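(* Let $\mathcal A$ be a Laurent phenomenon algebra of rank two, and let $t_1$ be a seed of $\mathcal A$ with cluster variables $x_1,x_2$ and exchange polynomials $F_1=P(x_2)$ (for $x_1$) and $F_2=Q(x_1)$ (for $x_2$) of degrees $c\ge 0$ (in $x_2$) and $b\ge 0$ (in $x_1$) respectively, and assume that $c\ge b$. Then $\mathcal A$ is of finite type if and only if either $b=0$, or $(b,c)$ is equal to one of $(1,1)$, $(1,2)$ and $(1,3)$.
   Context: Seeds. $S$ is a coefficient ring over $\mathbb Z$ which is a unique factorization domain; $n\ge 1$, $[n]=\{1,\dots,n\}$; the ambient field $\mathcal F$ is the field of rational functions in $n$ independent variables over $\mathrm{Frac}(S)$. A seed of rank $n$ in $\mathcal F$ is a pair $(\mathbf x,\mathbf F)$ where $\mathbf x=\{x_1,\dots,x_n\}$ (the cluster; its elements are cluster variables) is a transcendence basis of $\mathcal F$ over $\mathrm{Frac}(S)$, and $\mathbf F=\{F_1,\dots,F_n\}$ (the exchange polynomials) are polynomials in $\mathcal P=S[x_1,\dots,x_n]$ such that (LP1) each $F_i$ is irreducible in $\mathcal P$ and not divisible by any variable $x_j$; (LP2) $F_i$ does not involve $x_i$. The sets are unordered, but it is recorded which exchange polynomial belongs to which cluster variable. Write $f\propto g$ if $f,g\in\mathcal F$ differ multiplicatively by a unit of $S$. Exchange Laurent polynomials. For a seed, $\hat F_1,\dots,\hat F_n\in S[x_1^{\pm1},\dots,x_n^{\pm1}]$ are the unique elements such that $\hat F_i=\big(\prod_{k\ne i}x_k^{a_k}\big)F_i$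 for some integers $a_k\le 0$, and for all $j\neq i$ the element $\hat F_i|_{x_j\leftarrow F_j/x}$ lies in $S[x_1^{\pm1},\dots,x_{j-1}^{\pm1},x^{\pm1},x_{j+1}^{\pm1},\dots,x_n^{\pm1}]$ and is not divisible by $F_j$ in this ring. Mutation. For $i\in[n]$, $(\mathbf x',\mathbf F')=\mu_i(\mathbf x,\mathbf F)$ is obtained from $(\mathbf x,\mathbf F)$ by mutation at $i$ if it results from the following non-deterministic procedure. Put $x_i'=\hat F_i/x_i$ and $x_j'=x_j$ for $j\ne i$; $F_i'=F_i$. For $j\neq i$: if $F_j$ does not depend on $x_i$, then $F_j'$ is any polynomial in $\mathcal P'=S[x_1',\dots,x_n']$ with $F'_j\propto F_j$. If $F_j$ depends on $x_i$ (in which case $\hat F_i|_{x_j\leftarrow 0}$ is defined), put $G_j=F_j|_{x_i\leftarrow (\hat F_i|_{x_j\leftarrow0})/x_i'}$; let $H_j$ be $G_j$ with all common factors in $S[x_k:k\ne i,j]$ with $\hat F_i|_{x_j\leftarrow 0}$ removed (every irreducible factor of $\hat F_i|_{x_j\leftarrow0}$ is divided out of $G_j$ to the full power to which it divides $G_j$, monomials being immaterial); finally $F_j'=MH_j$ where $M$ is a Laurent monomial in the $x_k'$, $k\neq j$, with coefficient a unit in $S$, such that $F_j'\in\mathcal P'$, $F'_j$ does not involve $x'_j$, and $F_j'$ is not divisible by any variable of $\mathcal P'$. The result is always a seed. LP algebras. A Laurent phenomenon (LP) algebra of rank $n$ is a subring $\mathcal A\subset\mathcal F$ together with a distinguished collection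 of seeds in $\mathcal F$ such that: for each seed of the collection and each $i\in[n]$ we are given a seed of the collection obtained from it by mutation at $i$ (so seeds form the vertices of an $n$-regular graph whose edges are mutations); all seeds are connected by mutations; and $\mathcal A$ is generated over $S$ by all cluster variables of all the seeds. Normalization and finite type. Two seeds $(\mathbf x,\mathbf F)$, $(\mathbf x',\mathbf F')$ are equivalent if (for suitable indexing) $x_i\propto x_i'$ and $F_i\propto F_i'$ as elements of $\mathcal F$, for each $i$. An LP algebra is normalized if any two equivalent seeds of it are equal. An LP algebra $\mathcal A'$ is the normalization of an LP algebra $\mathcal A$ with the same ambient field if $\mathcal A'$ is normalized and there is a surjective map $p$ from the seeds of $\mathcal A$ to the seeds of $\mathcal A'$ such that $p(t)$ is equivalent to $t$ for each seed $t$ of $\mathcal A$ and $p(\mu_i(t))=\mu_i(p(t))$ for each $t$ and $i$. A normalized LP algebra is of finite type if it has finitely many seeds; an arbitrary LP algebra is of finite type if it has a normalization of finite type. *)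

(* Defs.v *)
From HB Require Import structures.
From mathcomp Require Import all_boot all_order all_fingroup all_algebra.
From mathcomp Require Import mpoly.

Set Implicit Arguments.
Unset Strict Implicit.
Unset Printing Implicit Defensive.

Import GRing.Theory.
Local Open Scope ring_scope.

Definition rdivides (R : idomainType) (a b : R) : Prop :=
  exists q, b = q * a.

Definition irreducible_elt (R : idomainType) (a : R) : Prop :=
  [/\ a != 0, a \isn't a GRing.unit &
      forall b c, a = b * c -> b \is a GRing.unit \/ c \is a GRing.unit].

Definition associated (R : idomainType) (a b : R) : Prop :=
  exists2 u, u \is a GRing.unit & a = u * b.

Definition is_ufd (R : idomainType) : Prop :=
  (forall a : R, a != 0 -> a \isn't a GRing.unit ->
     exists2 r : seq R, {in r, forall p, irreducible_elt p} &
                        a = \prod_(p <- r) p) /\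
  (forall r s : seq R,
     {in r, forall p, irreducible_elt p} ->
     {in s, forall p, irreducible_elt p} ->
     \prod_(p <- r) p = \prod_(p <- s) p ->
     exists2 s' : seq R, perm_eq s s' &
       size r = size s' /\
       forall k, (k < size r)%N -> associated r`_k s'`_k).

Definition involves (R : nzRingType) (n : nat) (i : 'I_n) (p : {mpoly R[n]})
    : bool :=
  has (fun m : 'X_{1..n} => m i != 0%N) (msupp p).

Section LaurentPhenomenon.

Variables (S : idomainType) (n : nat).

Definition ambient : fieldType := {fraction {mpoly {fraction S}[n]}}.
Local Notation K := ambient.

Definition frac_to_K : {fraction S} -> K :=
  @tofrac {mpoly {fraction S}[n]} \o @mpolyC n {fraction S}.
HB.instance Definition _ := GRing.RMorphism.on frac_to_K.

Definition S_to_K : S -> K := frac_to_K \o @tofrac S.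
HB.instance Definition _ := GRing.RMorphism.on S_to_K.

Definition propto (f g : K) : Prop :=
  exists2 u : S, u \is a GRing.unit & f = S_to_K u * g.

Definition ev (y : 'I_n -> K) (p : {mpoly S[n]}) : K := mmap S_to_K y p.

(* The value at y of the Laurent polynomial X^(-m) * p. *)
Definition lev (y : 'I_n -> K) (m : 'X_{1..n}) (p : {mpoly S[n]}) : K :=
  ev y p / mmap1 y m.

(* The ring S[y_1^{+-1}, ..., y_n^{+-1}], as a subset of the ambient field
   (for y algebraically independent), and divisibility by g in this ring. *)
Definition laurent (y : 'I_n -> K) (f : K) : Prop :=
  exists m p, f = lev y m p.

Definition ldivides (y : 'I_n -> K) (g f : K) : Prop :=
  exists2 q, laurent y q & f = q * g.

Definition subst (y : 'I_n -> K) (j : 'I_n) (f : K) : 'I_n -> K :=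
  [eta y with j |-> f].

Definition alg_independent (x : 'I_n -> K) : Prop :=
  forall p : {mpoly {fraction S}[n]}, mmap frac_to_K x p = 0 -> p = 0.

(* Every f is a root of a nonzero polynomial with coefficients in
   Frac(S)[x_1, ..., x_n]. *)
Definition alg_spanning (x : 'I_n -> K) : Prop :=
  forall f : K, exists2 p : {poly {mpoly {fraction S}[n]}},
    map_poly (mmap frac_to_K x) p != 0 &
    root (map_poly (mmap frac_to_K x) p) f.

Definition transcendence_basis (x : 'I_n -> K) : Prop :=
  alg_independent x /\ alg_spanning x.

(* A labelled seed (x, F): the i-th exchange polynomial is a polynomial in
   formal variables, 'X_k standing for the cluster variable x_k; as an element
   of the ambient field it is exchK t i. *)
Definition lseed : Type :=
  ({ffun 'I_n -> K} * {ffun 'I_n -> {mpoly S[n]}})%type.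

Definition clus (t : lseed) : {ffun 'I_n -> K} := t.1.
Definition exch (t : lseed) : {ffun 'I_n -> {mpoly S[n]}} := t.2.
Definition exchK (t : lseed) (i : 'I_n) : K := ev (clus t) (exch t i).

Definition is_seed (t : lseed) : Prop :=
  [/\ transcendence_basis (clus t),
      forall i, irreducible_elt (exch t i),
      forall i j, ~ rdivides 'X_j (exch t i) &
      forall i, ~~ involves i (exch t i)].

(* Seeds are unordered: an unordered seed is an orbit of labelled seeds under
   relabelling. The i-th variable of relabel s t is x_(s i); 'X_k is renamed
   to 'X_(s^-1 k) so that exchK (relabel s t) i = exchK t (s i). *)
Definition relabel (s : 'S_n) (t : lseed) : lseed :=
  ([ffun i => clus t (s i)], [ffun i => msym s^-1%g (exch t (s i))]).

Definition same_seed (t t' : lseed) : Prop := exists s, relabel s t = t'.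

Definition equiv_labelled (t t' : lseed) : Prop :=
  forall i, propto (clus t i) (clus t' i) /\ propto (exchK t i) (exchK t' i).

Definition equiv_seed (t t' : lseed) : Prop :=
  exists s, equiv_labelled (relabel s t) t'.

(* m encodes the exponents of the exchange Laurent polynomial of x_i:
   Fhat_i = X^(-m) * F_i, that is a_k = - m_k. The fresh variable x in the
   substitution x_j <- F_j / x reuses the slot of x_j, which is no longer
   present: F_j and the remaining variables do not involve x_j. *)
Definition exch_laurent (t : lseed) (i : 'I_n) (m : 'X_{1..n}) : Prop :=
  m i = 0%N /\
  forall j, j != i ->
    let f := lev (subst (clus t) j (exchK t j / clus t j)) m (exch t i) in
    laurent (clus t) f /\ ~ ldivides (clus t) (exchK t j) f.

(* Irreducible elements q of S[x_k : k <> i, j], other than variables, which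
   divide B in the Laurent polynomial ring. *)
Definition common_factor (x : 'I_n -> K) (i j : 'I_n) (B : K)
    (q : {mpoly S[n]}) : Prop :=
  [/\ irreducible_elt q, ~~ involves i q, ~~ involves j q,
      forall k, ~ rdivides 'X_k q & ldivides x (ev x q) B].

Definition factors_removed (x : 'I_n -> K) (i j : 'I_n) (B G H : K) : Prop :=
  [/\ laurent x H,
      exists2 r : seq {mpoly S[n]},
        {in r, forall q, common_factor x i j B q} &
        G = H * ev x (\prod_(q <- r) q) &
      forall q, common_factor x i j B q -> ~ ldivides x (ev x q) H].

(* t' is obtained from t by mutation at i. The element B below is
   Fhat_i with x_j <- 0; when F_j depends on x_i one has m j = 0, so that the
   total division in lev does not divide by 0. *)
Definition mutation (t : lseed) (i : 'I_n) (t' : lseed) : Prop :=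
  exists2 m, exch_laurent t i m &
  [/\ clus t' i = lev (clus t) m (exch t i) / clus t i,
      forall j, j != i -> clus t' j = clus t j,
      exchK t' i = exchK t i,
      forall j, j != i -> ~~ involves i (exch t j) ->
        propto (exchK t' j) (exchK t j) &
      forall j, j != i -> involves i (exch t j) ->
        let B := lev (subst (clus t) j 0) m (exch t i) in
        let G := ev (subst (clus t) i (B / clus t' i)) (exch t j) in
        exists H, factors_removed (clus t') i j B G H /\
        exists (u : S) (a : 'I_n -> int),
          [/\ u \is a GRing.unit,
              exchK t' j = S_to_K u * (\prod_(k | k != j) clus t' k ^ a k) * H,
              ~~ involves j (exch t' j) &
              forall k, ~ rdivides 'X_k (exch t' j)]].

(* The collection of unordered seeds is given by the set of all their
   labellings; lp_mu is only relevant on this set. *)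
Record lp_algebra : Type := LPAlgebra {
  lp_ring : K -> Prop;
  lp_seeds : lseed -> Prop;
  lp_mu : 'I_n -> lseed -> lseed;
  lp_seeds_relabel : forall s t, lp_seeds t -> lp_seeds (relabel s t);
  lp_mu_relabel : forall s i t, lp_seeds t ->
    lp_mu i (relabel s t) = relabel s (lp_mu (s i) t);
  lp_is_seed : forall t, lp_seeds t -> is_seed t;
  lp_seeds_mu : forall i t, lp_seeds t -> lp_seeds (lp_mu i t);
  lp_mutation : forall i t, lp_seeds t -> mutation t i (lp_mu i t);
  (* the mutation graph is undirected *)
  lp_mu_invol : forall i t, lp_seeds t -> lp_mu i (lp_mu i t) = t;
  lp_connected : forall t t', lp_seeds t -> lp_seeds t' ->
    exists w : seq 'I_n, same_seed (foldl (fun u i => lp_mu i u) t w) t';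
  lp_generated : forall f, lp_ring f <->
    exists k (y : 'I_k -> K) (p : {mpoly S[k]}),
      (forall l, exists t i, lp_seeds t /\ y l = clus t i) /\
      f = mmap S_to_K y p
}.

Definition normalized (A : lp_algebra) : Prop :=
  forall t t', lp_seeds A t -> lp_seeds A t' -> equiv_seed t t' ->
    same_seed t t'.

(* p is a map on unordered seeds, hence commutes with relabelling; p t is
   labelled according to its equivalence with t, so that mutation at i has the
   same meaning on both sides. *)
Definition normalization_of (A A' : lp_algebra) : Prop :=
  normalized A' /\
  exists p : lseed -> lseed,
    [/\ forall t, lp_seeds A t -> lp_seeds A' (p t),
        forall s t, lp_seeds A t -> p (relabel s t) = relabel s (p t),
        forall t', lp_seeds A' t' -> exists2 t, lp_seeds A t & p t = t',
        forall t, lp_seeds A t -> equiv_labelled (p t) t &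
        forall i t, lp_seeds A t -> p (lp_mu A i t) = lp_mu A' i (p t)].

(* Finitely many labelled seeds, or equivalently finitely many unordered ones,
   each of which has n! labellings. *)
Definition finitely_many_seeds (A : lp_algebra) : Prop :=
  exists r : seq lseed, forall t, lp_seeds A t -> t \in r.

Definition finite_type (A : lp_algebra) : Prop :=
  exists A', normalization_of A A' /\ finitely_many_seeds A'.

End LaurentPhenomenon.

(* Main.v *)
Require Import Defs.
From HB Require Import structures.
From mathcomp Require Import all_boot all_order all_fingroup all_algebra.
From mathcomp Require Import mpoly.
From mathcomp Require Import generic_quotient fraction ring zify.
From Stdlib Require Import Classical ClassicalEpsilon.
From Stdlib Require Import FunctionalExtensionality PropExtensionality.

Set Implicit Arguments.
Unset Strict Implicit.
Unset Printing Implicit Defensive.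

Import GRing.Theory.
Local Open Scope ring_scope.

(** Mutating alternately at the two positions produces a sequence of variables
x_k, any two consecutive ones forming a seed. When both exchange polynomials
are nonconstant, x_(k-1) x_(k+1) = P_k(x_k), where P_(k+2)(z) is the primitive
part of z^d P_k(P_(k+1)(0) / z), d being the degree of P_k. In particular the
degrees of the P_k alternate between b and c.

Equivalent seeds have equivalent mutations ([mutation_equiv]). Replacing each
variable by a representative of its class up to units, and scaling the exchange
polynomials so that the exchange relations hold exactly between
representatives, gives a normalization of any algebra ([normalizationP]).
Therefore finite type means that there are finitely many seeds up to
equivalence, and for this it is enough that four consecutive variables
reappear up to units at an even distance ([finite_type_of_period]).

If b and c are positive and bc >= 4, the degrees in x_1 of the variables,
starting from 0 and 1, satisfy d_(k+1) = e_k d_k - d_(k-1) with e_k alternately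
c and b; they increase along every second variable, so that infinitely many
seeds are inequivalent ([exchange_not_proportional]).

If b = 1 and c <= 3, the variables can be rescaled by elements of Frac(S) such
that P_0 = 1 + z and P_1(0) = 1. Then x_k and x_(k+5), x_(k+6) or x_(k+8), for
c = 1, 2, 3, are proportional over Frac(S) by identities between rational
functions ([period_linear], [period_quadratic], [period_cubic]). The factor of
proportionality is a unit of S. Indeed, since the P_k are primitive, the Gauss
valuation attached to an irreducible scalar is the same for all clusters of
the sequence ([gauss_unit_exchange]), hence vanishes at all variables
([propto_of_proportional]).

If b = 0, one exchange polynomial is a constant q, and the valuation attached to
q does depend on the cluster because x x' = q. Instead, the exchange Laurent
polynomials are unchanged, up to units, by mutation at the other position
([dual_laurent_exp]), and the variables have period four. The exception is a
pair of associated constant exchange polynomials, where the exchange Laurent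
polynomials are q / x and the variables have period three
([xseq_period3]). *)

(** * Divisibility and contents *)

Definition prime_elt (R : idomainType) (q : R) : Prop :=
  [/\ q != 0, q \isn't a GRing.unit &
      forall a b, rdivides q (a * b) -> rdivides q a \/ rdivides q b].

Lemma rdivides_mulr (R : idomainType) (q a b : R) :
  rdivides q a -> rdivides q (a * b).
Proof. by move=> [c ->]; exists (c * b); rewrite mulrAC. Qed.

Lemma rdividesB (R : idomainType) (q a b : R) :
  rdivides q a -> rdivides q b -> rdivides q (a - b).
Proof. by move=> [c ->] [d ->]; exists (c - d); rewrite mulrBl. Qed.

Lemma rdivides0 (R : idomainType) (q : R) : rdivides q 0.
Proof. by exists 0; rewrite mul0r. Qed.

Lemma irreducible_mul_unit (R : idomainType) (q c : R) :
  irreducible_elt q -> c \is a GRing.unit -> irreducible_elt (q * c).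
Proof.
move=> [q0 qu qi] cu; split.
- by rewrite mulf_neq0 // (memPn _ c cu) ?unitr0.
- by rewrite unitrM cu andbT.
move=> a b e.
have /qi[|] : q = a * (b / c).
  by apply: (mulIr cu); rewrite e mulrA mulrVK.
- by left.
- by rewrite unitrMl ?unitrV //; right.
Qed.

(** Compare the factorizations of a b and c q: the irreducible q is associated to
a factor of a or of b. *)
Lemma irreducible_prime (R : idomainType) (q : R) :
  is_ufd R -> irreducible_elt q -> prime_elt q.
Proof.
move=> [fact uniq] qi; have [q0 qu _] := qi; split=> // a b [c e].
have [->|a0] := eqVneq a 0; first by left; exact: rdivides0.
have [->|b0] := eqVneq b 0; first by right; exact: rdivides0.
have c0 : c != 0.
  apply/eqP => c0; move/eqP: e; rewrite c0 mul0r mulf_eq0.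
  by rewrite (negbTE a0) (negbTE b0).
have [au|au] := boolP (a \is a GRing.unit).
  by right; exists (a^-1 * c); rewrite -mulrA -e mulKr.
have [bu|bu] := boolP (b \is a GRing.unit).
  by left; exists (b^-1 * c); rewrite -mulrA -e mulrC mulrK.
have [ra hra ea] := fact _ a0 au; have [rb hrb eb] := fact _ b0 bu.
(* if the cofactor c is a unit, q' absorbs it *)
have [q' [r [hq' hr er]]] : exists q' r, [/\ irreducible_elt q' /\ rdivides q q',
    {in r, forall p, irreducible_elt p} & q' * \prod_(p <- r) p = c * q].
  have [cu|cu] := boolP (c \is a GRing.unit).
    exists (q * c), [::]; split => //; last by rewrite big_nil mulr1 mulrC.
    split; first exact: irreducible_mul_unit.
    by exists c; rewrite mulrC.
  have [rc hrc ec] := fact _ c0 cu.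
  exists q, rc; split => //; last by rewrite ec mulrC.
  by split => //; exists 1; rewrite mul1r.
have [] := uniq (q' :: r) (ra ++ rb).
- by move=> p; rewrite inE => /orP[/eqP->|/hr //]; case: hq'.
- by move=> p; rewrite mem_cat => /orP[/hra|/hrb].
- by rewrite big_cons er -e big_cat /= ea eb.
move=> s' ps [sz ass].
have /= [u uu eq'] := ass 0%N isT.
have s0 : s'`_0 \in ra ++ rb by rewrite (perm_mem ps) mem_nth // -sz.
have qs : rdivides q s'`_0.
  case: hq' => _ [d ed]; exists (u^-1 * d).
  by rewrite -mulrA -ed eq' mulKr.
have aux : forall r0 : seq R, s'`_0 \in r0 -> rdivides q (\prod_(p <- r0) p).
  by move=> r0 h; rewrite (big_rem _ h) /=; apply: rdivides_mulr.
by move: s0; rewrite mem_cat ea eb => /orP[/aux|/aux]; [left|right].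
Qed.

(** Gauss: the prime divides the product of the leading coefficients, hence one
of the two leading terms; stripping this term lowers a degree. *)
Lemma prime_polyC (R : idomainType) (q : R) :
  prime_elt q -> prime_elt (q%:P : {poly R}).
Proof.
move=> [q0 qu qp]; split; first by rewrite polyC_eq0.
  by rewrite poly_unitE coefC /= (negbTE qu) andbF.
suff main n : forall a b : {poly R}, (size a + size b <= n)%N ->
    rdivides q%:P (a * b) -> rdivides q%:P a \/ rdivides q%:P b.
  by move=> a b; apply: main.
elim: n => [|n IH] a b.
  rewrite leqn0 addn_eq0 !size_poly_eq0 => /andP[/eqP-> _] _.
  by left; exact: rdivides0.
move=> szn dab.
have [->|a0] := eqVneq a 0; first by left; exact: rdivides0.
have [->|b0] := eqVneq b 0; first by right; exact: rdivides0.
have step (a' b' : {poly R}) : a' != 0 -> (size a' + size b' <= n.+1)%N ->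
    rdivides q%:P (a' * b') -> rdivides q (lead_coef a') ->
    rdivides q%:P a' \/ rdivides q%:P b'.
  move=> a'0 sz' dab' [c ec].
  pose l := lead_coef a' *: 'X^((size a').-1).
  have dl : rdivides q%:P l.
    by exists (c *: 'X^((size a').-1)); rewrite mulrC mul_polyC scalerA mulrC -ec.
  have ssz : (size (a' - l)%R < size a')%N.
    rewrite (polySpred a'0) ltnS; apply/leq_sizeP => k hk.
    rewrite coefB coefZ coefXn; case: eqVneq => [->|kn].
      by rewrite mulr1 subrr.
    rewrite mulr0 nth_default ?subr0 // (polySpred a'0).
    by rewrite ltn_neqAle eq_sym kn.
  have [||da|] := IH (a' - l) b'; last by right.
  - by rewrite -ltnS (leq_trans _ sz') // ltn_add2r.
  - by rewrite mulrBl; apply: rdividesB => //; apply: rdivides_mulr.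
  left; case: da => d ed; case: dl => d' ed'.
  by exists (d + d'); rewrite mulrDl -ed -ed' subrK.
have : rdivides q (lead_coef a * lead_coef b).
  case: dab => d ed; exists (lead_coef d); rewrite -lead_coefM ed lead_coefM.
  by rewrite lead_coefC.
case/qp => h; first exact: (step a b).
case: (step b a) => //; rewrite 1?addnC 1?mulrC //; first by right.
by left.
Qed.


Definition prime_to (S T : idomainType) (h : S -> T) (a : T) : Prop :=
  forall q, irreducible_elt q -> prime_elt (h q) /\ ~ rdivides (h q) a.

(** Remove the irreducible factors of y one at a time: each divides h x * a, but
not a. *)
Lemma dvd_of_prime_to (S T : idomainType) (h : {rmorphism S -> T})
    (a b : T) (x y : S) :
  is_ufd S -> injective h ->
  (forall q s, rdivides (h q) (h s) -> rdivides q s) ->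
  prime_to h a -> x != 0 -> y != 0 -> h x * a = h y * b -> rdivides y x.
Proof.
move=> ufd hI hd pa x0 y0 e.
have unitcase z : z \is a GRing.unit -> forall w, rdivides z w.
  by move=> zu w; exists (w / z); rewrite mulrVK.
have [yu|yu] := boolP (y \is a GRing.unit); first exact: unitcase.
have [r hr ey] := ufd.1 y y0 yu.
move: x x0 e; rewrite {y y0 yu}ey; elim: r hr => [|q r IH] hr x x0.
  by move=> _; rewrite big_nil; apply: unitcase; exact: unitr1.
rewrite big_cons => e.
have qi : irreducible_elt q by apply: hr; rewrite mem_head.
have [[hq0 hqu hqp] nqa] := pa _ qi.
have /hqp[/hd|//] : rdivides (h q) (h x * a).
  by exists (h (\prod_(p <- r) p) * b); rewrite e rmorphM; ring.
case=> x' ex.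
have x'0 : x' != 0 by apply: contraNneq x0 => x'0; rewrite ex x'0 mul0r.
have [||c ec] := IH _ x' x'0.
- by move=> p pr; apply: hr; rewrite inE pr orbT.
- by apply: (mulfI hq0); rewrite mulrA [RHS]mulrA -!rmorphM -e ex [q * x']mulrC.
by exists c; rewrite ex ec; ring.
Qed.

Lemma associated_of_rdivides (R : idomainType) (a b : R) :
  a != 0 -> rdivides a b -> rdivides b a -> associated a b.
Proof.
move=> a0 [c ec] [d ed]; exists d => //.
apply/unitrP; exists c; split; apply: (mulIf a0); rewrite mul1r.
  by rewrite -mulrA [d * a]mulrC mulrA -ec mulrC -ed.
by rewrite -mulrA -ec -ed.
Qed.

(** Two proportional elements without scalar factors differ by a unit: each
irreducible factor of one scalar must divide the other scalar. *)
Lemma associated_of_prime_to (S T : idomainType) (h : {rmorphism S -> T})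
    (a b : T) (x y : S) :
  is_ufd S -> injective h ->
  (forall q s, rdivides (h q) (h s) -> rdivides q s) ->
  prime_to h a -> prime_to h b ->
  x != 0 -> y != 0 -> h x * a = h y * b -> associated x y.
Proof.
move=> ufd hI hd pa pb x0 y0 e; apply: associated_of_rdivides => //.
  by apply: (@dvd_of_prime_to _ _ h b a).
by apply: (@dvd_of_prime_to _ _ h a b).
Qed.

Lemma polyC2_inj (R : idomainType) : injective (polyC \o polyC : R -> {poly {poly R}}).
Proof. by move=> a b /polyC_inj/polyC_inj. Qed.

Lemma rdivides_polyC_coef (R : idomainType) (q : R) (p : {poly R}) :
  rdivides q%:P p <-> forall k, rdivides q p`_k.
Proof.
split=> [[r ->] k|h]; first by exists r`_k; rewrite coefMC.
have [f hf] := choice _ (fun k : nat => h k).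
exists (\poly_(k < size p) f k); apply/polyP=> k; rewrite coefMC coef_poly.
by case: ltnP => [//|/(nth_default 0) -> ]; rewrite mul0r.
Qed.

Lemma rdivides_polyC (R : idomainType) (q s : R) :
  rdivides q%:P s%:P -> rdivides q s.
Proof. by move/rdivides_polyC_coef/(_ 0%N); rewrite coefC. Qed.

Definition primitive (S : idomainType) (p : {poly S}) : Prop :=
  forall q : S, irreducible_elt q -> ~ rdivides q%:P p.

Lemma primitive_proportional (S : idomainType) (p r : {poly S}) (x y : S) :
  is_ufd S -> primitive p -> primitive r -> x != 0 -> y != 0 ->
  x *: p = y *: r -> associated x y.
Proof.
move=> ufd pp pr x0 y0 e.
apply: (@associated_of_prime_to _ _ (@polyC S) p r) => //.
- exact: polyC_inj.
- exact: rdivides_polyC.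
- by move=> q qi; split; [exact/prime_polyC/irreducible_prime | exact: pp].
- by move=> q qi; split; [exact/prime_polyC/irreducible_prime | exact: pr].
- by rewrite !mul_polyC.
Qed.

(** * Evaluation of bivariate polynomials *)

Section Bivariate.
Variables (S : idomainType) (K : fieldType) (h : {rmorphism S -> K}).
Implicit Types (x y f : K) (p : {poly S}) (a b : {poly {poly S}}).

Definition pev (x : K) : {poly S} -> K := horner_eval x \o map_poly h.
HB.instance Definition _ (x : K) := GRing.RMorphism.on (pev x).

(** The inner variable is evaluated at x and the outer one at y. *)
Definition ev2 (x y : K) : {poly {poly S}} -> K :=
  horner_eval y \o map_poly (pev x).
HB.instance Definition _ (x y : K) := GRing.RMorphism.on (ev2 x y).

Definition alg_free (x y : K) : Prop := forall a, ev2 x y a = 0 -> a = 0.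

Lemma pevE x p : pev x p = (map_poly h p).[x]. Proof. by []. Qed.

Lemma pevC x s : pev x s%:P = h s.
Proof. by rewrite pevE map_polyC /= hornerC. Qed.

Lemma pevX x : pev x 'X = x.
Proof. by rewrite pevE map_polyX hornerX. Qed.

Lemma pev_wide n x p : (size p <= n)%N ->
  pev x p = \sum_(k < n) h p`_k * x ^+ k.
Proof.
move=> sz; rewrite pevE (@horner_coef_wide _ n).
  by apply: eq_bigr => k _; rewrite coef_map.
by rewrite (leq_trans (size_poly _ _)).
Qed.

Lemma ev2C x y p : ev2 x y p%:P = pev x p.
Proof. by rewrite /ev2 /= map_polyC /= /horner_eval hornerC. Qed.

Lemma ev2X x y : ev2 x y 'X = y.
Proof. by rewrite /ev2 /= map_polyX /= /horner_eval hornerX. Qed.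

Lemma ev2_wide n x y a : (size a <= n)%N ->
  ev2 x y a = \sum_(k < n) pev x a`_k * y ^+ k.
Proof.
move=> sz; rewrite /ev2 /= /horner_eval (@horner_coef_wide _ n).
  by apply: eq_bigr => k _; rewrite coef_map.
by rewrite (leq_trans (size_poly _ _)).
Qed.

Lemma ev2_map_polyC x y p : ev2 x y (map_poly polyC p) = pev y p.
Proof.
rewrite (@ev2_wide (size p)) ?size_poly // (@pev_wide (size p)) //.
by apply: eq_bigr => k _; rewrite coef_map /= pevC.
Qed.

Lemma ev2_swapXY x y a : ev2 x y (swapXY a) = ev2 y x a.
Proof.
have main (m n : nat) : (size (swapXY a) <= m)%N -> (size a <= n)%N ->
    ev2 x y (swapXY a) = ev2 y x a.
  move=> sm sn; pose N := maxn m n.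
  have e (b : {poly {poly S}}) x' y' : (size b <= N)%N ->
     (size (swapXY b) <= N)%N ->
     ev2 x' y' b = \sum_(k < N) \sum_(l < N) h b`_k`_l * x' ^+ l * y' ^+ k.
    move=> sb ssb; rewrite (ev2_wide _ _ sb); apply: eq_bigr => k _.
    rewrite (@pev_wide N); first by rewrite mulr_suml.
    apply: leq_trans ssb; apply/leq_sizeP => j hj.
    by rewrite -coef_swapXY [(swapXY b)`_j]nth_default ?coef0.
  have sa : (size a <= N)%N by apply: leq_trans sn _; exact: leq_maxr.
  have ss : (size (swapXY a) <= N)%N by apply: leq_trans sm _; exact: leq_maxl.
  rewrite e ?swapXYK // exchange_big e //=; apply: eq_bigr => k _.
  by apply: eq_bigr => l _; rewrite coef_swapXY mulrAC.
exact: main (leqnn _) (leqnn _).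
Qed.

Lemma alg_freeC x y : alg_free x y -> alg_free y x.
Proof.
move=> fxy a; rewrite -ev2_swapXY => /fxy /eqP.
by rewrite swapXY_eq0 => /eqP.
Qed.

Lemma ev2_inj x y : alg_free x y -> injective (ev2 x y).
Proof. by move=> fxy a b /eqP; rewrite -subr_eq0 -rmorphB => /eqP/fxy/subr0_eq. Qed.

Lemma pev_inj x y : alg_free x y -> injective (pev x).
Proof. by move=> fxy a b; rewrite -!(ev2C x y) => /(ev2_inj fxy)/polyC_inj. Qed.

Lemma alg_free_neq0 x y : alg_free x y -> y != 0.
Proof.
by move=> fxy; apply/eqP => y0; have := fxy 'X; rewrite ev2X => /(_ y0)/eqP; rewrite polyX_eq0.
Qed.

Lemma alg_free_inj x y : alg_free x y -> injective h.
Proof.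
move=> fxy a b e; have := @pev_inj x y fxy a%:P b%:P.
by rewrite !pevC => /(_ e)/polyC_inj.
Qed.

(** The elements at which, for every irreducible scalar q, the Gauss valuation
extending the q-adic one from Frac(S) to Frac(S)(x, y) vanishes. *)
Definition gauss_unit (x y f : K) : Prop :=
  exists a b, [/\ prime_to (polyC \o polyC) a, prime_to (polyC \o polyC) b &
                  f * ev2 x y b = ev2 x y a].

Hypothesis ufd : is_ufd S.

Let c2 : S -> {poly {poly S}} := polyC \o polyC.

Lemma prime_polyC2 q : irreducible_elt q -> prime_elt (c2 q).
Proof. by move/(irreducible_prime ufd)/prime_polyC/prime_polyC. Qed.

Lemma prime_to1 : prime_to c2 1.
Proof.
move=> q qi; have qp := prime_polyC2 qi; split=> // -[d /esym e].
by case: qp => _ /unitrP[]; exists d; split=> //; rewrite mulrC.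
Qed.

Lemma prime_toM a b : prime_to c2 a -> prime_to c2 b -> prime_to c2 (a * b).
Proof.
move=> pa pb q qi; have [qp na] := pa q qi; have [_ nb] := pb q qi.
by split=> //; case: qp => _ _ qp /qp[].
Qed.

Lemma rdivides_polyC2_coef q (a : {poly {poly S}}) :
  rdivides (c2 q) a <-> forall i j, rdivides q a`_i`_j.
Proof.
split=> [/rdivides_polyC_coef da i|da]; first exact/rdivides_polyC_coef/da.
by apply/rdivides_polyC_coef => i; apply/rdivides_polyC_coef.
Qed.

Lemma prime_to_swapXY a : prime_to c2 a -> prime_to c2 (swapXY a).
Proof.
move=> pa q qi; have [qp na] := pa q qi; split=> // /rdivides_polyC2_coef da.
by case: na; apply/rdivides_polyC2_coef => i j; rewrite -coef_swapXY.
Qed.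

Lemma prime_to_polyC p : primitive p -> prime_to c2 p%:P.
Proof.
move=> pp q qi; split; first exact: prime_polyC2.
by move/rdivides_polyC/(pp _ qi).
Qed.

Lemma gauss_unitC x y f : gauss_unit x y f -> gauss_unit y x f.
Proof.
move=> [a [b [pa pb e]]]; exists (swapXY a), (swapXY b).
by split; rewrite ?ev2_swapXY //; exact: prime_to_swapXY.
Qed.

Lemma gauss_unit_pev x y p : primitive p -> gauss_unit x y (pev x p).
Proof.
move=> pp; exists p%:P, 1; split; first exact: prime_to_polyC.
  exact: prime_to1.
by rewrite rmorph1 mulr1 ev2C.
Qed.

Lemma primitiveX : primitive ('X : {poly S}).
Proof.
move=> q [_ qu _] /rdivides_polyC_coef/(_ 1%N)[d]; rewrite coefX /= => e.
by move/unitrP: qu; case; exists d; rewrite -e mulrC -e.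
Qed.

Lemma gauss_unit_var x y : gauss_unit x y x.
Proof. by have := gauss_unit_pev x y primitiveX; rewrite pevX. Qed.

(** Substituting y = P(x) / y' in a polynomial and clearing denominators
multiplies its coefficients by powers of the primitive polynomial P, so by
Gauss no scalar factor appears. *)
Lemma gauss_unit_exchange x y y' f (p : {poly S}) :
  primitive p -> y' != 0 -> y * y' = pev x p ->
  gauss_unit x y f -> gauss_unit x y' f.
Proof.
move=> pp y'0 e [a [b [pa pb ef]]].
(* hat c represents y'^N c(x, P(x) / y') *)
pose N := maxn (size a) (size b).
pose hat (c : {poly {poly S}}) := \poly_(l < N.+1) (c`_(N - l) * p ^+ (N - l)).
have hatE (c : {poly {poly S}}) : (size c <= N)%N -> ev2 x y' (hat c) = ev2 x y c * y' ^+ N.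
  move=> sc; rewrite (@ev2_wide N.+1) ?size_poly //.
  rewrite (@ev2_wide N.+1 x y c) ?(leq_trans sc) // mulr_suml.
  rewrite (reindex_inj rev_ord_inj) /=; apply: eq_bigr => k _.
  have kN : (k <= N)%N by rewrite -ltnS.
  rewrite coef_poly subSS ltnS leq_subr subKn // rmorphM rmorphXn /= -e.
  by rewrite exprMn -!mulrA -exprD subnKC.
have hatP (c : {poly {poly S}}) : (size c <= N)%N -> prime_to c2 c -> prime_to c2 (hat c).
  move=> sc pc q qi; have [qp nc] := pc q qi; split=> // /rdivides_polyC_coef dh.
  case: nc; apply/rdivides_polyC_coef => k.
  have [kN|kN] := leqP k N; last first.
    by rewrite nth_default; [exact: rdivides0 | exact: leq_trans (ltnW kN)].
  have [_ _ prm] := prime_polyC (irreducible_prime ufd qi).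
  suff strip m : rdivides q%:P (c`_k * p ^+ m) -> rdivides q%:P c`_k.
    by have := dh (N - k)%N; rewrite coef_poly ltnS leq_subr subKn // => /strip.
  elim: m => [|m IH]; first by rewrite mulr1.
  by rewrite exprSr mulrA => /prm[/IH|/(pp _ qi)].
exists (hat a), (hat b); split.
- by apply: hatP; rewrite ?leq_maxl.
- by apply: hatP; rewrite ?leq_maxr.
- by rewrite !hatE ?leq_maxl ?leq_maxr // mulrA ef.
Qed.

(** The two scalars have the same valuation at every irreducible. *)
Lemma associated_of_gauss_unit x y f g (s t : S) :
  alg_free x y -> gauss_unit x y f -> gauss_unit x y g ->
  s != 0 -> t != 0 -> h s * f = h t * g -> associated s t.
Proof.
move=> fxy [a [b [pa pb ef]]] [c [d [pc pd eg]]] s0 t0 e.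
have dvd q r : rdivides (c2 q) (c2 r) -> rdivides q r.
  by move=> /rdivides_polyC/rdivides_polyC.
apply: (associated_of_prime_to ufd (@polyC2_inj S) dvd
          (prime_toM pa pd) (prime_toM pc pb) s0 t0).
apply: (ev2_inj fxy); rewrite !rmorphM /= !ev2C !pevC -ef -eg.
transitivity ((h s * f) * (ev2 x y b * ev2 x y d)); first by ring.
by rewrite e; ring.
Qed.

End Bivariate.

(** * Rank two exchange recurrences up to rescaling *)

(** The polynomial z^d p(a/z), where d is the degree of p. *)
Definition revp (R : nzRingType) (p : {poly R}) (a : R) : {poly R} :=
  \poly_(k < size p) (p`_((size p).-1 - k) * a ^+ ((size p).-1 - k)).

Lemma size_revp (R : idomainType) (p : {poly R}) a :
  p`_0 != 0 -> size (revp p a) = size p.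
Proof.
move=> p0; have p_gt0 : (0 < size p)%N.
  by rewrite size_poly_gt0; apply: contraNneq p0 => ->; rewrite coef0.
by rewrite /revp size_poly_eq // subnn expr0 mulr1.
Qed.

Lemma coef0_revp (R : nzRingType) (p : {poly R}) a :
  (revp p a)`_0 = lead_coef p * a ^+ (size p).-1.
Proof.
rewrite coef_poly subn0; case: (posnP (size p)) => // /eqP.
by rewrite size_poly_eq0 => /eqP->; rewrite lead_coef0 mul0r.
Qed.

Lemma map_revp (R R' : idomainType) (f : {rmorphism R -> R'}) (p : {poly R}) a :
  injective f -> map_poly f (revp p a) = revp (map_poly f p) (f a).
Proof.
move=> fI; apply/polyP => k; rewrite coef_map_id0 ?rmorph0 // /revp [in RHS]coef_poly [in LHS]coef_poly.
rewrite size_map_inj_poly ?rmorph0 //.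
by case: ifP => _; rewrite ?rmorph0 // rmorphM rmorphXn coef_map_id0 ?rmorph0.
Qed.

Lemma revp_Poly (R : nzRingType) (s : seq R) (a : R) : last 1 s != 0 ->
  revp (Poly s) a =
  Poly (mkseq (fun k => s`_((size s).-1 - k) * a ^+ ((size s).-1 - k)) (size s)).
Proof.
move=> ls; have e : size (Poly s) = size s by rewrite (PolyK ls).
apply/polyP => k; rewrite /revp coef_poly !coef_Poly e.
case: ltnP => hk; first by rewrite nth_mkseq.
by rewrite nth_default // size_mkseq.
Qed.

Section Rescaling.
Variables (A : idomainType) (K : fieldType) (h : {rmorphism A -> K}).
Implicit Types (x y : K) (p r : {poly A}).

(** The identity p(l z) = m r(z), together with x = l y: the pairs of a variable
and its exchange polynomial are the same up to units. *)
Definition rescaling l m x p y r : Prop :=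
  [/\ l \is a GRing.unit, m \is a GRing.unit, x = h l * y &
      forall k, p`_k * l ^+ k = m * r`_k].
Definition rescaled x p y r : Prop := exists l m, rescaling l m x p y r.

Lemma unit_neq0 (l : A) : l \is a GRing.unit -> l != 0.
Proof. by apply: contraTneq => ->; rewrite unitr0. Qed.

Lemma rescaling_size l m x p y r : rescaling l m x p y r -> size p = size r.
Proof.
move=> [lu mu _ e]; apply/eqP; rewrite eqn_leq; apply/andP; split.
  apply/leq_sizeP => k hk; apply: (mulIf (expf_neq0 k (unit_neq0 lu))).
  by rewrite e nth_default // mulr0 mul0r.
apply/leq_sizeP => k hk; apply: (mulfI (unit_neq0 mu)).
by rewrite -e nth_default // mulr0 mul0r.
Qed.

Lemma rescaling_pev l m x p y r : rescaling l m x p y r ->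
  pev h x p = h m * pev h y r.
Proof.
move=> xy; have sz := rescaling_size xy; case: xy => lu mu ex e.
rewrite !(@pev_wide _ _ h (size p)) ?sz // mulr_sumr.
apply: eq_bigr => k _; rewrite ex exprMn !mulrA -rmorphXn -!rmorphM.
by rewrite e.
Qed.

Lemma rescaledZ c x p y r : c \is a GRing.unit ->
  rescaled x p y r -> rescaled x (c *: p) y r.
Proof.
move=> cu [l [m [lu mu ex e]]]; exists l, (c * m); split; rewrite ?unitrM ?cu //.
by move=> k; rewrite coefZ -mulrA e mulrA.
Qed.

(** One step of the recurrence commutes with rescaling, because
z^d p0(p1(0) / z) is homogeneous in the data: rescaling x0 by l0 and p1 by m1
rescales x2 by m1 / l0. *)
Lemma rescaled_exchange x0 x1 x2 y0 y1 y2 p0 p1 r0 r1 :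
  x0 != 0 ->
  rescaled x0 p0 y0 r0 -> rescaled x1 p1 y1 r1 ->
  x0 * x2 = pev h x1 p1 -> y0 * y2 = pev h y1 r1 ->
  rescaled x2 (revp p0 p1`_0) y2 (revp r0 r1`_0).
Proof.
move=> x00 [l0 [m0 s0]] [l1 [m1 s1]] ex ey.
have em1 := rescaling_pev s1; have sz := rescaling_size s0.
case: s0 => l0u m0u ex0 e0; case: s1 => l1u m1u _ e1.
have p10 : p1`_0 = m1 * r1`_0 by rewrite -e1 mulr1.
have y00 : y0 != 0 by apply: contraNneq x00 => y00; rewrite ex0 y00 mulr0.
have hl0 : h l0 \is a GRing.unit by apply: rmorph_unit.
exists (m1 / l0), (m0 * (m1 / l0) ^+ (size r0).-1).
split; rewrite ?unitrM ?unitrX ?unitrM ?unitrV ?m0u ?m1u ?l0u //.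
  apply: (mulfI x00); rewrite ex em1 -ey ex0 rmorphM rmorphV //=.
  by field; rewrite -unitfE.
move=> k; rewrite !coef_poly sz; case: ltnP => [hk|]; last by rewrite mulr0 mul0r.
set b := (size r0).-1; have kb : (k <= b)%N by rewrite /b -ltnS (ltn_predK hk).
have e : p0`_(b - k) = m0 * r0`_(b - k) * l0 ^- (b - k).
  by rewrite -e0 mulrK // unitrX.
have -> : (m1 / l0) ^+ b = (m1 / l0) ^+ (b - k) * (m1 / l0) ^+ k.
  by rewrite -exprD subnK.
rewrite e p10 !exprMn -!exprVn; move: (b - k)%N (l0^-1) => j l0V; ring.
Qed.

End Rescaling.

(** * Periods of the exchange recurrences *)

Section Periods.
Variables (F K : fieldType) (h : {rmorphism F -> K}).
Implicit Types (x : nat -> K) (p : nat -> {poly F}).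

Lemma pev_Poly_cons (y : K) a (s : seq F) :
  pev h y (Poly (a :: s)) = pev h y (Poly s) * y + h a.
Proof. by rewrite /= cons_poly_def rmorphD rmorphM /= pevX pevC. Qed.

Lemma pev_Poly_nil (y : K) : pev h y (Poly [::]) = 0.
Proof. exact: rmorph0. Qed.

(** Exchange relations over a field of coefficients, where exchange polynomials
matter up to a nonzero scalar only. The values p_k(x_k) are required to be
nonzero as they occur as denominators when the sequence is continued backwards. *)
Definition exchange_seq x p : Prop :=
  [/\ forall k, x k != 0 /\ pev h (x k) (p k) != 0,
      forall k, x k * x k.+2 = pev h (x k.+1) (p k.+1),
      forall k, (p k)`_0 != 0 &
      forall k, exists2 c, c != 0 & p k.+2 = c *: revp (p k) (p k.+1)`_0].

Lemma exchange_seq_shift n x p : exchange_seq x p ->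
  exchange_seq (fun k => x (n + k)%N) (fun k => p (n + k)%N).
Proof.
by move=> [x0 ex p0 ep]; split=> k; rewrite ?addnS.
Qed.

Lemma exchange_seq_step x p k (y0 y1 y2 : K) s0 s1 s2 :
  exchange_seq x p ->
  rescaled h (x k) (p k) y0 (Poly s0) ->
  rescaled h (x k.+1) (p k.+1) y1 (Poly s1) ->
  last 1 s0 != 0 -> y0 * y2 = pev h y1 (Poly s1) ->
  s2 = mkseq (fun k => s0`_((size s0).-1 - k) * s1`_0 ^+ ((size s0).-1 - k))
         (size s0) ->
  rescaled h (x k.+2) (p k.+2) y2 (Poly s2).
Proof.
move=> [x0 ex p0 ep] r0 r1 l0 ey ->; have [c c0 ->] := ep k.
apply: rescaledZ; first by rewrite unitfE.
rewrite -revp_Poly // -[s1`_0]coef_Poly.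
by apply: rescaled_exchange (ex k) ey => //; case: (x0 k).
Qed.

Lemma rescaled_neq0 (x0 : K) (p : {poly F}) y0 r0 : rescaled h x0 p y0 r0 ->
  x0 != 0 -> y0 != 0.
Proof. by move=> [l [m [_ _ -> _]]]; apply: contraNneq => ->; rewrite mulr0. Qed.

(** Rescaling z by the quotient of the two coefficients takes p_0 to 1 + z. *)
Lemma exchange_seq_start x p : exchange_seq x p ->
  size (p 0%N) = 2 -> exists2 y0 : K,
    rescaled h (x 0%N) (p 0%N) y0 (Poly [:: 1; 1]) & 1 + y0 != 0.
Proof.
move=> [x0 ex p0 ep] sz; set a := (p 0%N)`_0; set b := (p 0%N)`_1.
have a0 : a != 0 := p0 0%N.
have b0 : b != 0.
  by have := lead_coef_eq0 (p 0%N); rewrite lead_coefE sz -size_poly_eq0 sz => ->.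
have r0 : rescaled h (x 0%N) (p 0%N) (h (b / a) * x 0%N) (Poly [:: 1; 1]).
  exists (a / b), a; split; rewrite ?unitfE ?mulf_neq0 ?invr_neq0 //.
    rewrite mulrA -rmorphM (_ : a / b * (b / a) = 1) ?rmorph1 ?mul1r //.
    by field; rewrite a0 b0.
  move=> [|[|k]]; rewrite coef_Poly //= ?mulr1 -/a -/b //.
    by field.
  by rewrite !nth_default ?sz // ?mulr0 ?mul0r.
exists (h (b / a) * x 0%N) => //.
case: r0 => l [m r0]; have := rescaling_pev r0.
have [_] := x0 0%N; rewrite !pev_Poly_cons pev_Poly_nil => + e.
rewrite e; apply: contraNneq => e1.
by rewrite !rmorph1 mul0r add0r mul1r addrC e1 mulr0.
Qed.

Lemma rescaled_normalize (x0 : K) (p0 : {poly F}) : p0`_0 != 0 ->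
  rescaled h x0 p0 x0 ((p0`_0)^-1 *: p0).
Proof.
move=> p00; exists 1, p0`_0; split; rewrite ?unitr1 ?unitfE ?rmorph1 ?mul1r //.
by move=> k; rewrite expr1n mulr1 coefZ mulrA divff ?mul1r.
Qed.

Lemma rescaled_prop (x0 : K) (p : {poly F}) y0 r0 : rescaled h x0 p y0 r0 ->
  exists2 l, l != 0 & x0 = h l * y0.
Proof. by move=> [l [m [lu _ e _]]]; exists l => //; rewrite -unitfE. Qed.

Definition proportional (u v : K) : Prop := exists2 l : F, l != 0 & u = h l * v.

Lemma proportional_sym u v : proportional u v -> proportional v u.
Proof.
move=> [l l0 ->]; exists l^-1; rewrite ?invr_neq0 //.
by rewrite mulrA -rmorphM mulVf // rmorph1 mul1r.
Qed.

Lemma proportional_trans u v w :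
  proportional u v -> proportional v w -> proportional u w.
Proof.
move=> [l l0 ->] [m m0 ->]; exists (l * m); rewrite ?mulf_neq0 //.
by rewrite mulrA rmorphM.
Qed.

End Periods.

Section FinitePeriods.
Variables (F K : fieldType) (h : {rmorphism F -> K}).
Implicit Types (x : nat -> K) (p : nat -> {poly F}).

(** Exchanging x and u is the reflection of the sequence of variables about y:
it takes y3 and y4 to m1 and m2. The fourth variable on either side of y is the
same element y5, and the next one is r m2, so that the sequence comes back
through m1 to x. *)
Lemma cubic_reflection (x y p q r u y3 y4 m1 m2 : K) :
  x != 0 -> y != 0 -> u != 0 -> 1 + u != 0 -> 1 + x != 0 ->
  x * u = 1 + p * y + q * y ^+ 2 + r * y ^+ 3 ->
  y3 = (1 + u) / y -> m1 = (1 + x) / y ->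
  y4 = (y3 ^+ 3 + p * y3 ^+ 2 + q * y3 + r) / u ->
  m2 = (m1 ^+ 3 + p * m1 ^+ 2 + q * m1 + r) / x ->
  let y5 := (r + m2) / m1 in
  y3 * y5 = r + y4 /\
  y4 * (r * m2) = r ^+ 3 + p * r ^+ 2 * y5 + q * r * y5 ^+ 2 + r * y5 ^+ 3.
Proof.
move=> x0 y0 u0 u1 x1 e -> -> -> ->.
have -> : r = (x * u - 1 - p * y - q * y ^+ 2) / y ^+ 3 by rewrite e; field.
by split; field; rewrite ?x0 ?y0 ?u0 ?u1 ?x1.
Qed.

(** The same reflection for an exchange polynomial of degree two, for which the
fourth variable after y is already m1. *)
Lemma quadratic_reflection (x y p q u y3 y4 m1 : K) :
  x != 0 -> y != 0 -> u != 0 ->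
  x * u = 1 + p * y + q * y ^+ 2 ->
  y3 = (1 + u) / y -> m1 = (1 + x) / y ->
  y4 = (y3 ^+ 2 + p * y3 + q) / u ->
  y3 * m1 = q + y4 /\ y4 * (q * x) = q ^+ 2 + p * q * m1 + q * m1 ^+ 2.
Proof.
move=> x0 y0 u0 e -> -> ->.
have -> : q = (x * u - 1 - p * y) / y ^+ 2 by rewrite e; field.
by split; field; rewrite ?x0 ?y0 ?u0.
Qed.

(** Dividing p_1 by its constant term leaves the variable unchanged. *)
Lemma normalize_exchange x p n : exchange_seq h x p -> size (p 1%N) = n.+2 ->
  exists s : seq F, [/\ size s = n.+1, last 1 s != 0 &
    rescaled h (x 1%N) (p 1%N) (x 1%N) (Poly (1 :: s))].
Proof.
move=> [_ _ p0 _] sz; have r := rescaled_normalize h (x 1%N) (p0 1%N).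
set q := (_ *: _) in r.
have szq : size q = n.+2 by rewrite size_scale ?invr_neq0.
have q0 : q`_0 = 1 by rewrite coefZ mulVf.
exists (behead q); split; first by rewrite size_behead szq.
  have : lead_coef q != 0 by rewrite lead_coef_eq0 -size_poly_eq0 szq.
  rewrite lead_coefE (last_nth 0) szq size_behead szq /=.
  by move: szq; case: (q : seq F) => //= a s' [->].
suff <- : (q : seq F) = 1 :: behead q by rewrite polyseqK.
by move: szq q0; case: (q : seq F) => //= a s' _ ->.
Qed.

(** The variables are followed through closed forms y_k with normalized exchange
polynomials; the powers of d are the scalars by which y8 and y9 differ from y0
and y1. *)
Lemma period_cubic x p : exchange_seq h x p ->
  size (p 0%N) = 2 -> size (p 1%N) = 4 ->
  proportional h (x 8%N) (x 0%N) /\ proportional h (x 9%N) (x 1%N).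
Proof.
move=> hs s0 s1; have [y0 r0 x1] := exchange_seq_start hs s0.
have [s [ss ls r1]] := normalize_exchange hs s1.
case: s ss ls r1 => [|b [|c [|d [|? ?]]]] // _ d0 r1; rewrite /= in d0.
have [nz _ _ _] := hs.
have y00 := rescaled_neq0 r0 (proj1 (nz 0%N)).
have y10 : x 1%N != 0 := proj1 (nz 1%N).
have hd0 : h d != 0 by rewrite fmorph_eq0.
have [y ey] : exists y, y = x 1%N by exists (x 1%N).
rewrite -ey in y10; rewrite -{2}ey in r1.
pose u := (1 + h b * y + h c * y ^+ 2 + h d * y ^+ 3) / y0.
have eu : y0 * u = 1 + h b * y + h c * y ^+ 2 + h d * y ^+ 3.
  by rewrite mulrC divfK.
have r2 : rescaled h (x 2%N) (p 2%N) u (Poly [:: 1; 1]).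
  apply: (exchange_seq_step hs r0 r1); rewrite ?oner_neq0 //.
    by rewrite eu !pev_Poly_cons pev_Poly_nil rmorph1; ring.
  by rewrite /mkseq /= !expr1n !mulr1.
have u0 := rescaled_neq0 r2 (proj1 (nz 2%N)).
pose y3 := (1 + u) / y.
have r3 : rescaled h (x 3%N) (p 3%N) y3 (Poly [:: d; c; b; 1]).
  apply: (exchange_seq_step hs r1 r2) => //.
    by rewrite !pev_Poly_cons pev_Poly_nil rmorph1 mulrC divfK //; ring.
  by rewrite /mkseq /= !expr1n !mulr1.
have y30 := rescaled_neq0 r3 (proj1 (nz 3%N)).
have u1 : 1 + u != 0 by apply: contraNneq y30 => e; rewrite /y3 e mul0r.
pose y4 := (y3 ^+ 3 + h b * y3 ^+ 2 + h c * y3 + h d) / u.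
have r4 : rescaled h (x 4%N) (p 4%N) y4 (Poly [:: d; 1]).
  apply: (exchange_seq_step hs r2 r3); rewrite ?oner_neq0 //.
    by rewrite !pev_Poly_cons pev_Poly_nil rmorph1 mulrC divfK //; ring.
  by rewrite /mkseq /= subnn subn0 !mul1r.
(* the two variables preceding y0, up to scalars *)
pose m1 := (1 + y0) / y.
pose m2 := (m1 ^+ 3 + h b * m1 ^+ 2 + h c * m1 + h d) / y0.
have m10 : m1 != 0 by rewrite mulf_neq0 ?invr_neq0.
have [e5 e6] := @cubic_reflection _ _ _ _ _ _ y3 y4 m1 m2 y00 y10 u0 u1 x1 eu
  erefl erefl erefl erefl.
pose y5 := (h d + m2) / m1; rewrite -/y5 in e5 e6.
have r5 : rescaled h (x 5%N) (p 5%N) y5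
    (Poly [:: d ^+ 3; b * d ^+ 2; c * d; d]).
  apply: (exchange_seq_step hs r3 r4); rewrite ?oner_neq0 //.
    by rewrite !pev_Poly_cons pev_Poly_nil rmorph1 e5; ring.
  by rewrite /mkseq /= ?subn0 !subSS ?subn0 ?subnn ?mul1r ?expr1 ?mulr1.
have r6 : rescaled h (x 6%N) (p 6%N) (h d * m2) (Poly [:: d ^+ 3; d]).
  apply: (exchange_seq_step hs r4 r5); rewrite ?oner_neq0 //.
    by rewrite !pev_Poly_cons pev_Poly_nil e6; ring.
  by rewrite /mkseq /= ?subn0 ?subnn ?mul1r ?mulr1.
have y50 := rescaled_neq0 r5 (proj1 (nz 5%N)).
have m20 : m2 != 0.
  have := rescaled_neq0 r6 (proj1 (nz 6%N)).
  by apply: contraNneq => ->; rewrite mulr0.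
have e7 : y5 * m1 = h d + m2 by rewrite divfK.
have r7 : rescaled h (x 7%N) (p 7%N) (h d ^+ 2 * m1)
    (Poly [:: d ^+ 10; c * d ^+ 7; b * d ^+ 5; d ^+ 3]).
  apply: (exchange_seq_step hs r5 r6) => //.
    rewrite !pev_Poly_cons pev_Poly_nil mulrCA e7; ring.
  by rewrite /mkseq /= ?subn0 !subSS ?subn0 ?subnn; congr [:: _; _; _; _]; ring.
have e8 : y0 * m2 = m1 ^+ 3 + h b * m1 ^+ 2 + h c * m1 + h d.
  by rewrite mulrC divfK.
have r8 : rescaled h (x 8%N) (p 8%N) (h d ^+ 8 * y0) (Poly [:: d ^+ 11; d ^+ 3]).
  apply: (exchange_seq_step hs r6 r7) => //.
    rewrite !pev_Poly_cons pev_Poly_nil.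
    transitivity (h d ^+ 9 * (y0 * m2)); first by ring.
    by rewrite e8; ring.
  by rewrite /mkseq /= ?subn0 ?subnn; congr [:: _; _]; ring.
have e9 : y * m1 = 1 + y0 by rewrite mulrC divfK.
have r9 : exists s9, rescaled h (x 9%N) (p 9%N) (h d ^+ 9 * y) (Poly s9).
  eexists; apply: (exchange_seq_step hs r7 r8); rewrite //.
    by rewrite /= expf_neq0.
  rewrite !pev_Poly_cons pev_Poly_nil.
  transitivity (h d ^+ 11 * (y * m1)); first by ring.
  by rewrite e9; ring.
have dn n : d ^+ n != 0 by rewrite expf_neq0.
split.
  apply: proportional_trans (proportional_sym (rescaled_prop r0)).
  apply: proportional_trans (rescaled_prop r8) _.
  by exists (d ^+ 8); rewrite ?rmorphXn.
case: r9 => s9 /rescaled_prop r9; rewrite -ey; apply: proportional_trans r9 _.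
by exists (d ^+ 9); rewrite ?rmorphXn.
Qed.

Lemma period_quadratic x p : exchange_seq h x p ->
  size (p 0%N) = 2 -> size (p 1%N) = 3 ->
  proportional h (x 6%N) (x 0%N) /\ proportional h (x 7%N) (x 1%N).
Proof.
move=> hs s0 s1; have [y0 r0 x1] := exchange_seq_start hs s0.
have [s [ss ls r1]] := normalize_exchange hs s1.
case: s ss ls r1 => [|b [|d [|? ?]]] // _ d0 r1; rewrite /= in d0.
have [nz _ _ _] := hs.
have y00 := rescaled_neq0 r0 (proj1 (nz 0%N)).
have y10 : x 1%N != 0 := proj1 (nz 1%N).
have hd0 : h d != 0 by rewrite fmorph_eq0.
have [y ey] : exists y, y = x 1%N by exists (x 1%N).
rewrite -ey in y10; rewrite -{2}ey in r1.
pose u := (1 + h b * y + h d * y ^+ 2) / y0.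
have eu : y0 * u = 1 + h b * y + h d * y ^+ 2 by rewrite mulrC divfK.
have r2 : rescaled h (x 2%N) (p 2%N) u (Poly [:: 1; 1]).
  apply: (exchange_seq_step hs r0 r1); rewrite ?oner_neq0 //.
    by rewrite eu !pev_Poly_cons pev_Poly_nil rmorph1; ring.
  by rewrite /mkseq /= !expr1n !mulr1.
have u0 := rescaled_neq0 r2 (proj1 (nz 2%N)).
pose y3 := (1 + u) / y.
have r3 : rescaled h (x 3%N) (p 3%N) y3 (Poly [:: d; b; 1]).
  apply: (exchange_seq_step hs r1 r2) => //.
    by rewrite !pev_Poly_cons pev_Poly_nil rmorph1 mulrC divfK //; ring.
  by rewrite /mkseq /= !expr1n !mulr1.
have y30 := rescaled_neq0 r3 (proj1 (nz 3%N)).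
pose y4 := (y3 ^+ 2 + h b * y3 + h d) / u.
have r4 : rescaled h (x 4%N) (p 4%N) y4 (Poly [:: d; 1]).
  apply: (exchange_seq_step hs r2 r3); rewrite ?oner_neq0 //.
    by rewrite !pev_Poly_cons pev_Poly_nil rmorph1 mulrC divfK //; ring.
  by rewrite /mkseq /= subnn subn0 !mul1r.
pose m1 := (1 + y0) / y.
have [e5 e6] := @quadratic_reflection _ _ _ _ _ y3 y4 m1 y00 y10 u0 eu
  erefl erefl erefl.
have r5 : rescaled h (x 5%N) (p 5%N) m1 (Poly [:: d ^+ 2; b * d; d]).
  apply: (exchange_seq_step hs r3 r4); rewrite ?oner_neq0 //.
    by rewrite !pev_Poly_cons pev_Poly_nil rmorph1 e5; ring.
  by rewrite /mkseq /= ?subn0 ?subSS ?subn0 ?subnn ?mul1r ?expr1 ?mulr1.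
have r6 : rescaled h (x 6%N) (p 6%N) (h d * y0) (Poly [:: d ^+ 2; d]).
  apply: (exchange_seq_step hs r4 r5); rewrite ?oner_neq0 //.
    by rewrite !pev_Poly_cons pev_Poly_nil e6; ring.
  by rewrite /mkseq /= ?subn0 ?subnn; congr [:: _; _]; ring.
have e7 : y * m1 = 1 + y0 by rewrite mulrC divfK.
have r7 : exists s7, rescaled h (x 7%N) (p 7%N) (h d ^+ 2 * y) (Poly s7).
  eexists; apply: (exchange_seq_step hs r5 r6); rewrite //.
  rewrite !pev_Poly_cons pev_Poly_nil.
  transitivity (h d ^+ 2 * (y * m1)); first by ring.
  by rewrite e7; ring.
split.
  apply: proportional_trans (proportional_sym (rescaled_prop r0)).
  by apply: proportional_trans (rescaled_prop r6) _; exists d.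
case: r7 => s7 /rescaled_prop r7; rewrite -ey; apply: proportional_trans r7 _.
by exists (d ^+ 2); rewrite ?rmorphXn ?expf_neq0.
Qed.

Lemma period_linear x p : exchange_seq h x p ->
  size (p 0%N) = 2 -> size (p 1%N) = 2 -> proportional h (x 5%N) (x 0%N).
Proof.
move=> hs s0 s1; have [y0 r0 x1] := exchange_seq_start hs s0.
have [s [ss ls r1]] := normalize_exchange hs s1.
case: s ss ls r1 => [|d [|? ?]] // _ d0 r1; rewrite /= in d0.
have [nz _ _ _] := hs.
have y00 := rescaled_neq0 r0 (proj1 (nz 0%N)).
have y10 : x 1%N != 0 := proj1 (nz 1%N).
have [y ey] : exists y, y = x 1%N by exists (x 1%N).
rewrite -ey in y10; rewrite -{2}ey in r1.
pose u := (1 + h d * y) / y0.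
have eu : y0 * u = 1 + h d * y by rewrite mulrC divfK.
have r2 : rescaled h (x 2%N) (p 2%N) u (Poly [:: 1; 1]).
  apply: (exchange_seq_step hs r0 r1); rewrite ?oner_neq0 //.
    by rewrite eu !pev_Poly_cons pev_Poly_nil rmorph1; ring.
  by rewrite /mkseq /= !expr1n !mulr1.
have u0 := rescaled_neq0 r2 (proj1 (nz 2%N)).
pose y3 := (1 + u) / y.
have r3 : rescaled h (x 3%N) (p 3%N) y3 (Poly [:: d; 1]).
  apply: (exchange_seq_step hs r1 r2) => //.
    by rewrite !pev_Poly_cons pev_Poly_nil rmorph1 mulrC divfK //; ring.
  by rewrite /mkseq /= !expr1n !mulr1.
pose y4 := (y3 + h d) / u.
have r4 : rescaled h (x 4%N) (p 4%N) y4 (Poly [:: d; 1]).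
  apply: (exchange_seq_step hs r2 r3); rewrite ?oner_neq0 //.
    by rewrite !pev_Poly_cons pev_Poly_nil rmorph1 mulrC divfK //; ring.
  by rewrite /mkseq /= subnn subn0 !mul1r.
have r5 : exists s5, rescaled h (x 5%N) (p 5%N) y0 (Poly s5).
  eexists; apply: (exchange_seq_step hs r3 r4); rewrite ?oner_neq0 //.
  rewrite !pev_Poly_cons pev_Poly_nil rmorph1 /y4 /y3.
  have -> : h d = (y0 * u - 1) / y by rewrite eu; field.
  by field; rewrite u0 y10.
case: r5 => s5 /rescaled_prop r5; apply: proportional_trans r5 _.
exact: proportional_sym (rescaled_prop r0).
Qed.

End FinitePeriods.

(** * Growth of degrees *)

Section Degrees.
Variables (S : idomainType) (K : fieldType) (h : {rmorphism S -> K}).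
Variables (x0 x1 : K).
Hypothesis free : alg_free h x0 x1.
Implicit Types (f g : K) (d : nat).

(** The degree in x1 of a rational function of x0 and x1. *)
Definition has_degree f d : Prop :=
  exists a b : {poly {poly S}},
    [/\ a != 0, b != 0, f * ev2 h x0 x1 b = ev2 h x0 x1 a &
        size a = (size b + d)%N].

Lemma has_degree_x0 : has_degree x0 0.
Proof.
exists 'X%:P, 1; rewrite polyC_eq0 polyX_eq0 oner_eq0 rmorph1 ev2C pevX mulr1.
by split=> //; rewrite size_poly1 size_polyC polyX_eq0.
Qed.

Lemma has_degree_x1 : has_degree x1 1.
Proof.
exists 'X, 1; rewrite polyX_eq0 oner_eq0 rmorph1 ev2X mulr1.
by split=> //; rewrite size_poly1 size_polyX.
Qed.

Lemma has_degree_proportional f g d d' (s t : S) : s != 0 -> t != 0 ->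
  h s * f = h t * g -> has_degree f d -> has_degree g d' -> d = d'.
Proof.
move=> s0 t0 e [a [b [a0 b0 ef sf]]] [a' [b' [a'0 b'0 eg sg]]].
have e2 : s%:P%:P * (a * b') = t%:P%:P * (a' * b).
  apply: (ev2_inj free); rewrite !rmorphM /= !ev2C !pevC -ef -eg.
  transitivity ((h s * f) * (ev2 h x0 x1 b * ev2 h x0 x1 b')); first by ring.
  by rewrite e; ring.
have := congr1 (fun q : {poly {poly S}} => size q) e2.
rewrite !size_Cmul ?polyC_eq0 // !size_mul //.
have sb : (0 < size b)%N by rewrite size_poly_gt0.
have sb' : (0 < size b')%N by rewrite size_poly_gt0.
by rewrite sf sg /=; move: sb sb'; move: (size b) (size b') => n n'; lia.
Qed.

Lemma has_degree_uniq f d d' : has_degree f d -> has_degree f d' -> d = d'.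
Proof.
by apply: (@has_degree_proportional f f d d' 1 1); rewrite ?oner_neq0.
Qed.

(** The leading term of p dominates because f has positive degree. *)
Lemma has_degree_pev f d (p : {poly S}) e : (0 < d)%N -> size p = e.+1 ->
  has_degree f d -> has_degree (pev h f p) (e * d).
Proof.
move=> d_gt0 sp [a [b [a0 b0 ef sf]]].
(* p(a / b) is the sum of the t i divided by b^e *)
pose t i : {poly {poly S}} := (p`_i)%:P%:P * (a ^+ i * b ^+ (e - i)).
have lp : p`_e != 0.
  by have := lead_coef_eq0 p; rewrite lead_coefE sp -size_poly_eq0 sp => ->.
have szt i : (size (t i) <= (i * (size a).-1 + (e - i) * (size b).-1).+1)%N.
  rewrite /t; have [->|pi0] := eqVneq p`_i 0; first by rewrite !polyC0 mul0r size_poly0.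
  rewrite size_Cmul ?polyC_eq0 // size_mul ?expf_neq0 //.
  have := size_exp a i; have := size_exp b (e - i); rewrite !(mulnC _.-1).
  move: (i * _)%N ((e - i) * _)%N => m n.
  by move: (size (a ^+ i)) (size (b ^+ _)) => m' n'; lia.
have st : size (t e) = (e * (size a).-1).+1.
  rewrite /t subnn mulr1 size_Cmul ?polyC_eq0 //.
  have sa : (0 < size (a ^+ e))%N by rewrite size_poly_gt0 expf_neq0.
  have := size_exp a e; rewrite mulnC; move: sa; move: (e * _)%N => m.
  by move: (size (a ^+ e)) => n; lia.
have b_gt0 : (0 < size b)%N by rewrite size_poly_gt0.
have srest : (size (\sum_(i < e) t i)%R < size (t e))%N.
  rewrite st ltnS; apply: (leq_trans (size_sum _ _ _)).
  apply/bigmax_leqP => i _; apply: (leq_trans (szt i)).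
  have hi := ltn_ord i.
  have -> : (e * (size a).-1 = i * (size a).-1 + (e - i) * (size a).-1)%N.
    by rewrite -mulnDl subnKC // ltnW.
  rewrite -addnS leq_add2l sf.
  have : (0 < e - i)%N by rewrite subn_gt0.
  by case: (e - i)%N => // j _; nia.
exists (\sum_(i < e.+1) t i), (b ^+ e); split.
- by rewrite -size_poly_eq0 big_ord_recr /= addrC size_polyDl // st.
- exact: expf_neq0.
- rewrite (@pev_wide _ _ _ e.+1) ?sp // rmorph_sum mulr_suml; apply: eq_bigr => i _.
  rewrite /t !rmorphM !rmorphXn /= ev2C pevC -ef exprMn.
  have ei : (i <= e)%N by rewrite -ltnS.
  have -> : ev2 h x0 x1 b ^+ e = ev2 h x0 x1 b ^+ i * ev2 h x0 x1 b ^+ (e - i).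
    by rewrite -exprD subnKC.
  ring.
rewrite big_ord_recr /= addrC size_polyDl // st.
have sbe : (0 < size (b ^+ e))%N by rewrite size_poly_gt0 expf_neq0.
have := size_exp b e; rewrite mulnC; move: sbe; move: (size (b ^+ e)) => n; rewrite sf; case: (size b) b_gt0 => // m _; rewrite addSn /= mulnDr; lia.
Qed.

Lemma has_degree_div f g g' d d' : g * g' = f -> (d' <= d)%N ->
  has_degree f d -> has_degree g d' -> has_degree g' (d - d').
Proof.
move=> e dd [a [b [a0 b0 ef sf]]] [a' [b' [a'0 b'0 eg sg]]].
exists (a * b'), (a' * b); split; rewrite ?mulf_neq0 //.
  rewrite !rmorphM /= -ef -eg -e; ring.
rewrite !size_mul // sf sg.
have sb : (0 < size b)%N by rewrite size_poly_gt0.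
have sb' : (0 < size b')%N by rewrite size_poly_gt0.
by move: sb sb'; move: (size b) (size b') => n n'; lia.
Qed.

Variables (x : nat -> K) (p : nat -> {poly S}) (b c : nat).
Hypotheses (ex0 : x 0%N = x0) (ex1 : x 1%N = x1).
Hypothesis exx : forall k, x k * x k.+2 = pev h (x k.+1) (p k.+1).
Hypothesis sizep : forall k, size (p k) = (if odd k then c else b).+1.

Lemma has_degree_step k u v : has_degree (x k) u -> has_degree (x k.+1) v ->
  (0 < v)%N -> (u <= (if odd k then b else c) * v)%N ->
  has_degree (x k.+2) ((if odd k then b else c) * v - u).
Proof.
move=> du dv v0 le; apply: (has_degree_div (exx k) le _ du).
by apply: has_degree_pev => //; rewrite sizep /=; case: odd.
Qed.

(** With coefficients at least two the increments of the degrees do not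
decrease. *)
Lemma has_degree_increasing : (2 <= b <= c)%N ->
  forall k, exists u v, [/\ (u < v)%N, has_degree (x k) u & has_degree (x k.+1) v].
Proof.
move=> /andP[b2 bc]; elim=> [|k [u [v [uv du dv]]]].
  exists 0%N, 1%N; rewrite ex0 ex1; split=> //; [exact: has_degree_x0|exact: has_degree_x1].
have e2 : (2 <= if odd k then b else c)%N by case: odd; lia.
have := has_degree_step du dv; move: e2; set e := if _ then _ else _ => e2 dw.
exists v, (e * v - u)%N; split=> //; last by apply: dw; nia.
by nia.
Qed.

(** The degree two steps after u is w - u, so that 2 u < w means that degrees
increase along odd positions; the inequality persists because c - 2 >= 2. *)
Lemma has_degree_increasing1 : (b = 1)%N -> (4 <= c)%N ->
  forall j, exists u w, [/\ (0 < u)%N, (2 * u < w)%N, has_degree (x j.*2.+1) u &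
                            has_degree (x j.*2.+2) w].
Proof.
move=> b1 c4; elim=> [|j [u [w [u0 uw du dw]]]].
  exists 1%N, c; split=> //; first by lia.
    by rewrite ex1; exact: has_degree_x1.
  have := @has_degree_step 0 0 1; rewrite ex0 ex1 /= muln1 subn0.
  by apply; rewrite ?leq0n //; [exact: has_degree_x0|exact: has_degree_x1].
have := has_degree_step du dw; rewrite /= odd_double /= b1 mul1n => d3.
have {}d3 : has_degree (x j.*2.+3) (w - u) by apply: d3; lia.
have := has_degree_step dw d3; rewrite /= odd_double /= => d4.
exists (w - u)%N, (c * (w - u) - w)%N; rewrite doubleS.
by split=> //; [lia|nia|apply: d4; [lia|nia]].
Qed.

Lemma has_degree_odd_increasing : (1 <= b <= c)%N -> (4 <= b * c)%N ->
  forall j, exists u v,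
    [/\ (u < v)%N, has_degree (x j.*2.+1) u & has_degree (x j.+1.*2.+1) v].
Proof.
move=> bc bc4 j; have [b1|b2] := ltnP b 2.
  have eb : b = 1%N by lia.
  have c4 : (4 <= c)%N by lia.
  have [u [w [u0 uw du dw]]] := has_degree_increasing1 eb c4 j.
  exists u, (w - u)%N; split=> //; first by lia.
  have := has_degree_step du dw; rewrite /= odd_double /= eb mul1n doubleS.
  by apply; lia.
have bc2 : (2 <= b <= c)%N by lia.
have [u [v [uv du dv]]] := has_degree_increasing bc2 j.*2.+1.
have [v' [w [vw dv' dw]]] := has_degree_increasing bc2 j.*2.+2.
exists u, w; split=> //; rewrite (leq_trans uv) //.
by rewrite (has_degree_uniq dv dv') ltnW.
Qed.

Lemma exchange_not_proportional : (1 <= b <= c)%N -> (4 <= b * c)%N ->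
  forall i j (s t : S), (i < j)%N -> s != 0 -> t != 0 ->
    h s * x i.*2.+1 <> h t * x j.*2.+1.
Proof.
move=> bc bc4 i j s t ij s0 t0 e.
have inc := has_degree_odd_increasing bc bc4.
suff [u [v [uv du dv]]] : exists u v, [/\ (u < v)%N, has_degree (x i.*2.+1) u &
    has_degree (x j.*2.+1) v].
  by have := has_degree_proportional s0 t0 e du dv; lia.
elim: j ij {e} => // j IH; rewrite ltnS leq_eqVlt => /orP[/eqP->|/IH]; first exact: inc.
move=> [u [v [uv du dv]]]; have [v' [w [vw dv' dw]]] := inc j.
by exists u, w; split=> //; rewrite (has_degree_uniq dv dv') in uv; apply: ltn_trans vw.
Qed.

End Degrees.

(** * Exchange polynomials of rank two *)

Definition other (i : 'I_2) : 'I_2 := rev_ord i.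

Lemma otherK : involutive other. Proof. exact: rev_ordK. Qed.

Lemma other_neq i : other i != i.
Proof. by case: i => [[|[|]]]. Qed.

Lemma otherP i j : j != i -> j = other i.
Proof. by move=> ji; apply/val_inj; case: i j ji => [[|[|]] // ?] [[|[|]] // ?]. Qed.

Lemma ord2P i k : k = i \/ k = other i.
Proof. by have [|/otherP] := eqVneq k i; [left|right]. Qed.

Lemma big_ord2 (R : Type) (idx : R) (op : Monoid.com_law idx) (F : 'I_2 -> R) i :
  \big[op/idx]_(k < 2) F k = op (F i) (F (other i)).
Proof.
rewrite (bigD1 i) //= (bigD1 (other i)) ?other_neq //= big1 ?Monoid.mulm1 // => k.
by move=> /andP[/otherP->]; rewrite eqxx.
Qed.

Lemma mnmXi (i : 'I_2) k : (U_(i) *+ k)%MM i = k.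
Proof. by rewrite mulmnE mnm1E eqxx mul1n. Qed.

Lemma mnmXother (i : 'I_2) k : (U_(i) *+ k)%MM (other i) = 0%N.
Proof. by rewrite mulmnE mnm1E eq_sym (negbTE (other_neq i)). Qed.

Lemma mnmXP (i : 'I_2) k (m : 'X_{1..2}) :
  (U_(i) *+ k == m)%MM = (k == m i) && (m (other i) == 0%N).
Proof.
apply/eqP/andP => [<-|[/eqP-> /eqP mo]]; first by rewrite mnmXi mnmXother.
by apply/mnmP => z; case: (ord2P i z) => ->; rewrite ?mnmXi ?mnmXother.
Qed.

Section Univariate.
Variable S : idomainType.
Local Notation K := (ambient S 2).
Local Notation h := (@S_to_K S 2).
Implicit Types (P Q : {poly S}) (i j : 'I_2) (p : {mpoly S[2]}).

Definition uniX i : {poly S} -> {mpoly S[2]} :=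
  horner_eval 'X_i \o map_poly (@mpolyC 2 S).
HB.instance Definition _ i := GRing.RMorphism.on (uniX i).

Lemma uniXE i P : uniX i P = (map_poly (@mpolyC 2 S) P).['X_i].
Proof. by []. Qed.

Lemma uniXX i : uniX i 'X = 'X_i.
Proof. by rewrite uniXE map_polyX hornerX. Qed.

Lemma uniXC i c : uniX i c%:P = c%:MP.
Proof. by rewrite uniXE map_polyC hornerC. Qed.

Lemma uniX_sum i P : uniX i P = \sum_(k < size P) P`_k *: 'X_[U_(i) *+ k].
Proof.
rewrite uniXE (@horner_coef_wide _ (size P)) ?size_poly //.
apply: eq_bigr => k _; rewrite coef_map mpolyXn mul_mpolyC //.
Qed.

Lemma mcoeff_uniX i P (m : 'X_{1..2}) :
  (uniX i P)@_m = if m (other i) == 0%N then P`_(m i) else 0.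
Proof.
rewrite uniX_sum raddf_sum /=.
under eq_bigr => k _ do rewrite mcoeffZ mcoeffX mnmXP.
case: eqP => _; last by rewrite big1 // => k _; rewrite andbF mulr0.
have [lt|ge] := ltnP (m i) (size P).
  rewrite (bigD1 (Ordinal lt)) //= eqxx mulr1 big1 ?addr0 // => k kn.
  by rewrite andbT (_ : _ == _ = false) ?mulr0 //; apply/negbTE.
rewrite nth_default // big1 // => k _; rewrite andbT.
by rewrite ltn_eqF ?mulr0 // (leq_trans (ltn_ord k)).
Qed.

Lemma uniX_inj i : injective (uniX i).
Proof.
move=> P Q e; apply/polyP => k.
have := congr1 (mcoeff (U_(i) *+ k)%MM) e; by rewrite !mcoeff_uniX mnmXi mnmXother.
Qed.

Lemma involves_uniX i P : involves i (uniX i P) = (1 < size P)%N.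
Proof.
apply/hasP/idP => [[m]|sP].
  rewrite mcoeff_msupp mcoeff_uniX; case: ifP; last by rewrite eqxx.
  move=> _ Pm mi; rewrite ltnNge; apply: contraNN Pm => sP.
  by rewrite nth_default // (leq_trans sP) // lt0n.
exists (U_(i) *+ (size P).-1)%MM.
  rewrite mcoeff_msupp mcoeff_uniX mnmXi mnmXother /= -lead_coefE lead_coef_eq0.
  by rewrite -size_poly_gt0 (ltn_trans _ sP).
by rewrite mnmXi; case: (size P) sP => [|[]].
Qed.

Definition univ i p : {poly S} := \poly_(k < msize p) p@_(U_(i) *+ k).

(** Coefficients of p beyond its size vanish, so the truncation at msize p loses
nothing. *)
Lemma univK i p : ~~ involves (other i) p -> uniX i (univ i p) = p.
Proof.
move=> ni; apply/mpolyP => m; rewrite mcoeff_uniX; case: eqP => [mo|mo].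
  have em : m = (U_(i) *+ m i)%MM.
    by apply/esym/eqP; rewrite mnmXP eqxx mo.
  rewrite coef_poly; case: ltnP => [_|le]; first by rewrite -em.
  apply/esym/memN_msupp_eq0/negP => /msize_mdeg_lt; rewrite {1}em mdegMn mdeg1 mul1n.
  by rewrite ltnNge le.
apply/esym/memN_msupp_eq0; apply: contraNN ni => mp.
by apply/hasP; exists m => //; apply/eqP.
Qed.

Lemma not_involves_uniX i P : ~~ involves (other i) (uniX i P).
Proof.
apply/hasPn => m; rewrite mcoeff_msupp mcoeff_uniX negbK.
by case: (m _ == 0%N); rewrite // eqxx.
Qed.

Lemma uniXK i P : univ i (uniX i P) = P.
Proof. by apply: (@uniX_inj i); rewrite univK // not_involves_uniX. Qed.

Lemma ev_uniX (y : 'I_2 -> K) i P : ev y (uniX i P) = pev h (y i) P.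
Proof.
rewrite /ev uniX_sum raddf_sum /= (@pev_wide _ _ _ (size P)) //.
apply: eq_bigr => k _; rewrite -mul_mpolyC rmorphM /= mmapC -mpolyXn rmorphXn /=.
by rewrite mmapX mmap1U.
Qed.

Lemma mpoly_unitP p : p \is a GRing.unit -> exists2 c, c \is a GRing.unit & p = c%:MP.
Proof.
rewrite unfold_in /= => /andP[/eqP e u]; by exists p@_0%MM.
Qed.

Lemma mpolyC_inj : injective (@mpolyC 2 S).
Proof. by move=> a b /(congr1 (mcoeff 0%MM)); rewrite !mpolyCK. Qed.

Lemma irreducible_const c : irreducible_elt (c%:MP : {mpoly S[2]}) -> irreducible_elt c.
Proof.
move=> [c0 cu ci]; split; first by move: c0; rewrite mpolyC_eq0.
  by apply: contraNN cu => cu; apply: rmorph_unit.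
move=> a b e; have /ci[] : c%:MP_[2] = a%:MP * b%:MP by rewrite -mpolyCM e.
  by move=> /mpoly_unitP[d du /mpolyC_inj->]; left.
by move=> /mpoly_unitP[d du /mpolyC_inj->]; right.
Qed.

(** A factorization by a scalar would be a proper one, the other factor being
nonconstant. *)
Lemma primitive_uniX i P : irreducible_elt (uniX i P) -> (1 < size P)%N -> primitive P.
Proof.
move=> [_ _ Pi] sP q [q0 qu _] [R e].
have /Pi[] : uniX i P = uniX i R * q%:MP by rewrite e rmorphM /= uniXC.
  move=> /mpoly_unitP[c _]; rewrite -(uniXC i) => /uniX_inj eR.
  by move: sP; rewrite e eR -polyCM size_polyC; case: eqP.
by move=> /mpoly_unitP[c cu /mpolyC_inj eq]; rewrite eq cu in qu.
Qed.

Lemma coef0_uniX i P : ~ rdivides 'X_i (uniX i P) -> P`_0 != 0.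
Proof.
move=> nd; apply/eqP => P0; apply: nd; exists (uniX i (drop_poly 1 P)).
rewrite -uniXX -rmorphM -{1}(poly_take_drop 1 P) expr1.
suff -> : take_poly 1 P = 0 by rewrite add0r.
apply/polyP => k; rewrite coef_take_poly coef0.
by case: k => // ; rewrite P0.
Qed.

End Univariate.

(** * Evaluation at a transcendence basis *)

Lemma mpoly_rmorph_eq (n : nat) (R T : comNzRingType)
    (f g : {rmorphism {mpoly R[n]} -> T}) :
  (forall c, f c%:MP = g c%:MP) -> (forall i, f 'X_i = g 'X_i) -> f =1 g.
Proof.
move=> ec ex p; rewrite [p]mpolyE !rmorph_sum; apply: eq_bigr => m _.
rewrite -mul_mpolyC !rmorphM /= ec; congr (_ * _).
rewrite mpolyXE_id !rmorph_prod; apply: eq_bigr => i _.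
by rewrite !rmorphXn /= ex.
Qed.

Section Evaluation.
Variables (S : idomainType) (n : nat).
Local Notation K := (ambient S n).
Local Notation h := (@S_to_K S n).
Implicit Types (x y : 'I_n -> K).

HB.instance Definition _ y :=
  GRing.RMorphism.copy (@ev S n y) (mmap (@S_to_K S n) y).

Lemma evC y c : ev y c%:MP = h c. Proof. exact: mmapC. Qed.

Lemma evX y i : ev y 'X_i = y i.
Proof. by rewrite /ev mmapX mmap1U. Qed.

Lemma ev_map_tofrac y p :
  ev y p = mmap (@frac_to_K S n) y (map_mpoly (@tofrac S) p).
Proof.
pose g : {rmorphism {mpoly S[n]} -> K} :=
  mmap (@frac_to_K S n) y \o map_mpoly (@tofrac S).
apply: (@mpoly_rmorph_eq n S K (ev y) g) => [c|i].
  by rewrite -[LHS]/(ev y c%:MP) evC /= map_mpolyC ?rmorph0 // mmapC.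
by rewrite -[LHS]/(ev y 'X_i) evX /= map_mpolyX mmapX mmap1U.
Qed.

Lemma ev_inj x : alg_independent x -> injective (ev x).
Proof.
move=> fx p q epq.
have : ev x (p - q) = 0 by rewrite rmorphB /= epq subrr.
rewrite ev_map_tofrac => /fx e.
apply/eqP; rewrite -subr_eq0; apply/eqP/mpolyP => m.
have := congr1 (mcoeff m) e; rewrite mcoeff_map_mpoly !mcoeff0 => /eqP.
by rewrite tofrac_eq0 => /eqP.
Qed.

Lemma alg_independent_neq0 x i : alg_independent x -> x i != 0.
Proof.
move=> fx; rewrite -evX -(rmorph0 (ev x)) (inj_eq (ev_inj fx)).
by apply/eqP => /(congr1 (mcoeff U_(i)%MM)) /eqP; rewrite mcoeffX mcoeff0 eqxx oner_eq0.
Qed.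

Lemma mmap1_neq0 x m : alg_independent x -> mmap1 x m != 0.
Proof.
by move=> fx; apply/prodf_neq0 => i _; rewrite expf_neq0 ?alg_independent_neq0.
Qed.

Lemma S_to_K_inj : injective h.
Proof.
move=> a b; rewrite /S_to_K /frac_to_K /= => /eqP; rewrite tofrac_eq => /eqP.
by move=> /(congr1 (mcoeff 0%MM)); rewrite !mpolyCK => /eqP; rewrite tofrac_eq => /eqP.
Qed.

Lemma S_to_K_unit u : u \is a GRing.unit -> h u != 0.
Proof. by move=> uu; rewrite -unitfE rmorph_unit. Qed.

End Evaluation.

Section RankTwoEvaluation.
Variable S : idomainType.
Local Notation K := (ambient S 2).
Local Notation h := (@S_to_K S 2).
Implicit Types (x y : 'I_2 -> K) (i j : 'I_2).

(** Elements of the ring S[X_0, X_1] as bivariate polynomials whose inner variable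
is X_i. *)
Definition bivar i : {mpoly S[2]} -> {poly {poly S}} :=
  mmap (polyC \o polyC) (fun k => if k == i then 'X%:P else 'X).
HB.instance Definition _ i := GRing.RMorphism.on (bivar i).

Lemma ev2_bivar y i p : ev2 h (y i) (y (other i)) (bivar i p) = ev y p.
Proof.
pose g : {rmorphism {mpoly S[2]} -> K} :=
  ev2 h (y i) (y (other i)) \o bivar i.
apply: (@mpoly_rmorph_eq 2 S K g (ev y)) => [c|k].
  by rewrite -[RHS]/(ev y c%:MP) evC /= /bivar mmapC /= ev2C pevC.
rewrite -[RHS]/(ev y 'X_k) evX /= /bivar mmapX mmap1U; case: (ord2P i k) => ->.
  by rewrite eqxx ev2C pevX.
by rewrite (negbTE (other_neq i)) ev2X.
Qed.

Lemma bivarC i c : bivar i c%:MP = c%:P%:P.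
Proof. by rewrite /bivar mmapC. Qed.

Lemma bivarX i : bivar i 'X_i = 'X%:P.
Proof. by rewrite /bivar mmapX mmap1U eqxx. Qed.

Lemma bivarXother i : bivar i 'X_(other i) = 'X.
Proof. by rewrite /bivar mmapX mmap1U (negbTE (other_neq i)). Qed.

Lemma bivar_surj i a : exists p, bivar i p = a.
Proof.
exists (\sum_(k < size a) (\sum_(l < size a`_k) (a`_k`_l)%:MP * 'X_i ^+ l) *
          'X_(other i) ^+ k).
rewrite rmorph_sum -[RHS]coefK poly_def; apply: eq_bigr => k _.
rewrite rmorphM rmorphXn /= bivarXother -mul_polyC; congr (_ * _).
rewrite rmorph_sum -[a`_k in RHS]coefK poly_def rmorph_sum; apply: eq_bigr => l _.
by rewrite rmorphM rmorphXn /= bivarX bivarC -mul_polyC rmorphM rmorphXn.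
Qed.

(** Algebraic independence concerns coefficients in Frac(S); every bivariate
polynomial over S comes from a multivariate one. *)
Lemma alg_independent_free y i : alg_independent y -> alg_free h (y i) (y (other i)).
Proof.
move=> fy a; have [p <-] := bivar_surj i a; rewrite ev2_bivar => e.
suff -> : p = 0 by rewrite rmorph0.
by apply: (ev_inj fy); rewrite e -[RHS]/(mmap h y 0) rmorph0.
Qed.

Lemma mmap1_ord2 y m i : mmap1 y m = y i ^+ m i * y (other i) ^+ m (other i).
Proof. exact: (@big_ord2 _ _ _ (fun k => y k ^+ m k) i). Qed.

Lemma laurentP y f i : alg_independent y ->
  laurent y f <-> exists a b p, f * (y i ^+ a * y (other i) ^+ b) =
                                ev2 h (y i) (y (other i)) p.
Proof.
move=> fy; have y0 k : y k != 0 := alg_independent_neq0 k fy.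
split=> [[m [p ->]]|[a [b [p e]]]].
  exists (m i), (m (other i)), (bivar i p); rewrite ev2_bivar /lev -mmap1_ord2 divfK //.
  exact: mmap1_neq0.
have [q eq] := bivar_surj i p; rewrite -{}eq ev2_bivar in e.
exists (U_(i) *+ a + U_(other i) *+ b)%MM, q.
have e0 : (U_(other i) *+ b)%MM i = 0%N by rewrite -{2}(otherK i) mnmXother.
rewrite /lev -e (mmap1_ord2 _ _ i) !mnmDE !mnmXi mnmXother e0.
by rewrite addn0 add0n mulfK // mulf_neq0 ?expf_neq0.
Qed.

End RankTwoEvaluation.

(** * Exchange Laurent polynomials in rank two *)

(** Dividing out the variable from the cofactor reduces to divisors of a constant,
since the constant term of q is nonzero. *)
Lemma poly_dvd_monomial (D : idomainType) (q w : {poly D}) c n :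
  q`_0 != 0 -> c != 0 -> q * w = c *: 'X^n -> size q = 1.
Proof.
move=> q0 c0; elim: n w => [|n IH] w e.
  have e1 : size (q * w) = 1 by rewrite e expr0 size_scale ?size_poly1.
  have qw : q * w != 0 by rewrite -size_poly_eq0 e1.
  have qn : q != 0 by apply: contraNneq qw => ->; rewrite mul0r.
  have wn : w != 0 by apply: contraNneq qw => ->; rewrite mulr0.
  move: e1; rewrite size_mul //.
  have : (0 < size q)%N by rewrite size_poly_gt0.
  have : (0 < size w)%N by rewrite size_poly_gt0.
  by move: (size q) (size w) => a b; lia.
have w0 : w`_0 = 0.
  apply: (mulfI q0); have := congr1 (fun p : {poly D} => p`_0) e.
  by rewrite coef0M coefZ coefXn /= mulr0n !mulr0.
apply: (IH (drop_poly 1 w)); have X0 : 'X != 0 :> {poly D} by rewrite polyX_eq0.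
apply: (mulIf X0).
rewrite -mulrA -scalerAl -exprSr -e; congr (_ * _).
rewrite -[in RHS](poly_take_drop 1 w) expr1.
suff -> : take_poly 1 w = 0 by rewrite add0r.
by apply/polyP => -[|k]; rewrite coef_take_poly coef0 // w0.
Qed.

Lemma pev_revp (S : idomainType) (K : fieldType) (h : {rmorphism S -> K})
    (x : K) (P : {poly S}) a : x != 0 ->
  pev h x (revp P a) = pev h (h a / x) P * x ^+ (size P).-1.
Proof.
move=> x0; have [sP|sP] := posnP (size P).
  move/eqP: sP; rewrite size_poly_eq0 => /eqP->.
  by rewrite /revp size_poly0 poly_def big_ord0 !rmorph0 mul0r.
rewrite !(@pev_wide _ _ _ (size P)) ?size_poly // mulr_suml.
rewrite (reindex_inj rev_ord_inj) /=; apply: eq_bigr => k _.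
have kP : (k <= (size P).-1)%N by rewrite -ltnS prednK.
have e : (size P - k.+1 = (size P).-1 - k)%N by rewrite subnS -subn1 subnAC subn1.
rewrite e coef_poly (leq_ltn_trans (leq_subr _ _)) ?prednK // subKn //.
have -> : x ^+ (size P).-1 = x ^+ k * x ^+ ((size P).-1 - k).
  by rewrite -exprD subnKC.
by rewrite rmorphM rmorphXn /= exprMn exprVn; field; rewrite expf_neq0.
Qed.

(** The exponent of the exchange Laurent polynomial: if the other exchange
polynomial is a constant q, clearing denominators in P(q/z) leaves the factor
q^m exactly; otherwise no monomial factor is needed. *)
Definition laurent_exp (S : idomainType) (P Q : {poly S}) (m : nat) : Prop :=
  if (size Q <= 1)%N then
    rdivides (Q`_0 ^+ m)%:P (revp P Q`_0) /\
    ~ rdivides (Q`_0 ^+ m.+1)%:P (revp P Q`_0)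
  else m = 0%N.

Lemma laurent_exp_uniq (S : idomainType) (P Q : {poly S}) m m' :
  laurent_exp P Q m -> laurent_exp P Q m' -> m = m'.
Proof.
rewrite /laurent_exp; case: leqP => [_|_ -> ->] //.
have main n n' : rdivides (Q`_0 ^+ n)%:P (revp P Q`_0) ->
    ~ rdivides (Q`_0 ^+ n'.+1)%:P (revp P Q`_0) -> (n <= n')%N.
  move=> [d ed] nd; rewrite leqNgt; apply/negP => lt; apply: nd.
  exists (d * (Q`_0 ^+ (n - n'.+1))%:P).
  by rewrite ed -mulrA -polyCM -exprD subnK.
by move=> [d1 n1] [d2 n2]; apply/eqP; rewrite eqn_leq (main m m') ?(main m' m).
Qed.

Section RankTwoLaurent.
Variables (S : idomainType) (K : fieldType) (h : {rmorphism S -> K}) (x1 x2 : K).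
Hypothesis free : alg_free h x1 x2.
Implicit Types (P Q g : {poly S}) (f : K).

(** The Laurent polynomials, described by clearing denominators. *)
Definition laurent2 f : Prop :=
  exists a b p, f * (x1 ^+ a * x2 ^+ b) = ev2 h x1 x2 p.

Let x20 : x2 != 0 := alg_free_neq0 free.
Let free' : alg_free h x2 x1 := alg_freeC free.
Let hI : injective h := alg_free_inj free.

Let h_neq0 q : q != 0 -> h q != 0.
Proof. by rewrite -(rmorph0 h) (inj_eq hI). Qed.

(** Powers of x1 and x2 are invertible, so that divisibility by the scalar q can be
read off the coefficients of g. *)
Lemma laurent2_quotient g q a b : q != 0 ->
  laurent2 (pev h x2 g * x2 ^+ a / (x2 ^+ b * h q)) <-> rdivides q%:P g.
Proof.
move=> /h_neq0 hq; split=> [[a' [b' [p e]]]|[g' ->]]; last first.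
  exists 0%N, b, (map_poly polyC g' * 'X^a); rewrite !rmorphM /= rmorphXn /=.
  by rewrite ev2X ev2_map_polyC pevC; field; rewrite hq expf_neq0.
apply/rdivides_polyC_coef => k.
have e2 : map_poly polyC g * 'X^(a + b') * ('X^a')%:P = p * 'X^b * q%:P%:P.
  apply: (ev2_inj free); rewrite !rmorphM /= !rmorphXn /= -e ev2_map_polyC.
  rewrite !ev2C pevX pevC ev2X exprD; field.
  by rewrite hq expf_neq0.
have <- : (map_poly polyC g * 'X^(a + b') * ('X^a')%:P)`_(k + (a + b'))`_a' = g`_k.
  rewrite coefMC coefMXn ltnNge leq_addl /= addnK coef_map /=.
  by rewrite coefCM coefXn eqxx mulr1.
by rewrite e2 coefMC coefMC; eexists; reflexivity.
Qed.

(** Modulo Q, the numerator of P(Q/x2) is a monomial times P(0), while Q, having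
two terms, divides no monomial. *)
Lemma laurent2_not_dvd P Q :
  P`_0 != 0 -> Q`_0 != 0 -> (1 < size Q)%N ->
  forall f, laurent2 f -> pev h (pev h x1 Q / x2) P <> f * pev h x1 Q.
Proof.
move=> P0 Q0 sQ f [a [b [w ew]]] ef; set F := pev h x1 Q in ef.
set n := (size P).-1.
have sP : size P = n.+1.
  by rewrite prednK // size_poly_gt0; apply: contraNneq P0 => ->; rewrite coef0.
pose q := map_poly (@polyC S) Q.
have evq : ev2 h x2 x1 q = F by rewrite ev2_map_polyC.
(* s is the part of x2^n P(Q/x2) divisible by Q, divided by Q *)
pose s : {poly {poly S}} := \sum_(k < n) (P`_k.+1)%:P%:P * q ^+ k * ('X^(n - k.+1))%:P.
have es : pev h (F / x2) P * x2 ^+ n = h P`_0 * x2 ^+ n + F * ev2 h x2 x1 s.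
  rewrite (@pev_wide _ _ _ n.+1) ?sP // big_ord_recl mulrDl expr0 mulr1; congr (_ + _).
  rewrite rmorph_sum mulr_suml mulr_sumr; apply: eq_bigr => k _.
  rewrite !rmorphM /= !rmorphXn /= evq !ev2C pevC pevX.
  rewrite -[bump 0 k]/(k.+1) exprMn exprVn.
  have -> : x2 ^+ n = x2 ^+ k.+1 * x2 ^+ (n - k.+1) by rewrite -exprD subnKC.
  by rewrite [F ^+ k.+1]exprS; field; rewrite expf_neq0.
have e2 : q * (swapXY w * ('X^n)%:P - s * ('X^b)%:P * 'X^a) =
    (P`_0 *: 'X^(n + b)) *: 'X^a.
  apply: (ev2_inj free'); rewrite -mul_polyC -mul_polyC.
  rewrite rmorphM rmorphB !rmorphM /= !rmorphXn /= evq ev2_swapXY !ev2C.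
  rewrite -ew pevC pevX ev2X.
  transitivity (f * F * x2 ^+ n * x2 ^+ b * x1 ^+ a
                - F * ev2 h x2 x1 s * x2 ^+ b * x1 ^+ a); first by ring.
  by rewrite -ef es exprD; ring.
have : size q = 1.
  apply: poly_dvd_monomial e2; rewrite ?coef_map ?polyC_eq0 //.
  by rewrite -lead_coef_eq0 lead_coefZ lead_coefXn mulr1.
by rewrite size_map_inj_poly ?polyC0 // => [sQ1|]; [rewrite sQ1 in sQ|exact: polyC_inj].
Qed.

(** Dividing P(Q/x2) by (Q/x2)^k must leave no denominator and exhaust the
factors Q. If Q is not constant, Q does not divide P(Q/x2) at all; if it is a
constant, only powers of scalars are at stake. *)
Lemma laurent_expP P Q k (f := pev h (pev h x1 Q / x2) P / (pev h x1 Q / x2) ^+ k) :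
  P`_0 != 0 -> Q`_0 != 0 ->
  (laurent2 f /\ forall g : K, laurent2 g -> f <> g * pev h x1 Q) <->
  laurent_exp P Q k.
Proof.
move=> P0 Q0; have Qn0 : Q != 0 by apply: contraNneq Q0 => ->; rewrite coef0.
rewrite /laurent_exp; case: leqP => sQ.
  have eQ := size1_polyC sQ; set q := Q`_0 in Q0 eQ *.
  have eF : pev h x1 Q = h q by rewrite eQ pevC.
  have hq := h_neq0 Q0.
  have ef e : f / h q ^+ e =
      pev h x2 (revp P q) * x2 ^+ k / (x2 ^+ (size P).-1 * h (q ^+ (k + e))).
    rewrite /f eF pev_revp // rmorphXn /= exprD expr_div_n; field.
    by rewrite !expf_neq0.
  have lq e : laurent2 (f / h q ^+ e) <-> rdivides (q ^+ (k + e))%:P (revp P q).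
    by rewrite ef; apply: laurent2_quotient; rewrite expf_neq0.
  have := lq 0%N; rewrite divr1 addn0 => <-.
  have := lq 1%N; rewrite addn1 expr1 => <-; rewrite eF.
  split=> -[l1 l2]; split=> //.
    by move=> l3; apply: (l2 _ l3); rewrite divfK.
  by move=> g lg eg; apply: l2; rewrite eg mulfK.
have nd := laurent2_not_dvd P0 Q0 sQ; set F := pev h x1 Q in f nd *.
have F0 : F != 0 by rewrite /F -(rmorph0 (pev h x1)) (inj_eq (pev_inj free)).
split=> [[l1 l2]|k0].
  rewrite /f in l1 l2.
  case: k @f l1 l2 => // k f -[a [b [p ep]]] _.
  exfalso; apply: (nd (pev h (F / x2) P / (F / x2) ^+ k.+1 * F ^+ k / x2 ^+ k.+1)); last first.
    by rewrite expr_div_n [F ^+ k.+1]exprS; field; rewrite F0 ?x20 !expf_neq0.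
  exists a, (b + k.+1)%N, (p * (Q ^+ k)%:P).
  rewrite rmorphM /= -ep ev2C rmorphXn /= -/F exprD; field.
  by rewrite !expf_neq0 ?mulf_neq0 ?invr_eq0.
have {f}-> : f = pev h (F / x2) P by rewrite /f k0 divr1.
split=> //; exists 0%N, (size P).-1.
exists (\sum_(l < size P) (P`_l *: Q ^+ l)%:P * 'X^((size P).-1 - l)).
rewrite mul1r (@pev_wide _ _ _ (size P)) // mulr_suml rmorph_sum.
apply: eq_bigr => l _; rewrite -mul_polyC rmorphM /= ev2C rmorphM /= !rmorphXn /= pevC -/F ev2X.
have lP : (l <= (size P).-1)%N by rewrite -ltnS (ltn_predK (ltn_ord l)).
have -> : x2 ^+ (size P).-1 = x2 ^+ l * x2 ^+ ((size P).-1 - l) by rewrite -exprD subnKC.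
by rewrite expr_div_n; field; rewrite expf_neq0.
Qed.

End RankTwoLaurent.

(** * Mutation in rank two *)

Section RankTwoMutation.
Variable S : idomainType.
Local Notation K := (ambient S 2).
Local Notation h := (@S_to_K S 2).
Implicit Types (t : lseed S 2) (i j : 'I_2) (P Q : {poly S}).

(** The exchange polynomial at i, which involves the other variable only. *)
Definition upoly t i : {poly S} := univ (other i) (exch t i).

Lemma seed_alg_independent t : is_seed t -> alg_independent (clus t).
Proof. by case=> -[]. Qed.

Lemma seed_neq0 t i : is_seed t -> clus t i != 0.
Proof. by move/seed_alg_independent/alg_independent_neq0. Qed.

Lemma seed_free t i : is_seed t -> alg_free h (clus t i) (clus t (other i)).
Proof. by move/seed_alg_independent/alg_independent_free. Qed.

Lemma seed_exch t i : is_seed t -> exch t i = uniX (other i) (upoly t i).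
Proof. by case=> _ _ _ ni; rewrite univK // otherK. Qed.

Lemma seed_exchK t i : is_seed t -> exchK t i = pev h (clus t (other i)) (upoly t i).
Proof. by move=> st; rewrite /exchK seed_exch // ev_uniX. Qed.

Lemma seed_coef0 t i : is_seed t -> (upoly t i)`_0 != 0.
Proof.
by move=> st; apply: (@coef0_uniX S (other i)); rewrite -seed_exch //; case: st.
Qed.

Lemma seed_size_gt0 t i : is_seed t -> (0 < size (upoly t i))%N.
Proof.
by move=> /(@seed_coef0 _ i); rewrite size_poly_gt0; apply: contraNneq => ->; rewrite coef0.
Qed.

Lemma seed_primitive t i : is_seed t -> (1 < size (upoly t i))%N -> primitive (upoly t i).
Proof.
by move=> st; apply: (@primitive_uniX S (other i)); rewrite -seed_exch //; case: st.
Qed.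

Lemma seed_const t i : is_seed t -> (size (upoly t i) <= 1)%N ->
  upoly t i = ((upoly t i)`_0)%:P /\ irreducible_elt (upoly t i)`_0.
Proof.
move=> st /size1_polyC e; split=> //; apply: irreducible_const.
by rewrite -(uniXC (other i)) -e -seed_exch //; case: st.
Qed.

Lemma seed_involves t i : is_seed t ->
  involves i (exch t (other i)) = (1 < size (upoly t (other i)))%N.
Proof. by move=> st; rewrite seed_exch // otherK involves_uniX. Qed.

Lemma seed_upoly_inj t t' i : is_seed t -> is_seed t' ->
  clus t (other i) = clus t' (other i) -> exchK t i = exchK t' i ->
  upoly t i = upoly t' i.
Proof.
move=> st st' ec; rewrite !seed_exchK // -ec => /pev_inj; apply.
exact: (alg_freeC (@seed_free t i st)).
Qed.

Lemma lev_subst t i (m : 'X_{1..2}) f : is_seed t -> m i = 0%N ->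
  lev (subst (clus t) (other i) f) m (exch t i) =
  pev h f (upoly t i) / f ^+ m (other i).
Proof.
move=> st mi; rewrite /lev seed_exch // ev_uniX (mmap1_ord2 _ _ i) mi expr0 mul1r.
by rewrite /subst /= eqxx.
Qed.

Lemma laurent_laurent2 y i f : alg_independent y ->
  laurent y f <-> laurent2 h (y i) (y (other i)) f.
Proof. exact: laurentP. Qed.

Lemma exch_laurentP t i (m : 'X_{1..2}) : is_seed t ->
  exch_laurent t i m <->
  m i = 0%N /\ laurent_exp (upoly t i) (upoly t (other i)) (m (other i)).
Proof.
move=> st; have fy := seed_alg_independent st.
have main k := @laurent_expP _ _ h _ _ (@seed_free t i st) (upoly t i)
  (upoly t (other i)) k (@seed_coef0 t i st) (@seed_coef0 t (other i) st).
have eF : exchK t (other i) = pev h (clus t i) (upoly t (other i)).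
  by rewrite seed_exchK // otherK.
have ll f := @laurent_laurent2 (clus t) i f fy.
split=> [[mi lm]|[mi /main[l1 l2]]]; split=> //.
  apply/main; have := lm (other i) (other_neq i); rewrite lev_subst // eF.
  move=> [/ll l1 l2]; split=> // g lg eg; apply: l2; exists g => //.
  exact/ll.
move=> j' /otherP->; rewrite lev_subst // eF; split; first exact/ll.
by move=> [g /ll lg eg]; apply: (l2 g).
Qed.

End RankTwoMutation.

Lemma poly_shift_eq (D : idomainType) (p q : {poly D}) a b :
  p`_0 != 0 -> q`_0 != 0 -> p * 'X^a = q * 'X^b -> p = q.
Proof.
move=> p0 q0; wlog ab : a b p q p0 q0 / (a <= b)%N => [th e|e].
  by case/orP: (leq_total a b) => l; [|apply/esym]; apply: th l _; rewrite ?e.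
have X0 : 'X^a != 0 :> {poly D} by rewrite -size_poly_eq0 size_polyXn.
have {}e : p = q * 'X^(b - a).
  by apply: (mulIf X0); rewrite e -mulrA -exprD subnK.
move: e; case: (b - a)%N => [|k] e; first by rewrite e mulr1.
by move: p0; rewrite e coefMXn eqxx.
Qed.

Section ExchangeRelation.
Variables (S : idomainType) (K : fieldType) (h : {rmorphism S -> K}) (z : K).
Hypothesis zI : injective (pev h z).
Hypothesis z0 : z != 0.

(** Both sides are polynomials in z up to powers of z, and have nonzero constant
terms, so the powers of z agree. *)
Lemma exchange_poly (Q R : {poly S}) a d u (n : int) :
  Q`_0 != 0 -> R`_0 != 0 -> a != 0 -> d != 0 -> u != 0 ->
  pev h z R * h d = h u * z ^ n * pev h (h a / z) Q ->
  d *: R = u *: revp Q a.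
Proof.
move=> Q0 R0 a0 d0 u0 e; set k := (size Q).-1.
have e2 : pev h z (d *: R) * z ^+ k = z ^ n * pev h z (u *: revp Q a).
  rewrite -!mul_polyC !rmorphM /= !pevC pev_revp // -/k [h d * _]mulrC e.
  by ring.
have Qn : Q != 0 by apply: contraNneq Q0 => ->; rewrite coef0.
have l0 : (d *: R)`_0 != 0 by rewrite coefZ mulf_neq0.
have r0 : (u *: revp Q a)`_0 != 0.
  by rewrite coefZ coef0_revp !mulf_neq0 ?expf_neq0 ?lead_coef_eq0.
case: n e e2 => n _ e2.
  apply: (poly_shift_eq (a := k) (b := n) l0 r0); apply: zI.
  by rewrite !rmorphM /= !rmorphXn /= pevX e2 mulrC.
apply: (poly_shift_eq (a := k + n.+1) (b := 0) l0 r0); apply: zI.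
rewrite expr0 mulr1 rmorphM /= !rmorphXn /= pevX exprD mulrA e2.
by rewrite NegzE -exprnN mulrAC mulVf ?mul1r // expf_neq0.
Qed.

End ExchangeRelation.

Section RankTwoMutationP.
Variable S : idomainType.
Local Notation K := (ambient S 2).
Local Notation h := (@S_to_K S 2).
Implicit Types (t : lseed S 2) (i j : 'I_2) (P Q R : {poly S}).

Lemma const_of_not_involves i (q : {mpoly S[2]}) :
  ~~ involves i q -> ~~ involves (other i) q -> exists c, q = c%:MP.
Proof.
move=> ni no; have := univK no => e; exists (univ i q)`_0.
rewrite -{1}e -(uniXC i) -size1_polyC // leqNgt -(involves_uniX i) e //.
Qed.

Lemma irreducible_mpolyC (c : S) :
  irreducible_elt c -> irreducible_elt (c%:MP : {mpoly S[2]}).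
Proof.
move=> [c0 cu ci]; split; first by rewrite mpolyC_eq0.
  by apply: contraNN cu => /mpoly_unitP[d du /mpolyC_inj->].
move=> a b e.
have c0' : c%:MP_[2] != 0 by rewrite mpolyC_eq0.
have a0 : a != 0 by apply: contraNneq c0' => a0; rewrite e a0 mul0r.
have b0 : b != 0 by apply: contraNneq c0' => b0; rewrite e b0 mulr0.
have : msize (a * b) = 1%N by rewrite -e msizeC c0.
rewrite msizeM //.
have : (0 < msize a)%N by rewrite lt0n msize_poly_eq0.
have : (0 < msize b)%N by rewrite lt0n msize_poly_eq0.
move=> sb sa sab.
have /msize1_polyC ea : (msize a <= 1)%N by move: sb sa sab; move: (msize a) (msize b) => m n; lia.
have /msize1_polyC eb : (msize b <= 1)%N by move: sb sa sab; move: (msize a) (msize b) => m n; lia.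
have /ci[u|u] : c = a@_0%MM * b@_0%MM.
- by apply: mpolyC_inj; rewrite e {1}ea {1}eb mpolyCM.
- by left; rewrite ea; apply: rmorph_unit.
- by right; rewrite eb; apply: rmorph_unit.
Qed.

Lemma not_rdivides_X k (c : S) : c != 0 -> ~ rdivides 'X_k (c%:MP : {mpoly S[2]}).
Proof.
move=> c0 [w /(congr1 (mcoeff 0%MM))]; rewrite mpolyCK rmorphM /= mcoeffX.
have -> : (U_(k) == 0)%MM = false.
  by apply/eqP => /mnmP/(_ k)/eqP; rewrite mnm1E mnm0E eqxx.
by rewrite mulr0 => /eqP; rewrite (negbTE c0).
Qed.

Lemma S_to_K_neq0 (c : S) : c != 0 -> h c != 0.
Proof. by rewrite -(rmorph0 h) (inj_eq (@S_to_K_inj S 2)). Qed.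

Lemma laurent_const_quotient (y : 'I_2 -> K) i (a c : S) (g : K) :
  alg_independent y -> c != 0 -> laurent y g -> h a = g * h c -> rdivides c a.
Proof.
move=> fy c0 /(@laurent_laurent2 S y i _ fy) lg e.
apply/rdivides_polyC; apply/(@laurent2_quotient _ _ _ _ _ (@alg_independent_free _ y i fy) a%:P c 0 0 c0).
have -> : pev h (y (other i)) a%:P = g * h c by rewrite pevC; exact: e.
by rewrite !expr0 mul1r mulr1 mulfK //; exact: S_to_K_neq0.
Qed.

Lemma laurent_const_ldivides (y : 'I_2 -> K) i (a c : S) :
  alg_independent y -> rdivides c a -> ldivides y (ev y c%:MP) (h a).
Proof.
move=> fy [d ->]; exists (h d); last by rewrite evC rmorphM.
by exists 0%MM, d%:MP; rewrite /lev evC /mmap1 big1 ?divr1 // => k _; rewrite mnm0E.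
Qed.

(** In rank two the common factors involve no variable. *)
Lemma common_factorP (y : 'I_2 -> K) i a q : alg_independent y ->
  common_factor y i (other i) (h a) q <->
  exists c, [/\ q = c%:MP, irreducible_elt c & rdivides c a].
Proof.
move=> fy; split=> [[qi ni no _ [g lg e]]|[c [-> ci ca]]].
  have [c eq] := const_of_not_involves ni no; exists c.
  rewrite eq evC in e; rewrite eq in qi.
  have ci := irreducible_const qi; split=> //.
  by case: ci => c0 _ _; apply: laurent_const_quotient fy c0 lg e.
have [c0 _ _] := ci.
split; first exact: irreducible_mpolyC.
- by rewrite -(uniXC i) involves_uniX size_polyC; case: eqP.
- by rewrite -(uniXC (other i)) involves_uniX size_polyC; case: eqP.
- by move=> k; apply: not_rdivides_X.
- exact: (@laurent_const_ldivides y i).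
Qed.

(** R is z^d Q(P(0)/z) with scalar factors removed. *)
Definition factor_free P Q R : Prop :=
  exists (r : seq S) u,
    [/\ {in r, forall d, irreducible_elt d /\ rdivides d P`_0},
        u \is a GRing.unit & (\prod_(d <- r) d) *: R = u *: revp Q P`_0].

(** Mutation expressed by the univariate exchange polynomials: the only data left
are the exponent m of the exchange Laurent polynomial and the scalars removed
from z^d Q(P(0)/z). *)
Definition mutation2 t i t' : Prop :=
  let P := upoly t i in let Q := upoly t (other i) in
  exists m : nat,
   [/\ laurent_exp P Q m,
       clus t' i * clus t i * clus t (other i) ^+ m = pev h (clus t (other i)) P,
       clus t' (other i) = clus t (other i),
       upoly t' i = P &
       if (size Q <= 1)%N then
         exists2 u, u \is a GRing.unit & upoly t' (other i) = u *: Q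
       else factor_free P Q (upoly t' (other i))].

End RankTwoMutationP.

Lemma pev0 (S : idomainType) (K : fieldType) (h : {rmorphism S -> K}) P :
  pev h 0 P = h P`_0.
Proof. by rewrite pevE horner_coef0 coef_map. Qed.

Lemma pevZ (S : idomainType) (K : fieldType) (h : {rmorphism S -> K}) x c P :
  pev h x (c *: P) = h c * pev h x P.
Proof. by rewrite -mul_polyC rmorphM /= pevC. Qed.

Lemma mul_div_cancel (K : fieldType) (a u w : K) :
  u != 0 -> w != 0 -> a = u * w * (a / (w * u)).
Proof. by move=> u0 w0; field; rewrite u0. Qed.

Lemma eq_div_of_mul (K : fieldType) (g a d u w : K) :
  u != 0 -> w != 0 -> d * a = u * (g * w) -> g = a / (w * u) * d.
Proof. by move=> u0 w0 e; rewrite mulrAC [a * d]mulrC e; field; rewrite u0. Qed.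

Lemma prod_irreducible_neq0 (S : idomainType) (r : seq S) :
  {in r, forall d, irreducible_elt d} -> \prod_(d <- r) d != 0.
Proof. by move=> hr; rewrite prodf_seq_neq0; apply/allP => d /hr[]. Qed.

Section RankTwoMutationIff.
Variable S : idomainType.
Local Notation K := (ambient S 2).
Local Notation h := (@S_to_K S 2).
Implicit Types (t : lseed S 2) (i j : 'I_2) (P Q R : {poly S}).

Lemma lev_exch t i (m : 'X_{1..2}) : is_seed t -> m i = 0%N ->
  lev (clus t) m (exch t i) =
  pev h (clus t (other i)) (upoly t i) / clus t (other i) ^+ m (other i).
Proof.
move=> st mi; rewrite /lev -/(exchK t i) seed_exchK // (mmap1_ord2 _ _ i) mi.
by rewrite expr0 mul1r.
Qed.

Lemma prod_but_other (y : 'I_2 -> K) i (a : 'I_2 -> int) :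
  \prod_(k | k != other i) y k ^ a k = y i ^ a i.
Proof.
rewrite (big_pred1 i) // => k; have [->|->] := ord2P i k.
  by rewrite /= eqxx eq_sym other_neq.
by rewrite /= eqxx (negbTE (other_neq i)).
Qed.


Section OneMutation.
Variables (t t' : lseed S 2) (i : 'I_2).
Hypotheses (st : is_seed t) (st' : is_seed t').
Local Notation P := (upoly t i).
Local Notation Q := (upoly t (other i)).
Local Notation R := (upoly t' (other i)).
Local Notation z := (clus t' i).

Let z0 : z != 0 := seed_neq0 i st'.
Let zI : injective (pev h z) := pev_inj (@seed_free S t' i st').

Lemma exchK_other (u : lseed S 2) : is_seed u ->
  exchK u (other i) = pev h (clus u i) (upoly u (other i)).
Proof. by move=> su; rewrite seed_exchK // otherK. Qed.

Lemma ev_subst_exch f : ev (subst (clus t) i f) (exch t (other i)) = pev h f Q.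
Proof. by rewrite seed_exch // otherK ev_uniX /subst /= eqxx. Qed.

Lemma propto_const : (size Q <= 1)%N ->
  propto (exchK t' (other i)) (exchK t (other i)) <->
  exists2 u, u \is a GRing.unit & R = u *: Q.
Proof.
move=> sQ; have [eQ _] := seed_const st sQ.
have e c (w : K) : pev h w (c *: Q) = h c * exchK t (other i).
  by rewrite pevZ exchK_other // eQ !pevC.
split=> -[u uu eu]; exists u => //; first by apply: zI; rewrite e -exchK_other.
by rewrite exchK_other // eu e.
Qed.

Let hP0 := h P`_0.

Lemma exchange_factors H :
  factors_removed (clus t') i (other i) hP0 (pev h (hP0 / z) Q) H ->
  exists2 r : seq S, {in r, forall d, irreducible_elt d /\ rdivides d P`_0} &
    pev h (hP0 / z) Q = H * h (\prod_(d <- r) d).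
Proof.
move=> [_ [r hr e] _]; exists [seq mcoeff 0%MM q | q <- r].
  move=> d /mapP[q qr ->]; have := hr q qr.
  move/(@common_factorP S (clus t') i _ q (seed_alg_independent st')).
  by move=> [c [-> ci ca]]; rewrite mpolyCK.
rewrite e; congr (_ * _); rewrite big_map.
rewrite -[LHS]/(mmap h (clus t') _) !rmorph_prod; apply: eq_big_seq => q /hr.
move/(@common_factorP S (clus t') i _ q (seed_alg_independent st')).
by move=> [c [-> ci ca]]; rewrite mpolyCK; exact: mmapC.
Qed.

Lemma factor_free_of_removed H (u : S) (a : 'I_2 -> int) :
  u \is a GRing.unit ->
  factors_removed (clus t') i (other i) hP0 (pev h (hP0 / z) Q) H ->
  exchK t' (other i) = h u * (\prod_(k | k != other i) clus t' k ^ a k) * H ->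
  factor_free P Q R.
Proof.
move=> uu /exchange_factors[r hr eG] eR; exists r, u; split=> //.
apply: (@exchange_poly _ _ _ z zI z0 Q R _ _ _ (a i));
  rewrite ?seed_coef0 ?(unit_neq0 uu) //.
  by apply: prod_irreducible_neq0 => d /hr[].
rewrite -exchK_other // eR (prod_but_other (clus t')) -[pev _ (_ / _) Q]/(pev h (hP0 / z) Q) eG.
by rewrite -!mulrA.
Qed.

(** The element H from which common factors have been removed is R(z) / z^d up to
a unit, and R is primitive. *)
Lemma removed_of_factor_free : (1 < size Q)%N -> factor_free P Q R ->
  exists H, factors_removed (clus t') i (other i) hP0 (pev h (hP0 / z) Q) H /\
    exists (u : S) (a : 'I_2 -> int),
      [/\ u \is a GRing.unit,
          exchK t' (other i) = h u * (\prod_(k | k != other i) clus t' k ^ a k) * H,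
          ~~ involves (other i) (exch t' (other i)) &
          forall k, ~ rdivides 'X_k (exch t' (other i))].
Proof.
move=> sQ [r [u [hr uu e]]]; set d := \prod_(d <- r) d in e.
have fy := seed_alg_independent st'.
have d0 : d != 0 by apply: prod_irreducible_neq0 => c /hr[].
have hu := S_to_K_unit 2 uu.
have sR : (1 < size R)%N.
  have := congr1 (fun p : {poly S} => size p) e.
  by rewrite !size_scale ?(unit_neq0 uu) // size_revp ?seed_coef0 // => ->.
pose n := (size Q).-1.
pose H := pev h z R / (z ^+ n * h u).
have lH c : c != 0 -> laurent (clus t') (H / h c) -> rdivides c%:P R.
  move=> c0 /(@laurent_laurent2 S (clus t') (other i) _ fy); rewrite otherK => l.
  have uc0 : u * c != 0 by rewrite mulf_neq0 ?(unit_neq0 uu).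
  have free := @seed_free S t' (other i) st'; rewrite otherK in free.
  have /(laurent2_quotient free R 0 n uc0)[g eg] :
      laurent2 h (clus t' (other i)) z (pev h z R * z ^+ 0 / (z ^+ n * h (u * c))).
    by rewrite expr0 mulr1 rmorphM mulrA invfM mulrA; exact: l.
  by exists (u%:P * g); rewrite eg polyCM; ring.
have lH1 : laurent (clus t') H.
  apply/(@laurent_laurent2 S (clus t') (other i) _ fy); rewrite otherK.
  have free := @seed_free S t' (other i) st'; rewrite otherK in free.
  have -> : H = pev h z R * z ^+ 0 / (z ^+ n * h u) by rewrite expr0 mulr1.
  apply/(laurent2_quotient free R 0 n (unit_neq0 uu)).
  by exists (u^-1 *: R); rewrite mulrC mul_polyC scalerA divrr ?scale1r.
exists H; split; last first.
  exists u, (fun=> n%:Z); split; try by case: st'.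
  rewrite (prod_but_other (clus t')) (exchK_other st').
  exact: (mul_div_cancel _ hu (expf_neq0 n z0)).
split=> //.
  exists [seq c%:MP | c <- r].
    move=> q /mapP[c /hr[ci ca] ->].
    by apply/(@common_factorP S (clus t') i _ _ fy); exists c.
  have -> : ev (clus t') (\prod_(q <- [seq c%:MP | c <- r]) q) = h d.
    rewrite big_map -[LHS]/(mmap h (clus t') _) !rmorph_prod.
    by apply: eq_bigr => c _; exact: mmapC.
  have e3 := congr1 (pev h z) e; rewrite !pevZ pev_revp // -/n in e3.
  exact: (eq_div_of_mul hu (expf_neq0 n z0) e3).
move=> q /(@common_factorP S (clus t') i _ _ fy)[c [-> ci _]] [g lg eg].
have [c0 _ _] := ci; apply: (seed_primitive st' sR ci); apply: (lH c c0).
rewrite evC in eg; have hc := S_to_K_neq0 c0.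
have -> : H / h c = g by rewrite eg; exact: (mulfK hc g).
exact: lg.
Qed.

End OneMutation.

End RankTwoMutationIff.

Section MutationP.
Variable S : idomainType.
Local Notation K := (ambient S 2).
Local Notation h := (@S_to_K S 2).
Implicit Types (t : lseed S 2) (i j : 'I_2) (P Q R : {poly S}).

Lemma div_div_eq (F : fieldType) (a b c d : F) :
  b != 0 -> c != 0 -> a = d / c / b <-> a * b * c = d.
Proof.
move=> b0 c0; split=> [->|<-]; first by rewrite !divfK.
by rewrite mulfK // mulfK.
Qed.

Lemma lev_subst0 t i (m : 'X_{1..2}) : is_seed t -> m i = 0%N -> m (other i) = 0%N ->
  lev (subst (clus t) (other i) 0) m (exch t i) = h (upoly t i)`_0.
Proof.
by move=> st mi mo; rewrite lev_subst // mo expr0 divr1; exact: pev0.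
Qed.

Lemma mutationP t t' i : is_seed t -> is_seed t' ->
  mutation t i t' <-> mutation2 t i t'.
Proof.
move=> st st'; split=> [[m lm [e1 e2 e3 e4 e5]]|[m [le e1 e2 e3 e4]]].
  have [mi le] := (exch_laurentP i m st).1 lm.
  have ej := e2 _ (other_neq i).
  exists (m (other i)); split=> //.
  - rewrite lev_exch // in e1.
    exact: ((div_div_eq _ _ (seed_neq0 i st) (expf_neq0 _ (seed_neq0 (other i) st))).1 e1).
  - exact: (seed_upoly_inj st' st ej e3).
  case: leqP => sQ.
    apply/(propto_const st st' sQ); apply: e4 (other_neq i) _.
    by rewrite seed_involves // -leqNgt.
  have mo : m (other i) = 0%N by move: le; rewrite /laurent_exp leqNgt sQ.
  have inv : involves i (exch t (other i)) by rewrite seed_involves.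
  have := e5 _ (other_neq i) inv; rewrite /= lev_subst0 // ev_subst_exch //.
  by move=> [H [fr [u [a [uu eR _ _]]]]]; exact: (factor_free_of_removed st st' uu fr eR).
pose m' := (U_(other i) *+ m)%MM.
have mi : m' i = 0%N by rewrite /m' -{2}(otherK i) mnmXother.
have mo : m' (other i) = m by rewrite /m' mnmXi.
exists m'; first by apply/exch_laurentP => //; rewrite mo.
split.
- rewrite lev_exch // mo.
  exact: ((div_div_eq _ _ (seed_neq0 i st) (expf_neq0 _ (seed_neq0 (other i) st))).2 e1).
- by move=> j /otherP->.
- by rewrite !seed_exchK // e2 e3.
- move=> j /otherP->; rewrite seed_involves // -leqNgt => sQ.
  by apply/(propto_const st st' sQ); move: e4; rewrite sQ.
move=> j /otherP->; rewrite seed_involves // => sQ.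
have m0 : m = 0%N by move: le; rewrite /laurent_exp leqNgt sQ.
rewrite m0 in mo.
rewrite /= lev_subst0 // ev_subst_exch //; apply: removed_of_factor_free => //.
by move: e4; rewrite leqNgt sQ.
Qed.

End MutationP.

(** * Rescaling of seeds *)

Section ScaleVariables.
Variables (n : nat) (R : comNzRingType).

Definition scale_vars (u : 'I_n -> R) : {mpoly R[n]} -> {mpoly R[n]} :=
  mmap (@mpolyC n R) (fun k => (u k)%:MP * 'X_k).
HB.instance Definition _ u := GRing.RMorphism.on (scale_vars u).

Lemma scale_varsC u c : scale_vars u c%:MP = c%:MP.
Proof. exact: mmapC. Qed.

Lemma scale_varsX u k : scale_vars u 'X_k = (u k)%:MP * 'X_k.
Proof. by rewrite /scale_vars mmapX mmap1U. Qed.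

Lemma scale_varsK (u v : 'I_n -> R) : (forall k, u k * v k = 1) ->
  cancel (scale_vars u) (scale_vars v).
Proof.
move=> uv p; apply: (@mpoly_rmorph_eq n R _ (scale_vars v \o scale_vars u) idfun).
  by move=> c /=; rewrite !scale_varsC.
by move=> k /=; rewrite scale_varsX rmorphM /= scale_varsC scale_varsX mulrA -mpolyCM uv mul1r.
Qed.

Lemma mmap_scale_vars (T : comNzRingType) (f : {rmorphism R -> T})
    (y y' : 'I_n -> T) (u : 'I_n -> R) p :
  (forall k, y' k = f (u k) * y k) -> mmap f y' p = mmap f y (scale_vars u p).
Proof.
move=> ey; apply: (@mpoly_rmorph_eq n R T (mmap f y') (mmap f y \o scale_vars u)).
  by move=> c /=; rewrite scale_varsC !mmapC.
by move=> k /=; rewrite scale_varsX rmorphM /= mmapC !mmapX !mmap1U ey.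
Qed.

End ScaleVariables.

Lemma irreducible_iso (R : idomainType) (f g : {rmorphism R -> R}) a :
  cancel f g -> cancel g f -> irreducible_elt a -> irreducible_elt (f a).
Proof.
move=> fK gK [a0 au ai]; split.
- by rewrite -(rmorph0 f) (inj_eq (can_inj fK)).
- by apply: contraNN au => fu; rewrite -(fK a); apply: rmorph_unit.
move=> b c e; have /ai[] : a = g b * g c by rewrite -rmorphM -e fK.
  by move=> u; left; rewrite -(gK b); apply: rmorph_unit.
by move=> u; right; rewrite -(gK c); apply: rmorph_unit.
Qed.

Lemma irreducible_unit_mul (R : idomainType) (c a : R) :
  c \is a GRing.unit -> irreducible_elt a -> irreducible_elt (c * a).
Proof. by move=> cu ai; rewrite mulrC; apply: irreducible_mul_unit. Qed.

(** Compare the coefficients of P(u z) and w P'(z), as y is transcendental. *)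
Lemma pev_scale_coef (S : idomainType) (K : fieldType) (h : {rmorphism S -> K})
    (y : K) (u w : S) (P P' : {poly S}) :
  injective (pev h y) -> pev h (h u * y) P = h w * pev h y P' ->
  forall k, P`_k * u ^+ k = w * P'`_k.
Proof.
move=> yI e k; pose P1 := \poly_(k < size P) (P`_k * u ^+ k).
have /(congr1 (fun p : {poly S} => p`_k)) : P1 = w *: P'.
  apply: yI; rewrite pevZ -e !(@pev_wide _ _ _ (size P)) ?size_poly //.
  apply: eq_bigr => l _; rewrite coef_poly ltn_ord rmorphM rmorphXn exprMn.
  by rewrite mulrA.
rewrite coefZ coef_poly; case: ltnP => // sk <-.
by rewrite nth_default // mul0r.
Qed.

Section EquivalentSeeds.
Variable S : idomainType.
Local Notation K := (ambient S 2).
Local Notation h := (@S_to_K S 2).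
Implicit Types (t s : lseed S 2) (i j : 'I_2).

(** Scaling the variables by units is an automorphism of the polynomial ring. *)
Lemma transcendence_basis_scale (x y : 'I_2 -> K) (u v : 'I_2 -> S) :
  (forall k, u k * v k = 1) -> (forall k, y k = h (u k) * x k) ->
  transcendence_basis x -> transcendence_basis y.
Proof.
move=> uv ey [ix sx].
pose uF k := tofrac (u k); pose vF k := tofrac (v k).
have uvF k : uF k * vF k = 1 by rewrite -tofracM uv tofrac1.
have vuF k : vF k * uF k = 1 by rewrite mulrC uvF.
have e p : mmap (@frac_to_K S 2) y p = mmap (@frac_to_K S 2) x (scale_vars uF p).
  by apply: mmap_scale_vars => k; rewrite ey.
split=> [p|f]; first by rewrite e => /ix e0; rewrite -(scale_varsK uvF p) e0 rmorph0.
have [p p0 rp] := sx f.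
have ep : map_poly (mmap (@frac_to_K S 2) y) (map_poly (scale_vars vF) p) =
          map_poly (mmap (@frac_to_K S 2) x) p.
  rewrite -map_poly_comp_id0 ?rmorph0 //; apply: eq_map_poly => q /=.
  by rewrite e (scale_varsK vuF).
by exists (map_poly (scale_vars vF) p); rewrite ep.
Qed.

Lemma propto_units (I : finType) (x y : I -> K) :
  (forall k, propto (x k) (y k)) ->
  exists u v : I -> S, (forall k, u k * v k = 1) /\ (forall k, x k = h (u k) * y k).
Proof.
move=> pxy; have /choice[u hu] : forall k, exists c, c \is a GRing.unit /\ x k = h c * y k.
  by move=> k; have [c cu e] := pxy k; exists c.
by exists u, (fun k => (u k)^-1); split=> k; have [uu e] := hu k; rewrite ?divrr.
Qed.

Lemma scale_vars_uniX (u : 'I_2 -> S) i (P : {poly S}) :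
  scale_vars u (uniX i P) = uniX i (\poly_(k < size P) (P`_k * u i ^+ k)).
Proof.
rewrite uniX_sum rmorph_sum poly_def rmorph_sum; apply: eq_bigr => k _.
rewrite -mul_mpolyC -mpolyXn rmorphM rmorphXn /= scale_varsC scale_varsX exprMn.
rewrite -mul_polyC rmorphM rmorphXn /= uniXC uniXX mulrA; congr (_ * _).
by rewrite mpolyCM [in RHS]rmorphXn.
Qed.

Lemma propto_refl (f : K) : propto f f.
Proof. by exists 1; rewrite ?unitr1 // rmorph1 mul1r. Qed.

Lemma propto_sym (f g : K) : propto f g -> propto g f.
Proof.
move=> [u uu ->]; exists u^-1; rewrite ?unitrV // mulrA.
by rewrite -[_ * h u]rmorphM mulVr // rmorph1 mul1r.
Qed.

Lemma propto_trans (f g k : K) : propto f g -> propto g k -> propto f k.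
Proof.
move=> [u uu ->] [v vu ->]; exists (u * v); first by rewrite unitrM uu.
by rewrite mulrA rmorphM.
Qed.

Lemma equiv_labelled_sym s t : equiv_labelled s t -> equiv_labelled t s.
Proof. by move=> e i; have [e1 e2] := e i; split; apply: propto_sym. Qed.

Lemma equiv_labelled_trans s t r :
  equiv_labelled s t -> equiv_labelled t r -> equiv_labelled s r.
Proof.
move=> e e' i; have [e1 e2] := e i; have [e3 e4] := e' i.
by split; [apply: propto_trans e3|apply: propto_trans e4].
Qed.

Lemma is_seed_equiv s t : is_seed t -> equiv_labelled s t -> is_seed s.
Proof.
move=> st e; have [bt it dt nt] := st.
have [u [v [uv ec]]] := propto_units (fun i => (e i).1).
have vu k : v k * u k = 1 by rewrite mulrC uv.
have bs := transcendence_basis_scale uv ec bt.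
have ev_s p : ev (clus s) (scale_vars v p) = ev (clus t) p.
  apply/esym/mmap_scale_vars => k; rewrite ec mulrA.
  by rewrite -[h (v k) * _]rmorphM vu rmorph1 mul1r.
have ee i : exists2 w : S, w \is a GRing.unit &
    exch s i = w%:MP * scale_vars v (exch t i).
  have [_ [w wu ew]] := e i; exists w => //; apply: (ev_inj bs.1).
  rewrite -[LHS]/(exchK s i) ew -[RHS]/(mmap h (clus s) _) rmorphM /= mmapC.
  by congr (_ * _); rewrite -[RHS]/(ev (clus s) _) ev_s.
split=> // [i|i j|i]; have [w wu ew] := ee i; rewrite ew.
- apply: irreducible_unit_mul; first exact: rmorph_unit.
  by apply: (@irreducible_iso _ (scale_vars v) (scale_vars u)); [exact: scale_varsK|exact: scale_varsK|].
- move=> [q eq]; apply: (dt i j).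
  have e1 : w%:MP * exch t i = scale_vars u q * ((u j)%:MP * 'X_j).
    by rewrite -scale_varsX -rmorphM -eq rmorphM /= scale_varsC (scale_varsK vu).
  have wV : (w^-1)%:MP * w%:MP = 1 :> {mpoly S[2]} by rewrite -mpolyCM mulVr.
  exists ((w^-1)%:MP * (scale_vars u q * (u j)%:MP)).
  by rewrite -!mulrA -e1 mulrA wV mul1r.
have ni : ~~ involves (other (other i)) (exch t i) by rewrite otherK.
rewrite -(univK ni) scale_vars_uniX -(uniXC (other i)) -rmorphM /=.
by have := @not_involves_uniX S (other i); rewrite otherK; apply.
Qed.

Lemma equiv_rescaling s t : is_seed s -> is_seed t -> equiv_labelled s t ->
  exists u w : 'I_2 -> S, forall i,
    rescaling h (u (other i)) (w i) (clus s (other i)) (upoly s i)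
                (clus t (other i)) (upoly t i).
Proof.
move=> ss st e.
have /choice[u hu] : forall k, exists c, c \is a GRing.unit /\ clus s k = h c * clus t k.
  by move=> k; have [[c cu ec] _] := e k; exists c.
have /choice[w hw] : forall k, exists c, c \is a GRing.unit /\ exchK s k = h c * exchK t k.
  by move=> k; have [_ [c cu ec]] := e k; exists c.
exists u, w => i; have [uu eu] := hu (other i); have [wu ew] := hw i; split=> // k.
rewrite !seed_exchK // eu in ew.
exact: (pev_scale_coef (pev_inj (alg_freeC (@seed_free S t i st))) ew).
Qed.

End EquivalentSeeds.

(** * Mutation of equivalent seeds *)

Section RescaledCoefficients.
Variable S : idomainType.
Implicit Types (P Q R A B : {poly S}).

Definition coef_rescaled A B : Prop :=
  exists l m : S, [/\ l \is a GRing.unit, m \is a GRing.unit &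
                      forall k, A`_k * l ^+ k = m * B`_k].

Lemma coef_rescaled_sym A B : coef_rescaled A B -> coef_rescaled B A.
Proof.
move=> [l [m [lu mu e]]]; exists l^-1, m^-1; split; rewrite ?unitrV // => k.
apply: (mulIr (unitrX k lu)); apply: (mulrI mu).
by rewrite -[_ * l ^+ k]mulrA -exprMn mulVr // expr1n mulr1 mulrA mulrA divrr // mul1r e.
Qed.

Lemma coef_rescaled_dvd A B q w : w \is a GRing.unit -> coef_rescaled A B ->
  rdivides q%:P B -> rdivides (w * q)%:P A.
Proof.
move=> wu [l [m [lu mu e]]] /rdivides_polyC_coef dB; apply/rdivides_polyC_coef => k.
have [d ed] := dB k; exists (m * d * w^-1 * (l^-1) ^+ k).
apply: (mulIr (unitrX k lu)); rewrite e ed.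
transitivity (m * d * q * (w^-1 * w) * (l^-1 * l) ^+ k); last by rewrite exprMn; ring.
by rewrite !mulVr // expr1n; ring.
Qed.

Lemma laurent_exp_rescaled P Q P' Q' m :
  coef_rescaled (revp P' Q'`_0) (revp P Q`_0) -> size Q' = size Q ->
  (exists2 w, w \is a GRing.unit & Q'`_0 = w * Q`_0) ->
  laurent_exp P Q m -> laurent_exp P' Q' m.
Proof.
move=> cr sz [w wu e]; rewrite /laurent_exp sz; case: leqP => // _.
rewrite e !exprMn => -[d nd]; split.
  by apply: coef_rescaled_dvd d; rewrite ?unitrX // -e.
move=> d'; apply: nd.
have e1 : Q`_0 ^+ m.+1 = (w^-1) ^+ m.+1 * (w ^+ m.+1 * Q`_0 ^+ m.+1).
  by rewrite mulrA -exprMn mulVr // expr1n mul1r.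
rewrite e1; apply: coef_rescaled_dvd d'; rewrite ?unitrX ?unitrV //.
by apply: coef_rescaled_sym; rewrite -e.
Qed.

Lemma primitive_rescaled A B : coef_rescaled A B -> primitive B -> primitive A.
Proof.
move=> /coef_rescaled_sym cr pB q qi d; apply: (pB q qi).
by rewrite -[q]mul1r; apply: coef_rescaled_dvd d; rewrite ?unitr1.
Qed.

(** R and R' are the primitive parts of A and A', and primitive parts of
polynomials that agree up to rescaling agree up to rescaling by units. *)
Lemma factor_free_rescaled A A' R R' (d d' u u' l m : S) :
  is_ufd S -> primitive R -> primitive R' ->
  d != 0 -> d' != 0 -> u \is a GRing.unit -> u' \is a GRing.unit ->
  l \is a GRing.unit -> m \is a GRing.unit ->
  (forall k, A'`_k * l ^+ k = m * A`_k) ->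
  d *: R = u *: A -> d' *: R' = u' *: A' ->
  exists2 m', m' \is a GRing.unit & forall k, R'`_k * l ^+ k = m' * R`_k.
Proof.
move=> ufd pR pR' d0 d'0 uu u'u lu mu eA e e'.
(* R1(z) = R'(l z) *)
pose R1 := \poly_(k < size R') (R'`_k * l ^+ k).
have eR1 k : R1`_k = R'`_k * l ^+ k.
  by rewrite coef_poly; case: ltnP => // sk; rewrite nth_default // mul0r.
have pR1 : primitive R1.
  apply: (@primitive_rescaled _ R') => //; exists l^-1, 1.
  by split; rewrite ?unitrV ?unitr1 // => k; rewrite eR1 -mulrA -exprMn divrr // expr1n mulr1 mul1r.
have e1 : (u * d') *: R1 = (u' * m * d) *: R.
  apply/polyP => k; rewrite !coefZ eR1.
  have ek := congr1 (fun p : {poly S} => p`_k) e.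
  have ek' := congr1 (fun p : {poly S} => p`_k) e'.
  rewrite /= !coefZ in ek ek'.
  transitivity (u * (d' * R'`_k) * l ^+ k); first by ring.
  rewrite ek' -[RHS]mulrA ek; transitivity (u * u' * (A'`_k * l ^+ k)); first by ring.
  by rewrite eA; ring.
have nz1 : u * d' != 0 by rewrite mulf_neq0 ?(unit_neq0 uu).
have nz2 : u' * m * d != 0 by rewrite !mulf_neq0 ?(unit_neq0 u'u) ?(unit_neq0 mu).
have [c cu ec] := primitive_proportional ufd pR1 pR nz1 nz2 e1.
exists c^-1; rewrite ?unitrV // => k; apply: (mulfI nz1).
have := congr1 (fun p : {poly S} => p`_k) e1; rewrite /= !coefZ eR1 => ->.
by rewrite ec mulrACA divrr // mul1r.
Qed.

End RescaledCoefficients.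

Section MutationEquivalence.
Variable S : idomainType.
Local Notation K := (ambient S 2).
Local Notation h := (@S_to_K S 2).
Implicit Types (t s : lseed S 2) (i j : 'I_2).

(** The next variable, for m = 0, and the next exchange polynomial before removal
of scalars are determined up to rescaling by l. *)
Lemma equiv_revp s t i : is_seed s -> is_seed t -> equiv_labelled s t ->
  exists l m,
    [/\ l \is a GRing.unit, m \is a GRing.unit,
        exchK s i / clus s i = h l * (exchK t i / clus t i) &
        forall k, (revp (upoly s (other i)) (upoly s i)`_0)`_k * l ^+ k =
                  m * (revp (upoly t (other i)) (upoly t i)`_0)`_k].
Proof.
move=> ss st e; have [u [w r]] := equiv_rescaling ss st e.
have r0 := r (other i); rewrite otherK in r0.
have aux (x : lseed S 2) : is_seed x ->
    clus x i * (exchK x i / clus x i) = pev h (clus x (other i)) (upoly x i).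
  by move=> sx; rewrite -seed_exchK // mulrC divfK // seed_neq0.
have rr0 : rescaled h (clus s i) (upoly s (other i)) (clus t i) (upoly t (other i)).
  by exists (u i), (w (other i)).
have rr1 : rescaled h (clus s (other i)) (upoly s i) (clus t (other i)) (upoly t i).
  by exists (u (other i)), (w i).
have [l [m [lu mu e1 e2]]] :=
  rescaled_exchange (seed_neq0 i ss) rr0 rr1 (aux s ss) (aux t st).
by exists l, m.
Qed.

Lemma equiv_size s t i : is_seed s -> is_seed t -> equiv_labelled s t ->
  size (upoly s i) = size (upoly t i).
Proof.
by move=> ss st e; have [u [w r]] := equiv_rescaling ss st e; apply: rescaling_size (r i).
Qed.

Lemma equiv_coef0 s t i : is_seed s -> is_seed t -> equiv_labelled s t ->
  exists2 w, w \is a GRing.unit & (upoly s i)`_0 = w * (upoly t i)`_0.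
Proof.
move=> ss st e; have [u [w r]] := equiv_rescaling ss st e.
by have [_ wu _ /(_ 0%N)] := r i; rewrite mulr1; exists (w i).
Qed.

Lemma equiv_laurent_exp s t i m : is_seed s -> is_seed t -> equiv_labelled s t ->
  laurent_exp (upoly t i) (upoly t (other i)) m ->
  laurent_exp (upoly s i) (upoly s (other i)) m.
Proof.
move=> ss st e; apply: laurent_exp_rescaled; last exact: equiv_coef0.
  have [l [n [lu nu _ el]]] := equiv_revp (other i) ss st e.
  by rewrite otherK in el; exists l, n.
exact: equiv_size.
Qed.

Lemma equivP i s t :
  propto (clus s i) (clus t i) -> propto (clus s (other i)) (clus t (other i)) ->
  propto (exchK s i) (exchK t i) -> propto (exchK s (other i)) (exchK t (other i)) ->
  equiv_labelled s t.
Proof. by move=> a b c d k; case: (ord2P i k) => ->. Qed.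

Lemma proptoM (f g f' g' : K) : propto f g -> propto f' g' -> propto (f * f') (g * g').
Proof.
move=> [u uu ->] [v vu ->]; exists (u * v); first by rewrite unitrM uu.
by rewrite rmorphM mulrACA.
Qed.

Lemma proptoV (f g : K) : propto f g -> propto f^-1 g^-1.
Proof.
move=> [u uu ->]; exists u^-1; rewrite ?unitrV // invfM; congr (_ * _).
exact: (esym (rmorphV h uu)).
Qed.

Lemma proptoX (f g : K) n : propto f g -> propto (f ^+ n) (g ^+ n).
Proof.
move=> fg; elim: n => [|n IH]; first exact: propto_refl.
by rewrite !exprS; apply: proptoM.
Qed.

Lemma eq_div_div (F : fieldType) (a b c d : F) : b != 0 -> c != 0 ->
  a * b * c = d -> a = d * b^-1 * c^-1.
Proof. by move=> b0 c0 <-; field; rewrite b0 c0. Qed.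

Lemma mutation2_exchK t i t' m : is_seed t ->
  clus t' i * clus t i * clus t (other i) ^+ m = pev h (clus t (other i)) (upoly t i) ->
  clus t' i = exchK t i * (clus t i)^-1 * (clus t (other i) ^+ m)^-1.
Proof.
move=> st; rewrite -seed_exchK // => e; apply: eq_div_div e; first exact: seed_neq0.
by rewrite expf_neq0 // seed_neq0.
Qed.

Lemma seed_exchK_eq t t' i : is_seed t -> is_seed t' ->
  clus t' (other i) = clus t (other i) -> upoly t' i = upoly t i ->
  exchK t' i = exchK t i.
Proof. by move=> st st' e1 e2; rewrite !seed_exchK // e1 e2. Qed.

Hypothesis ufd : is_ufd S.

(** The exponent m and the polynomial z^d Q(P(0)/z) are compatible with
equivalence; what is removed from the latter is its content, which is
determined up to a unit. *)
Lemma mutation_equiv t s t' s' i :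
  is_seed t -> is_seed s -> is_seed t' -> is_seed s' ->
  equiv_labelled s t -> mutation t i t' -> mutation s i s' ->
  equiv_labelled s' t'.
Proof.
move=> st ss st' ss' e /(mutationP i st st')[m [le e1 e2 e3 e4]].
move=> /(mutationP i ss ss')[m' [le' e1' e2' e3' e4']].
have em := laurent_exp_uniq le' (equiv_laurent_exp ss st e le).
rewrite {}em in le' e1'.
have [pi qi] := e i; have [pj qj] := e (other i).
have pz : propto (clus s' i) (clus t' i).
  rewrite (mutation2_exchK st e1) (mutation2_exchK ss e1').
  by do 2?apply: proptoM => //; apply: proptoV => //; apply: proptoX.
apply: (@equivP i); first exact: pz.
- by rewrite e2 e2'.
- by rewrite (seed_exchK_eq st st' e2 e3) (seed_exchK_eq ss ss' e2' e3').
move: e4 e4'; rewrite (equiv_size _ ss st e); case: leqP => sQ.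
  move=> /(propto_const st st' sQ) a b.
  have sQs : (size (upoly s (other i)) <= 1)%N by rewrite (equiv_size _ ss st e).
  move/(propto_const ss ss' sQs): b => b.
  by apply: propto_trans (propto_trans b qj) (propto_sym a).
move=> [r [u [hr uu eR]]] [r' [u' [hr' u'u eR']]].
have m0 : m = 0%N by move: le; rewrite /laurent_exp leqNgt sQ.
have [l [n [lu nu el ek]]] := equiv_revp i ss st e.
have ez (x x' : lseed S 2) : is_seed x ->
    clus x' i * clus x i * clus x (other i) ^+ m = pev h (clus x (other i)) (upoly x i) ->
    clus x' i = exchK x i / clus x i.
  by move=> sx ex; rewrite (mutation2_exchK sx ex) m0 expr0 invr1 mulr1.
rewrite -(ez _ _ ss e1') -(ez _ _ st e1) in el.
have szR (x x' : lseed S 2) r0 u0 : is_seed x -> is_seed x' ->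
    (1 < size (upoly x (other i)))%N ->
    {in r0, forall d, irreducible_elt d /\ rdivides d (upoly x i)`_0} ->
    u0 \is a GRing.unit ->
    \prod_(d <- r0) d *: upoly x' (other i) = u0 *: revp (upoly x (other i)) (upoly x i)`_0 ->
    \prod_(d <- r0) d != 0 /\ primitive (upoly x' (other i)).
  move=> sx sx' sz hr0 u0u e0.
  have d0 : \prod_(d <- r0) d != 0.
    by apply: prod_irreducible_neq0 => d /hr0[].
  split=> //; apply: seed_primitive => //.
  have := congr1 (fun p : {poly S} => size p) e0.
  by rewrite !size_scale ?(unit_neq0 u0u) // size_revp ?seed_coef0 // => ->.
have [d0 pR] := szR _ _ _ _ st st' sQ hr uu eR.
have sQs : (1 < size (upoly s (other i)))%N by rewrite (equiv_size _ ss st e).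
have [d'0 pR'] := szR _ _ _ _ ss ss' sQs hr' u'u eR'.
have [n' n'u en'] := factor_free_rescaled ufd pR pR' d0 d'0 uu u'u lu nu ek eR eR'.
rewrite !exchK_other //; exists n' => //.
by apply: (@rescaling_pev _ _ h l n'); split.
Qed.

End MutationEquivalence.

Section MutationTransport.
Variable S : idomainType.
Local Notation K := (ambient S 2).
Local Notation h := (@S_to_K S 2).
Implicit Types (t s : lseed S 2) (i j : 'I_2).

Lemma monomial_inj (K' : fieldType) (h' : {rmorphism S -> K'}) (z : K') (c d : S) m n :
  injective (pev h' z) -> c != 0 -> d != 0 -> h' c * z ^+ m = h' d * z ^+ n ->
  m = n /\ c = d.
Proof.
move=> zI c0 d0 e.
have e2 : c *: 'X^m = d *: 'X^n :> {poly S}.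
  by apply: zI; rewrite !pevZ !rmorphXn /= pevX.
have := congr1 (fun p : {poly S} => size p) e2.
rewrite !size_scale // !size_polyXn => -[em]; split=> //.
have := congr1 (fun p : {poly S} => lead_coef p) e2.
by rewrite !lead_coefZ !lead_coefXn !mulr1.
Qed.

(** Rescaled data satisfy the definition of mutation as soon as the three
identities required exactly, and not only up to units, hold. *)
Lemma mutation_transport t t' s s' i m :
  is_seed t -> is_seed s -> is_seed t' -> is_seed s' ->
  equiv_labelled s t -> equiv_labelled s' t' -> mutation t i t' ->
  clus s' (other i) = clus s (other i) -> exchK s' i = exchK s i ->
  clus s' i * clus s i * clus s (other i) ^+ m = exchK s i ->
  mutation s i s'.
Proof.
move=> st ss st' ss' e e' /(mutationP i st st')[n [le e1 e2 e3 e4]] f2 f3 f1.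
have sI : injective (pev h (clus s (other i))) := pev_inj (alg_freeC (@seed_free S s i ss)).
have nm : n = m.
  have p1 : propto (exchK s i) (clus s' i * clus s i * clus s (other i) ^+ n).
    apply: propto_trans (e i).2 _; rewrite seed_exchK // -e1.
    apply: proptoM; last by apply: proptoX; apply: propto_sym; case: (e (other i)).
    by apply: proptoM; apply: propto_sym; [case: (e' i)|case: (e i)].
  have [u uu eu] := p1; rewrite -f1 in eu.
  (* cancelling both variables leaves monomials in the remaining variable *)
  have e0 : h 1 * clus s (other i) ^+ m = h u * clus s (other i) ^+ n.
    apply: (mulfI (mulf_neq0 (seed_neq0 i ss') (seed_neq0 i ss))).
    by rewrite rmorph1 mul1r eu mulrCA.
  by have [] := monomial_inj sI (oner_neq0 S) (unit_neq0 uu) e0.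
apply/mutationP => //; exists m; split=> //.
- by rewrite -nm; apply: equiv_laurent_exp ss st e le.
- by rewrite f1 seed_exchK.
- exact: seed_upoly_inj.
move: e4; rewrite (equiv_size _ ss st e); case: leqP => sQ.
  move=> /(propto_const st st' sQ) a.
  have sQs : (size (upoly s (other i)) <= 1)%N by rewrite (equiv_size _ ss st e).
  apply/(propto_const ss ss' sQs).
  apply: propto_trans (e' _).2 _; apply: propto_trans a _.
  by apply: propto_sym; case: (e (other i)).
move=> [r [u [hr uu eR]]].
have n0 : n = 0%N by move: le; rewrite /laurent_exp leqNgt sQ.
have m0 : m = 0%N by rewrite -nm.
have [l [c [lu cu el ek]]] := equiv_revp i ss st e.
have ez (x x' : lseed S 2) : is_seed x ->
    clus x' i * clus x i * clus x (other i) ^+ 0 = exchK x i ->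
    clus x' i = exchK x i / clus x i.
  by move=> sx <-; rewrite expr0 mulr1 mulfK // seed_neq0.
rewrite m0 in f1; rewrite n0 in e1.
have es : clus s' i = exchK s i / clus s i by apply: ez.
have et : clus t' i = exchK t i / clus t i.
  by apply: ez; rewrite // e1 seed_exchK.
rewrite -es -et in el.
have [v [w rs]] := equiv_rescaling ss' st' e'; have := rs (other i).
rewrite otherK => -[vu wu ev ew].
have vl : v i = l.
  by apply: (@S_to_K_inj S 2); apply: (mulIf (seed_neq0 i st')); rewrite -ev el.
rewrite vl in ew.
have [w0 w0u ew0] := equiv_coef0 i ss st e.
exists r, (w (other i) * u * c^-1); split.
- move=> d /hr[di dd]; split=> //; rewrite ew0.
  by case: dd => g ->; exists (w0 * g); rewrite mulrA.
- by rewrite !unitrM wu uu unitrV.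
apply/polyP => k; rewrite !coefZ; apply: (mulIr (unitrX k lu)).
rewrite -[LHS]mulrA ew -[RHS]mulrA ek.
have := congr1 (fun p : {poly S} => p`_k) eR; rewrite /= !coefZ => eRk.
transitivity (w (other i) * (\prod_(d <- r) d * (upoly t' (other i))`_k)); first by ring.
rewrite eRk; transitivity (w (other i) * u * (c^-1 * c) * (revp (upoly t (other i)) (upoly t i)`_0)`_k).
  by rewrite mulVr // mulr1 mulrA.
by ring.
Qed.

End MutationTransport.

(** * Normalization *)

Section Relabelling.
Variable S : idomainType.
Local Notation K := (ambient S 2).
Local Notation h := (@S_to_K S 2).
Implicit Types (t s : lseed S 2) (i j : 'I_2) (w : 'S_2).

Lemma clus_relabel w t i : clus (relabel w t) i = clus t (w i).
Proof. by rewrite /clus /relabel /= ffunE. Qed.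

Lemma exchK_relabel w t i : exchK (relabel w t) i = exchK t (w i).
Proof.
rewrite /exchK /exch /relabel /= ffunE.
set y := [ffun k => _]; set p := fun_of_fin _ _.
pose g : {rmorphism {mpoly S[2]} -> K} := mmap h y \o msym w^-1%g.
apply: (@mpoly_rmorph_eq 2 S K g (mmap h (clus t))) => [c|k].
  by rewrite /= /msym !mmapC.
by rewrite /= /msym mmapX mmap1U !mmapX !mmap1U /y ffunE permKV.
Qed.

Lemma perm_other w i : w (other i) = other (w i).
Proof. by apply: otherP; rewrite (inj_eq perm_inj) other_neq. Qed.

Lemma equiv_relabel w s t :
  equiv_labelled s t -> equiv_labelled (relabel w s) (relabel w t).
Proof. by move=> e i; rewrite !clus_relabel !exchK_relabel. Qed.

Lemma equiv_labelled_refl t : equiv_labelled t t.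
Proof. by move=> i; split; apply: propto_refl. Qed.

(** Equality of representatives expresses equality up to units. *)
Definition rep (f : K) : K := epsilon (inhabits 0) (fun g => propto g f).

Lemma rep_propto f : propto (rep f) f.
Proof.
apply: (epsilon_spec (inhabits 0) (fun g => propto g f)).
by exists f; apply: propto_refl.
Qed.

Lemma rep_eq f g : propto f g -> rep f = rep g.
Proof.
move=> fg; rewrite /rep; congr epsilon; apply: functional_extensionality => k.
apply: propositional_extensionality; split=> e; first exact: propto_trans fg.
exact: propto_trans (propto_sym fg).
Qed.

End Relabelling.

Section Normalization.
Variables (S : idomainType) (A : lp_algebra S 2).
Hypothesis ufd : is_ufd S.
Local Notation K := (ambient S 2).
Local Notation h := (@S_to_K S 2).
Local Notation mu := (lp_mu A).
Local Notation seed := (lp_seeds A).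
Implicit Types (t s : lseed S 2) (i j : 'I_2) (w : 'S_2).

Lemma lp_exchange t i : seed t ->
  exists m, clus (mu i t) i * clus t i * clus t (other i) ^+ m = exchK t i.
Proof.
move=> At; have st := lp_is_seed At; have st' := lp_is_seed (lp_seeds_mu i At).
have /(mutationP i st st')[m [_ e _ _ _]] := lp_mutation i At.
by exists m; rewrite e seed_exchK.
Qed.

Lemma lp_clus_other t i : seed t -> clus (mu i t) (other i) = clus t (other i).
Proof. by move=> At; have [m _ [_ e _ _ _]] := lp_mutation i At; rewrite e ?other_neq. Qed.

Lemma lp_exchK t i : seed t -> exchK (mu i t) i = exchK t i.
Proof. by move=> At; have [m _ [_ _ e _ _]] := lp_mutation i At. Qed.

Lemma lp_mu_equiv t s i : seed t -> seed s -> equiv_labelled t s ->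
  equiv_labelled (mu i t) (mu i s).
Proof.
move=> At As e.
exact: (mutation_equiv ufd (lp_is_seed As) (lp_is_seed At)
  (lp_is_seed (lp_seeds_mu i As)) (lp_is_seed (lp_seeds_mu i At)) e
  (lp_mutation i As) (lp_mutation i At)).
Qed.

(** In the normal form of a seed all variables are representatives, and each
exchange polynomial is scaled so that the exchange relation holds exactly
between representatives. *)
Definition norm_spec t s : Prop :=
  (forall k, clus s k = rep (clus t k)) /\
  forall i, propto (exchK s i) (exchK t i) /\
    exists m, exchK s i =
      rep (clus (mu i t) i) * rep (clus t i) * rep (clus t (other i)) ^+ m.

Lemma norm_equiv t s : norm_spec t s -> equiv_labelled s t.
Proof.
by move=> [ec ee] i; rewrite ec; split; [exact: rep_propto|case: (ee i)].
Qed.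

(** The right-hand side of the exchange relation differs from the exchange
polynomial by a unit, which can be absorbed in the polynomial. *)
Lemma norm_exists t : seed t -> exists s, norm_spec t s.
Proof.
move=> At.
have [u [v [uv eu]]] := propto_units (fun k => rep_propto (clus t k)).
have vu k : v k * u k = 1 by rewrite mulrC uv.
have /choice[E hE] : forall i, exists p : {mpoly S[2]},
    propto (ev (fun k => rep (clus t k)) p) (exchK t i) /\
    exists m, ev (fun k => rep (clus t k)) p =
      rep (clus (mu i t) i) * rep (clus t i) * rep (clus t (other i)) ^+ m.
  move=> i; have [m em] := lp_exchange i At.
  have [c cu ec] : propto
      (rep (clus (mu i t) i) * rep (clus t i) * rep (clus t (other i)) ^+ m) (exchK t i).
    by rewrite -em; do !apply: proptoM; rewrite ?rep_propto //;
      try apply: proptoX; apply: rep_propto.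
  have e1 : ev (fun k => rep (clus t k)) (scale_vars v (c%:MP * exch t i)) =
      h c * exchK t i.
    transitivity (ev (clus t) (c%:MP * exch t i)).
      apply/esym/mmap_scale_vars => k; rewrite eu mulrA.
      by rewrite -[h (v k) * _]rmorphM vu rmorph1 mul1r.
    by rewrite -[LHS]/(mmap h (clus t) _) rmorphM /= mmapC.
  exists (scale_vars v (c%:MP * exch t i)); rewrite e1; split; first by exists c.
  by exists m; rewrite ec.
exists ([ffun k => rep (clus t k)], [ffun i => E i]).
have ec k : clus ([ffun k => rep (clus t k)], [ffun i => E i]) k = rep (clus t k).
  by rewrite /clus /= ffunE.
split=> // i; have [h1 h2] := hE i.
suff -> : exchK ([ffun k => rep (clus t k)], [ffun i => E i]) i =
    ev (fun k => rep (clus t k)) (E i) by [].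
rewrite /exchK /exch /= ffunE; congr (ev _ _).
by apply: functional_extensionality.
Qed.

Lemma norm_is_seed t s : seed t -> norm_spec t s -> is_seed s.
Proof. by move=> At /norm_equiv; apply: is_seed_equiv; apply: lp_is_seed At. Qed.

Lemma seed_eq s s' : is_seed s -> (forall k, clus s k = clus s' k) ->
  (forall i, exchK s i = exchK s' i) -> s = s'.
Proof.
move=> ss ec ee; have e1 : s.1 = s'.1 by apply/ffunP.
have e2 : s.2 = s'.2.
  apply/ffunP => i; apply: (ev_inj (seed_alg_independent ss)).
  by rewrite -[LHS]/(exchK s i) ee /exchK /clus e1.
by case: s s' e1 e2 {ss ec ee} => [a b] [a' b'] /= -> ->.
Qed.

(** The exchange relation fixes the product of two variables exactly, and the
remaining monomial factor is not a nontrivial unit: two normal forms of an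
exchange polynomial that agree up to a unit are equal. *)
Lemma exchK_rigid s i (f g g' : K) m m' : is_seed s -> f != 0 ->
  g = f * clus s (other i) ^+ m -> g' = f * clus s (other i) ^+ m' ->
  propto g g' -> g = g'.
Proof.
move=> ss f0 eg eg' [c cu ec].
have sI : injective (pev h (clus s (other i))) := pev_inj (alg_freeC (@seed_free S s i ss)).
have e0 : h 1 * clus s (other i) ^+ m = h c * clus s (other i) ^+ m'.
  by apply: (mulfI f0); rewrite rmorph1 mul1r -eg ec eg' mulrCA.
have [_ c1] := monomial_inj sI (oner_neq0 S) (unit_neq0 cu) e0.
by rewrite ec -c1 rmorph1 mul1r.
Qed.

Lemma rep_neq0 t k : seed t -> rep (clus t k) != 0.
Proof.
move=> At; have [c cu ->] := rep_propto (clus t k).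
by rewrite mulf_neq0 ?seed_neq0 ?S_to_K_unit //; apply: lp_is_seed At.
Qed.

Lemma norm_uniq t t' s s' : seed t -> seed t' -> equiv_labelled t t' ->
  norm_spec t s -> norm_spec t' s' -> s = s'.
Proof.
move=> At At' e ns ns'; have ss := norm_is_seed At ns.
have er k : rep (clus t k) = rep (clus t' k) by apply: rep_eq; case: (e k).
apply: seed_eq => // [k|i]; first by rewrite ns.1 ns'.1 er.
have emu : rep (clus (mu i t) i) = rep (clus (mu i t') i).
  by apply: rep_eq; case: (lp_mu_equiv i At At' e i).
have [p1 [m1 e1]] := ns.2 i; have [p2 [m2 e2]] := ns'.2 i.
rewrite -emu -!er -(ns.1 (other i)) in e2; rewrite -(ns.1 (other i)) in e1.
apply: (exchK_rigid ss _ e1 e2).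
  by rewrite mulf_neq0 ?rep_neq0 //; apply: lp_seeds_mu.
by apply: propto_trans p1 (propto_trans (e i).2 (propto_sym p2)).
Qed.

Definition norm t : lseed S 2 := epsilon (inhabits t) (norm_spec t).

Lemma normP t : seed t -> norm_spec t (norm t).
Proof. by move=> /norm_exists; apply: (epsilon_spec (inhabits t) (norm_spec t)). Qed.

Lemma norm_eq t t' : seed t -> seed t' -> equiv_labelled t t' -> norm t = norm t'.
Proof. by move=> At At' e; apply: norm_uniq e (normP At) (normP At'). Qed.

Lemma norm_relabel w t : seed t -> norm (relabel w t) = relabel w (norm t).
Proof.
move=> At; have Aw := lp_seeds_relabel w At.
apply: (norm_uniq Aw Aw (equiv_labelled_refl _) (normP Aw)).
have [nc ne] := normP At; split=> [k|i]; first by rewrite !clus_relabel nc.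
have [p1 [m em]] := ne (w i).
rewrite !exchK_relabel; split=> //; exists m.
by rewrite lp_mu_relabel // !clus_relabel perm_other.
Qed.

Definition norm_seeds s : Prop := exists2 t, seed t & norm t = s.

(** Any seed with normal form s will do, since equivalent seeds have equivalent
mutations. *)
Definition norm_inv s : lseed S 2 :=
  epsilon (inhabits s) (fun t => seed t /\ norm t = s).

Lemma norm_invP s : norm_seeds s -> seed (norm_inv s) /\ norm (norm_inv s) = s.
Proof.
move=> [t At e]; apply: (epsilon_spec (inhabits s) (fun t => seed t /\ norm t = s)).
by exists t.
Qed.

Definition norm_mu i s : lseed S 2 := norm (mu i (norm_inv s)).

Lemma norm_mu_norm i t : seed t -> norm_mu i (norm t) = norm (mu i t).
Proof.
move=> At; have [At' e] : seed (norm_inv (norm t)) /\ norm (norm_inv (norm t)) = norm t.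
  by apply: norm_invP; exists t.
apply: norm_eq; try exact: lp_seeds_mu.
apply: lp_mu_equiv => //.
apply: equiv_labelled_trans (norm_equiv (normP At)).
by have := norm_equiv (normP At'); rewrite e => /equiv_labelled_sym.
Qed.

(** The required exchange relation is the one imposed on normal forms, and the
mutation at i of the mutated seed leads back: the exchange polynomial at i is
the same product for both normal forms. *)
Lemma norm_mutation i t : seed t -> mutation (norm t) i (norm (mu i t)).
Proof.
move=> At; have At' := lp_seeds_mu i At.
have [nc ne] := normP At; have [nc' ne'] := normP At'.
have ss := norm_is_seed At (normP At); have ss' := norm_is_seed At' (normP At').
have [p1 [m1 e1]] := ne i; have [p2 [m2 e2]] := ne' i.
rewrite lp_mu_invol // lp_clus_other // in e2.
have f2 : clus (norm (mu i t)) (other i) = clus (norm t) (other i).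
  by rewrite nc nc' lp_clus_other.
have f3 : exchK (norm (mu i t)) i = exchK (norm t) i.
  rewrite [rep (clus t i) * _]mulrC -(nc (other i)) in e2; rewrite -(nc (other i)) in e1.
  apply: (exchK_rigid ss _ e2 e1); first by rewrite mulf_neq0 ?rep_neq0.
  by apply: propto_trans p2 _; rewrite (lp_exchK i At); exact: propto_sym p1.
have f1 : clus (norm (mu i t)) i * clus (norm t) i * clus (norm t) (other i) ^+ m1 =
    exchK (norm t) i.
  by rewrite e1 nc' !nc.
exact: (mutation_transport (lp_is_seed At) ss (lp_is_seed At') ss'
  (norm_equiv (normP At)) (norm_equiv (normP At')) (lp_mutation i At) f2 f3 f1).
Qed.

Lemma norm_foldl (x : seq 'I_2) t : seed t ->
  seed (foldl (fun u i => mu i u) t x) /\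
  foldl (fun u i => norm_mu i u) (norm t) x = norm (foldl (fun u i => mu i u) t x).
Proof.
elim: x t => [|i x IH] t At //=; rewrite norm_mu_norm //.
exact: IH (lp_seeds_mu i At).
Qed.

Definition normalization : lp_algebra S 2.
Proof.
refine (@LPAlgebra S 2
  (fun f => exists k (y : 'I_k -> K) (p : {mpoly S[k]}),
     (forall l, exists t i, norm_seeds t /\ y l = clus t i) /\
     f = mmap (@S_to_K S 2) y p)
  norm_seeds norm_mu _ _ _ _ _ _ _ _).
- move=> w _ [t At <-]; exists (relabel w t); first exact: lp_seeds_relabel.
  exact: norm_relabel.
- move=> w i _ [t At <-]; rewrite -norm_relabel // !norm_mu_norm ?lp_mu_relabel //.
    by apply: norm_relabel; apply: lp_seeds_mu.
  exact: lp_seeds_relabel.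
- by move=> _ [t At <-]; apply: norm_is_seed (normP At).
- move=> i _ [t At <-]; rewrite norm_mu_norm //.
  by exists (mu i t) => //; apply: lp_seeds_mu.
- by move=> i _ [t At <-]; rewrite norm_mu_norm //; apply: norm_mutation.
- move=> i _ [t At <-]; rewrite !norm_mu_norm ?lp_mu_invol //.
  exact: lp_seeds_mu.
- move=> _ _ [t At <-] [t' At' <-].
  have [x [w e]] := lp_connected At At'; exists x, w.
  have [Ax ->] := norm_foldl x At.
  by rewrite -(norm_relabel w Ax) e.
- by move=> f.
Defined.

Lemma normalization_normalized : normalized normalization.
Proof.
move=> _ _ [t At <-] [t' At' <-] [w e]; exists w.
have Aw := lp_seeds_relabel w At.
rewrite -(norm_relabel w At); apply: (norm_eq Aw At').
apply: equiv_labelled_trans (norm_equiv (normP At')).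
apply: equiv_labelled_trans e; rewrite -(norm_relabel w At).
exact/equiv_labelled_sym/norm_equiv/normP.
Qed.

Lemma normalizationP : normalization_of A normalization.
Proof.
split; first exact: normalization_normalized.
exists norm; split=> [t At|w t At|_ [t At <-]|t At|i t At].
- by exists t.
- exact: norm_relabel.
- by exists t.
- exact: norm_equiv (normP At).
- by rewrite /= norm_mu_norm.
Qed.

Lemma finite_type_of_classes (r : seq (lseed S 2)) :
  (forall t, seed t -> exists t0, [/\ t0 \in r, seed t0 & equiv_labelled t t0]) ->
  finite_type A.
Proof.
move=> hr; exists normalization; split; first exact: normalizationP.
exists (map norm r) => _ [t At <-]; have [t0 [rt0 At0 e]] := hr t At.
by apply/mapP; exists t0 => //; apply: norm_eq.
Qed.

End Normalization.

(** * The sequence of seeds *)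

Definition par (k : nat) : 'I_2 := if odd k then ord_max else ord0.

Lemma other_par k : other (par k) = par k.+1.
Proof. by apply: val_inj; rewrite /par /=; case: (odd k). Qed.

Lemma par2 k : par k.+2 = par k.
Proof. by rewrite /par /= negbK. Qed.

Lemma par_even n k : ~~ odd n -> par (n + k) = par k.
Proof. by rewrite /par oddD => /negbTE->. Qed.

Section SeedSequence.
Variables (S : idomainType) (A : lp_algebra S 2).
Hypothesis ufd : is_ufd S.
Local Notation K := (ambient S 2).
Local Notation h := (@S_to_K S 2).
Local Notation mu := (lp_mu A).
Local Notation seed := (lp_seeds A).
Implicit Types (t s : lseed S 2) (i j : 'I_2) (w : 'S_2).

(** The product of a variable and its successor is the exchange polynomial up to
a monomial, and no variable divides the exchange polynomial. *)
Lemma equiv_of_neighbours t s : seed t -> seed s ->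
  (forall i, propto (clus t i) (clus s i)) ->
  (forall i, propto (clus (mu i t) i) (clus (mu i s) i)) ->
  equiv_labelled t s.
Proof.
move=> At As ec emu i; split=> //.
have st := lp_is_seed At; have ss := lp_is_seed As.
have [m em] := lp_exchange i At; have [n en] := lp_exchange i As.
set y := clus s (other i); have [u uu eu] := ec (other i).
have yI : injective (pev h y) := pev_inj (alg_freeC (@seed_free S s i ss)).
(* the exchange polynomial of t in the variable y of s *)
pose P1 := \poly_(k < size (upoly t i)) ((upoly t i)`_k * u ^+ k).
have eP1 : pev h y P1 = exchK t i.
  rewrite seed_exchK // eu !(@pev_wide _ _ _ (size (upoly t i))) ?size_poly //.
  apply: eq_bigr => k _; rewrite coef_poly ltn_ord exprMn rmorphM rmorphXn /=.
  by rewrite mulrA.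
have [c cu ec'] : propto (exchK t i * y ^+ n) (exchK s i * y ^+ m).
  rewrite -em -en -[_ * _ * y ^+ m]mulrA [y ^+ n * _]mulrC -[X in propto X _]mulrA.
  apply: proptoM; first exact: proptoM.
  by apply: proptoM; [exact: proptoX | exact: propto_refl].
have e2 : P1 * 'X^n = (c *: upoly s i) * 'X^m.
  apply: yI; rewrite !rmorphM /= !rmorphXn /= pevX pevZ eP1 -seed_exchK // ec'.
  by rewrite mulrA.
have /poly_shift_eq : P1`_0 != 0.
  by rewrite coef_poly expr0 mulr1 seed_size_gt0 // seed_coef0.
move=> /(_ (c *: upoly s i) n m); rewrite coefZ mulf_neq0 ?(unit_neq0 cu) ?seed_coef0 //.
move=> /(_ isT e2) e3; exists c => //.
by rewrite -eP1 e3 pevZ -seed_exchK.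
Qed.

Variable t1 : lseed S 2.
Hypothesis At1 : seed t1.

Fixpoint sseq (k : nat) : lseed S 2 :=
  if k is k'.+1 then mu (par k') (sseq k') else t1.

Definition xseq (k : nat) : K := clus (sseq k) (par k).

Lemma sseq_seed k : seed (sseq k).
Proof. by elim: k => //= k IH; apply: lp_seeds_mu. Qed.

Lemma sseq_is_seed k : is_seed (sseq k).
Proof. exact: lp_is_seed (sseq_seed k). Qed.

Lemma mu_sseq k : mu (par k) (sseq k) = sseq k.+1.
Proof. by []. Qed.

Lemma mu_sseqS k : mu (par k) (sseq k.+1) = sseq k.
Proof. by rewrite /= lp_mu_invol //; apply: sseq_seed. Qed.

Lemma xseqS k : clus (sseq k) (par k.+1) = xseq k.+1.
Proof. by rewrite /xseq -other_par /= lp_clus_other //; apply: sseq_seed. Qed.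

Lemma xseqSS k : clus (sseq k.+1) (par k) = xseq k.+2.
Proof. by rewrite -par2 xseqS. Qed.

Lemma propto_par (f g : 'I_2 -> K) k :
  propto (f (par k)) (g (par k)) -> propto (f (par k.+1)) (g (par k.+1)) ->
  forall i, propto (f i) (g i).
Proof. by rewrite -other_par => p1 p2 i; case: (ord2P (par k) i) => ->. Qed.

(** The seed at position 1 has the variables x_1 and x_2 and the neighbouring
variables x_0 and x_3. *)
Lemma sseq_period n : ~~ odd n -> (forall k, (k < 4)%N -> propto (xseq (n + k)) (xseq k)) ->
  equiv_labelled (sseq n.+1) (sseq 1).
Proof.
move=> on px; apply: equiv_of_neighbours; try exact: sseq_seed.
  have e1 : par n.+1 = par 1 by rewrite -(addn1 n) par_even.
  apply: (@propto_par _ _ 1); first by rewrite -e1; have := px 1%N isT; rewrite addn1 /xseq e1.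
  have e2 : par n.+2 = par 2 by rewrite -(addn2 n) par_even.
  by rewrite xseqS -e2 xseqS; have := px 2 isT; rewrite addn2.
have e0 : par n = par 0 by rewrite -(addn0 n) par_even.
apply: (@propto_par _ _ 0).
  by rewrite mu_sseqS -{1 2}e0 mu_sseqS; have := px 0%N isT; rewrite addn0 /xseq e0.
have e1 : par n.+1 = par 1 by rewrite -(addn1 n) par_even.
rewrite mu_sseq -{1 2}e1 mu_sseq !xseqSS.
by have := px 3 isT; rewrite addn3.
Qed.

(** By periodicity every mutation of one of the seeds at positions 1 to n is
equivalent to such a seed. *)
Lemma finite_type_of_period n : (0 < n)%N -> ~~ odd n ->
  (forall k, (k < 4)%N -> propto (xseq (n + k)) (xseq k)) -> finite_type A.
Proof.
move=> n0 on px; have per := sseq_period on px.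
have main (x : seq 'I_2) t : seed t ->
    (exists k, (0 < k <= n)%N /\ equiv_labelled t (sseq k)) ->
    exists k, (0 < k <= n)%N /\ equiv_labelled (foldl (fun u i => mu i u) t x) (sseq k).
  elim: x t => [|i x IH] t At; first by [].
  rewrite /= => -[k [kn e]]; apply: (IH _ (lp_seeds_mu i At)).
  have emu := lp_mu_equiv ufd i At (sseq_seed k) e.
  have [ei|ei] := ord2P (par k) i.
    rewrite ei mu_sseq in emu; rewrite ei; have [lt|ge] := ltnP k n.
      by exists k.+1.
    have ek : k = n by apply/eqP; rewrite eqn_leq ge andbT; case/andP: kn.
    exists 1%N; split; first by rewrite n0.
    by apply: equiv_labelled_trans emu _; rewrite ek.
  rewrite other_par in ei; case: k kn e emu ei => [|k] // kn e emu; rewrite par2 => ei.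
  case: k kn e emu ei => [|k] kn e emu ei.
    exists n; split; first by rewrite n0 leqnn.
    apply: equiv_labelled_trans emu _.
    apply: equiv_labelled_trans
      (lp_mu_equiv ufd i (sseq_seed 1) (sseq_seed n.+1) (equiv_labelled_sym per)) _.
    have -> : i = par n by rewrite ei -(addn0 n) par_even.
    by rewrite mu_sseqS; apply: equiv_labelled_refl.
  exists k.+1; split; first by rewrite /= ltnW //; case/andP: kn.
  by rewrite {2}ei mu_sseqS in emu.
apply: (@finite_type_of_classes S A ufd
  [seq relabel w (sseq k) | w <- enum [set: 'S_2], k <- iota 1 n]) => t At.
have [x [w e]] := lp_connected (sseq_seed 1) At.
have [|k [kn ek]] := main x _ (sseq_seed 1).
  by exists 1%N; split; [rewrite n0 | exact: equiv_labelled_refl].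
exists (relabel w (sseq k)); split.
- by apply/allpairsP; exists (w, k); rewrite mem_enum inE mem_iota add1n ltnS.
- exact: lp_seeds_relabel (sseq_seed k).
by rewrite -e; apply: equiv_relabel.
Qed.

End SeedSequence.

(** * Nonconstant exchange polynomials *)

Lemma fraction_ratio (R : idomainType) (f : {fraction R}) :
  exists n d : R, d != 0 /\ tofrac d * f = tofrac n.
Proof.
elim/quotW: f => r; exists (frac r).1, (frac r).2; split; first exact: denom_ratioP.
unlock FracField.tofrac.
rewrite -[_ * _]/(FracField.mul _ _) -FracField.pi_mul.
apply/eqmodP; rewrite /= /FracField.equivf /FracField.mulf.
by rewrite !numden_Ratio ?oner_eq0 ?mul1r ?mulr1 ?denom_ratioP // mulrC.
Qed.

Section ExchangeSequence.
Variables (S : idomainType) (A : lp_algebra S 2).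
Hypothesis ufd : is_ufd S.
Local Notation K := (ambient S 2).
Local Notation h := (@S_to_K S 2).
Variable t1 : lseed S 2.
Hypothesis At1 : lp_seeds A t1.
Local Notation s := (sseq A t1).
Local Notation x := (xseq A t1).

(** The exchange polynomial in the variable x_k. *)
Definition pseq k : {poly S} := upoly (s k) (par k.+1).

Lemma pseqS k : upoly (s k) (par k) = pseq k.+1.
Proof.
rewrite /pseq par2; have := lp_mutation (par k) (sseq_seed At1 k).
move/(mutationP (par k) (sseq_is_seed At1 k) (sseq_is_seed At1 k.+1)).
by move=> [m [_ _ _ e _]]; rewrite -e.
Qed.

Lemma pseq_exchange k : exists m,
  [/\ laurent_exp (pseq k.+1) (pseq k) m,
      x k * x k.+2 * x k.+1 ^+ m = pev h (x k.+1) (pseq k.+1) &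
      if (size (pseq k) <= 1)%N then
        exists2 u, u \is a GRing.unit & pseq k.+2 = u *: pseq k
      else factor_free (pseq k.+1) (pseq k) (pseq k.+2)].
Proof.
have := lp_mutation (par k) (sseq_seed At1 k).
move/(mutationP (par k) (sseq_is_seed At1 k) (sseq_is_seed At1 k.+1)).
move=> [m [le e1 e2 e3 e4]]; exists m; move: le e1 e4; rewrite other_par pseqS -/(pseq k).
rewrite (xseqS At1) (xseqSS At1) [x k.+2 * _]mulrC.
have -> : upoly (s k.+1) (par k.+1) = pseq k.+2 by rewrite pseqS.
by [].
Qed.

Lemma pseq_rel k : (1 < size (pseq k))%N ->
  x k * x k.+2 = pev h (x k.+1) (pseq k.+1) /\
  factor_free (pseq k.+1) (pseq k) (pseq k.+2).
Proof.
move=> sk; have [m []] := pseq_exchange k.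
by rewrite /laurent_exp leqNgt sk /= => ->; rewrite expr0 mulr1.
Qed.

Lemma size_factor_free (P Q R : {poly S}) : Q`_0 != 0 -> factor_free P Q R ->
  size R = size Q.
Proof.
move=> Q0 [r [u [hr uu e]]]; have := congr1 (fun p : {poly S} => size p) e.
rewrite !size_scale ?(unit_neq0 uu) ?size_revp //.
by apply: prod_irreducible_neq0 => d /hr[].
Qed.

Lemma pseq_coef0 k : (pseq k)`_0 != 0.
Proof. exact/seed_coef0/sseq_is_seed. Qed.

Lemma xseq_free k : alg_free h (x k) (x k.+1).
Proof.
have := @seed_free S (s k) (par k) (sseq_is_seed At1 k).
by rewrite other_par (xseqS At1).
Qed.

Lemma xseq_neq0 k : x k != 0.
Proof. exact: seed_neq0 (sseq_is_seed At1 k). Qed.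

Lemma size_pseq k : size (pseq k) = size (pseq (odd k)).
Proof.
suff [] : size (pseq k) = size (pseq (odd k)) /\
          size (pseq k.+1) = size (pseq (odd k.+1)) by [].
elim: k => [|k [IH1 IH2]]; split=> //; rewrite /= negbK -IH1.
have [m [_ _]] := pseq_exchange k; case: leqP => _.
  by move=> [u uu ->]; rewrite size_scale ?unit_neq0.
by apply: size_factor_free; apply: pseq_coef0.
Qed.

Hypothesis p0 : (1 < size (pseq 0))%N.
Hypothesis p1 : (1 < size (pseq 1))%N.

Lemma pseq_gt1 k : (1 < size (pseq k))%N.
Proof. by rewrite size_pseq; case: (odd k). Qed.

Lemma pseq_primitive k : primitive (pseq k).
Proof. apply: seed_primitive; [exact: sseq_is_seed | exact: pseq_gt1]. Qed.

Local Notation hF := (@frac_to_K S 2).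

Lemma pev_map_tofrac z (p : {poly S}) : pev hF z (map_poly (@tofrac S) p) = pev h z p.
Proof.
rewrite !pevE -map_poly_comp_id0 ?tofrac0 //.
Qed.

Lemma exchange_seq_frac :
  exchange_seq hF x (fun k => map_poly (@tofrac S) (pseq k)).
Proof.
have tI : injective (@tofrac S) by move=> a b /eqP; rewrite tofrac_eq => /eqP.
split=> k.
- split; first exact: xseq_neq0.
  rewrite pev_map_tofrac -(rmorph0 (pev h (x k))) (inj_eq (pev_inj (@xseq_free k))).
  by rewrite -size_poly_gt0 (ltn_trans _ (pseq_gt1 k)).
- by rewrite pev_map_tofrac; have [] := pseq_rel (pseq_gt1 k).
- by rewrite coef_map_id0 ?tofrac0 // tofrac_eq0 pseq_coef0.
have [_ [r [u [hr uu e]]]] := pseq_rel (pseq_gt1 k).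
have d0 : \prod_(d <- r) d != 0 by apply: prod_irreducible_neq0 => d /hr[].
set d := \prod_(d <- r) d in e d0.
have td : tofrac d != 0 by rewrite tofrac_eq0.
exists (tofrac u / tofrac d).
  by rewrite mulf_neq0 ?invr_eq0 // tofrac_eq0 (unit_neq0 uu).
have e2 := congr1 (map_poly (@tofrac S)) e.
rewrite !map_polyZ /= (map_revp _ _ tI) in e2.
rewrite coef_map_id0 ?tofrac0 //.
by apply: (scalerI td); rewrite e2 scalerA mulrCA divff // mulr1.
Qed.

(** Start from the cluster containing the variable and change the cluster step by
step down to the one at n. *)
Lemma gauss_unit_xseq k n : gauss_unit h (x n) (x n.+1) (x (n + k)).
Proof.
elim: k n => [|k IH] n; first by rewrite addn0; apply: gauss_unit_var.
rewrite addnS -addSn; apply: gauss_unitC.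
have [e _] := pseq_rel (pseq_gt1 n).
have e' : x n.+2 * x n = pev h (x n.+1) (pseq n.+1) by rewrite mulrC e.
exact: (gauss_unit_exchange ufd (@pseq_primitive n.+1) (xseq_neq0 n) e' (IH n.+1)).
Qed.

Lemma propto_of_proportional m n : proportional hF (x m) (x n) -> propto (x m) (x n).
Proof.
move=> [l l0 e]; have [a [d [d0 ed]]] := fraction_ratio l.
have a0 : a != 0 by rewrite -tofrac_eq0 -ed mulf_neq0 // tofrac_eq0.
have e2 : h d * x m = h a * x n.
  rewrite e mulrA; congr (_ * _).
  by rewrite -[h d]/(hF (tofrac d)) -rmorphM ed.
have [c cu ec] := associated_of_gauss_unit ufd (@xseq_free 0)
  (gauss_unit_xseq m 0) (gauss_unit_xseq n 0) d0 a0 e2.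
apply: propto_sym; exists c => //.
have ha : h a != 0 by apply: S_to_K_neq0.
by apply: (mulfI ha); rewrite -e2 ec rmorphM mulrCA mulrA.
Qed.

End ExchangeSequence.

Section NonconstantExchange.
Variables (S : idomainType) (A : lp_algebra S 2).
Hypothesis ufd : is_ufd S.
Local Notation K := (ambient S 2).
Local Notation h := (@S_to_K S 2).
Local Notation hF := (@frac_to_K S 2).
Variable t1 : lseed S 2.
Hypothesis At1 : lp_seeds A t1.
Local Notation s := (sseq A t1).
Local Notation x := (xseq A t1).
Local Notation p := (pseq A t1).

Section Sizes.
Variables b c : nat.
Hypotheses (sp0 : size (p 0) = b.+2) (sp1 : size (p 1) = c.+2).

Lemma size_pseq_odd k : size (p k) = (if odd k then c.+1 else b.+1).+1.
Proof.
by rewrite (size_pseq At1); case: (odd k); rewrite ?sp0 ?sp1.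
Qed.

Lemma exchange_seq_at n : exchange_seq hF (fun k => x (n + k)%N)
  (fun k => map_poly (@tofrac S) (p (n + k)%N)).
Proof.
have g0 : (1 < size (p 0))%N by rewrite sp0.
have g1 : (1 < size (p 1))%N by rewrite sp1.
exact: (exchange_seq_shift n (exchange_seq_frac At1 g0 g1)).
Qed.

Lemma size_map_tofrac (q : {poly S}) : size (map_poly (@tofrac S) q) = size q.
Proof.
rewrite size_map_inj_poly ?tofrac0 //.
by move=> a d /eqP; rewrite tofrac_eq => /eqP.
Qed.

Lemma propto_xseq m n : proportional hF (x m) (x n) -> propto (x m) (x n).
Proof.
have g0 : (1 < size (p 0))%N by rewrite sp0.
have g1 : (1 < size (p 1))%N by rewrite sp1.
exact: (propto_of_proportional ufd At1 g0 g1).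
Qed.

(** A normalization with finitely many seeds would identify two seeds at odd
positions, whose variables x_k would then be equal up to a unit. *)
Lemma infinite_nonconstant : (b <= c)%N -> (4 <= b.+1 * c.+1)%N -> ~ finite_type A.
Proof.
move=> bc bc4 [A' [[_ [q [q_seed _ _ q_equiv _]]] [r hr]]].
have g0 : (1 < size (p 0))%N by rewrite sp0.
have g1 : (1 < size (p 1))%N by rewrite sp1.
have exx k : x k * x k.+2 = pev h (x k.+1) (p k.+1).
  by have [] := pseq_rel At1 (pseq_gt1 At1 g0 g1 k).
have bc' : (1 <= b.+1 <= c.+1)%N by [].
have np := @exchange_not_proportional S K h (x 0%N) (x 1%N) (@xseq_free S A t1 At1 0%N)
  x p b.+1 c.+1 erefl erefl exx size_pseq_odd bc' bc4.
(* one seed more than there are in r *)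
pose l := [seq q (s i.*2.+1) | i <- iota 0 (size r).+1].
have : ~~ uniq l.
  apply/negP => /uniq_leq_size h1; have /h1 : {subset l <= r}.
    by move=> _ /mapP[i _ ->]; apply/hr/q_seed/sseq_seed.
  by rewrite size_map size_iota ltnn.
move=> /(uniqPn t1)[i [j [ij]]]; rewrite size_map size_iota => jr.
have ir := ltn_trans ij jr.
rewrite !(nth_map 0%N) ?size_iota // !nth_iota // !add0n => eq.
have pj (k : nat) : propto (clus (q (s k.*2.+1)) (par 1)) (x k.*2.+1).
  have [e _] := q_equiv _ (sseq_seed At1 k.*2.+1) (par 1).
  have ep : par k.*2.+1 = par 1 by rewrite /par /= odd_double.
  by rewrite /xseq ep.
have := pj i; rewrite eq => pi.
have [u uu eu] := propto_trans (propto_sym pi) (pj j).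
apply: (np i j 1 u ij (oner_neq0 S) (unit_neq0 uu)).
by rewrite -eu rmorph1 mul1r.
Qed.

End Sizes.

Lemma finite_cubic : size (p 0) = 2 -> size (p 1) = 4 -> finite_type A.
Proof.
move=> s0 s1; apply: (finite_type_of_period ufd At1 (n := 8)) => // k k4.
apply: (propto_xseq s0 s1).
have per m : ~~ odd m -> proportional hF (x (m + 8)) (x (m + 0)) /\
    proportional hF (x (m + 9)) (x (m + 1)).
  move=> om; apply: (period_cubic (exchange_seq_at s0 s1 m)).
    by rewrite size_map_tofrac (size_pseq_odd s0 s1) addn0 (negbTE om).
  by rewrite size_map_tofrac (size_pseq_odd s0 s1) addn1 /= om.
have [e0 e1] := per 0%N isT; have [e2 e3] := per 2 isT.
by case: k k4 => [|[|[|[|k]]]].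
Qed.

Lemma finite_quadratic : size (p 0) = 2 -> size (p 1) = 3 -> finite_type A.
Proof.
move=> s0 s1; apply: (finite_type_of_period ufd At1 (n := 6)) => // k k4.
apply: (propto_xseq s0 s1).
have per m : ~~ odd m -> proportional hF (x (m + 6)) (x (m + 0)) /\
    proportional hF (x (m + 7)) (x (m + 1)).
  move=> om; apply: (period_quadratic (exchange_seq_at s0 s1 m)).
    by rewrite size_map_tofrac (size_pseq_odd s0 s1) addn0 (negbTE om).
  by rewrite size_map_tofrac (size_pseq_odd s0 s1) addn1 /= om.
have [e0 e1] := per 0%N isT; have [e2 e3] := per 2 isT.
by case: k k4 => [|[|[|[|k]]]].
Qed.

(** The period five is odd: after five mutations the two positions of the seed
are exchanged, and labelled seeds repeat after ten. *)
Lemma finite_linear : size (p 0) = 2 -> size (p 1) = 2 -> finite_type A.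
Proof.
move=> s0 s1; apply: (finite_type_of_period ufd At1 (n := 10)) => // k k4.
apply: (propto_xseq s0 s1).
have per m : proportional hF (x (m + 5)) (x m).
  rewrite -[X in proportional _ _ (x X)]addn0.
  apply: (period_linear (exchange_seq_at s0 s1 m)).
    by rewrite size_map_tofrac (size_pseq_odd s0 s1); case: odd.
  by rewrite size_map_tofrac (size_pseq_odd s0 s1); case: odd.
have e : (10 + k = k + 5 + 5)%N by lia.
by rewrite e; apply: proportional_trans (per _) (per _).
Qed.

End NonconstantExchange.

(** * A constant exchange polynomial *)

Lemma poly_scaleI (R : idomainType) (c : R) (p q : {poly R}) : c != 0 ->
  c *: p = c *: q -> p = q.
Proof.
move=> c0; rewrite -!mul_polyC; apply: mulfI.
by rewrite polyC_eq0.
Qed.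

Section ConstantPolynomial.
Variable S : idomainType.
Implicit Types (P R : {poly S}) (q u : S).

Lemma associated_of_dvd_irreducible (d q : S) :
  irreducible_elt d -> irreducible_elt q -> rdivides d q -> associated d q.
Proof.
move=> [d0 du _] [_ _ qi] [g e]; case: (qi _ _ e) => [gu|]; last by rewrite (negbTE du).
  by exists g^-1; rewrite ?unitrV // e mulKr.
Qed.

(** An irreducible divisor of the irreducible q is associated to q. *)
Lemma prod_of_divisors (r : seq S) q : irreducible_elt q ->
  {in r, forall d, irreducible_elt d /\ rdivides d q} ->
  exists2 u, u \is a GRing.unit & \prod_(d <- r) d = u * q ^+ size r.
Proof.
move=> qi; elim: r => [|d r IH] hr.
  by exists 1; rewrite ?unitr1 // big_nil mulr1.
have [|u uu eu] := IH; first by move=> c cr; apply: hr; rewrite inE cr orbT.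
have [di dq] := hr d (mem_head _ _).
have [v vu ev] := associated_of_dvd_irreducible di qi dq.
exists (v * u); first by rewrite unitrM vu.
by rewrite big_cons eu ev exprS; ring.
Qed.

Lemma laurent_exp_const P q m : laurent_exp P q%:P m <->
  rdivides (q ^+ m)%:P (revp P q) /\ ~ rdivides (q ^+ m.+1)%:P (revp P q).
Proof.
by rewrite /laurent_exp coefC /= size_polyC; case: eqP.
Qed.

(** The power of q in revp P q is visible once the cofactor is primitive. *)
Lemma laurent_exp_of_primitive P R q u m : irreducible_elt q -> primitive R ->
  u \is a GRing.unit -> revp P q = (u * q ^+ m) *: R -> laurent_exp P q%:P m.
Proof.
move=> qi pR uu e; apply/laurent_exp_const; rewrite e; split.
  by exists (u *: R); rewrite [RHS]mulrC mul_polyC scalerA [_ * u]mulrC.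
move=> [g eg]; apply: (pR q qi); have [q0 _ _] := qi.
exists (u^-1 *: g); have qm : q ^+ m != 0 by rewrite expf_neq0.
apply: (poly_scaleI qm); apply: (poly_scaleI (unit_neq0 uu)).
rewrite scalerA eg exprSr polyCM -!mul_polyC.
transitivity ((u%:P * (u^-1)%:P) * (g * ((q ^+ m)%:P * q%:P))); last by ring.
have uV : u%:P * (u^-1)%:P = 1 :> {poly S} by rewrite -polyCM divrr.
by rewrite uV mul1r !mulrA.
Qed.

(** Replacing q by w q multiplies z^d P(q/z) by w^d after rescaling z by w. *)
Lemma laurent_exp_unit P q w m : w \is a GRing.unit ->
  laurent_exp P q%:P m -> laurent_exp P (w * q)%:P m.
Proof.
move=> wu; apply: laurent_exp_rescaled.
- rewrite !coefC /=; exists w, (w ^+ (size P).-1); split; rewrite ?unitrX // => k.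
  rewrite !coef_poly; case: ltnP => sk; last by rewrite mulr0 mul0r.
  have kP : (k <= (size P).-1)%N by rewrite -ltnS (ltn_predK sk).
  have -> : w ^+ (size P).-1 = w ^+ ((size P).-1 - k) * w ^+ k.
    by rewrite -exprD subnK.
  by rewrite exprMn; ring.
- by rewrite !size_polyC mulf_eq0 negb_or (unit_neq0 wu).
- by exists w; rewrite // !coefC.
Qed.

(** Exchanging x2 with x2' = q / x2 turns P into R = z^d P(q/z) / q^m, for
which the exponents m and n of the exchange Laurent polynomials add up to d:
both exchange Laurent polynomials are then the same element. *)
Lemma dual_laurent_exp P R q (r : seq S) u m n :
  irreducible_elt q -> primitive P -> primitive R -> P`_0 != 0 ->
  {in r, forall d, irreducible_elt d /\ rdivides d q} -> u \is a GRing.unit ->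
  (\prod_(d <- r) d) *: R = u *: revp P q ->
  laurent_exp P q%:P m -> laurent_exp R q%:P n ->
  (exists2 c, c \is a GRing.unit & revp P q = (c * q ^+ m) *: R) /\
  (n + m = (size P).-1)%N.
Proof.
move=> qi pP pR P0 hr uu e lm ln; have [q0 _ _] := qi.
have [v vu ev] := prod_of_divisors qi hr.
have eV : revp P q = (u^-1 * v * q ^+ size r) *: R.
  apply: (poly_scaleI (unit_neq0 uu)); rewrite -e ev scalerA !mulrA.
  by rewrite divrr // mul1r.
have cu : u^-1 * v \is a GRing.unit by rewrite unitrM unitrV uu.
have lr := laurent_exp_of_primitive qi pR cu eV.
rewrite (laurent_exp_uniq lr lm) in eV.
set c := u^-1 * v in eV cu; set d := (size P).-1.
split; first by exists c.
have sP : (0 < size P)%N.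
  by rewrite size_poly_gt0; apply: contraNneq P0 => ->; rewrite coef0.
have sR : size R = size P.
  rewrite -(size_revp q P0) eV size_scale // mulf_neq0 ?expf_neq0 //.
  exact: unit_neq0.
(* reversal is an involution up to the factor q^d *)
have eR : (c * q ^+ m) *: revp R q = q ^+ d *: P.
  apply/polyP => k; rewrite !coefZ coef_poly sR; case: ltnP => sk; last first.
    by rewrite mulr0 nth_default // mulr0.
  have kd : (k <= d)%N by rewrite -ltnS /d prednK.
  have := congr1 (fun p : {poly S} => p`_(d - k)) eV.
  rewrite /= coefZ coef_poly (leq_ltn_trans (leq_subr _ _)) /d ?prednK //.
  rewrite subKn // => ek.
  rewrite mulrA -ek -/d; have -> : q ^+ d = q ^+ k * q ^+ (d - k) by rewrite -exprD subnKC.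
  by ring.
(* otherwise q would divide the primitive polynomial P *)
have md : (m <= d)%N.
  rewrite leqNgt; apply/negP => dm; apply: (pP q qi).
  exists (c *: ((q ^+ (m - d.+1)) *: revp R q)).
  have qd : q ^+ d != 0 by rewrite expf_neq0.
  apply: (poly_scaleI qd); rewrite -eR.
  have -> : q ^+ m = q ^+ d * (q * q ^+ (m - d.+1)).
    by rewrite -exprS -exprD; congr (q ^+ _); lia.
  by rewrite -!mul_polyC !polyCM; ring.
have eR2 : revp R q = (c^-1 * q ^+ (d - m)) *: P.
  have nz : c * q ^+ m != 0 by rewrite mulf_neq0 ?expf_neq0 ?(unit_neq0 cu).
  apply: (poly_scaleI nz); rewrite eR scalerA; congr (_ *: P).
  have -> : q ^+ d = q ^+ m * q ^+ (d - m) by rewrite -exprD subnKC.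
  transitivity ((c * c^-1) * (q ^+ m * q ^+ (d - m))); last by ring.
  by rewrite divrr // mul1r.
have cVu : c^-1 \is a GRing.unit by rewrite unitrV.
have ln' := laurent_exp_of_primitive qi pP cVu eR2.
by rewrite (laurent_exp_uniq ln ln') subnK.
Qed.

Lemma revp_polyC c a : revp (c%:P : {poly S}) a = c%:P.
Proof.
have [->|c0] := eqVneq c 0; first by rewrite polyC0 /revp size_poly0 poly_def big_ord0.
apply/polyP => -[|k]; rewrite coef_poly size_polyC c0 !coefC //=.
by rewrite subnn mulr1.
Qed.

Lemma laurent_exp_const_const (c q : S) m :
  irreducible_elt c -> irreducible_elt q -> laurent_exp c%:P q%:P m ->
  (associated c q -> m = 1%N) /\ (~ associated c q -> m = 0%N).
Proof.
move=> ci qi /laurent_exp_const; rewrite revp_polyC.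
have [c0 cu _] := ci; have [q0 qu _] := qi.
move=> [/rdivides_polyC d1 d2]; split=> [[u uu eu]|nass].
  case: m d1 d2 => [|[|m]] // d1 d2.
    by case: d2; exists u%:P; rewrite eu polyCM expr1.
  exfalso; case: d1 => g eg; case/negP: qu; apply/unitrP; exists (u^-1 * g * q ^+ m).
  have e1 : u^-1 * g * q ^+ m * q = 1.
    apply: (mulfI (mulf_neq0 (unit_neq0 uu) q0)).
    rewrite mulr1 -eu {1}eu eg !exprS.
    transitivity ((u * u^-1) * (g * (q * (q * q ^+ m)))); last by rewrite divrr // mul1r.
    by ring.
  by split; rewrite // mulrC.
case: m d1 {d2} => // m [g eg]; case: nass.
have /(associated_of_dvd_irreducible qi ci) [u uu eu] : rdivides q c.
  by exists (g * q ^+ m); rewrite eg exprSr mulrA.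
by exists u^-1; rewrite ?unitrV // eu mulKr.
Qed.

End ConstantPolynomial.

Lemma associated_refl (R : idomainType) (a : R) : associated a a.
Proof. by exists 1; rewrite ?unitr1 ?mul1r. Qed.

Lemma associated_sym (R : idomainType) (a b : R) : associated a b -> associated b a.
Proof. by move=> [u uu ->]; exists u^-1; rewrite ?unitrV // mulKr. Qed.

Lemma associated_trans (R : idomainType) (a b c : R) :
  associated a b -> associated b c -> associated a c.
Proof. by move=> [u uu ->] [v vu ->]; exists (u * v); rewrite ?unitrM ?uu ?mulrA. Qed.

(** Both exchange Laurent polynomials are z^-n R(z), evaluated through yz = q. *)
Lemma dual_exchange (S : idomainType) (K : fieldType) (h : {rmorphism S -> K})
    (y z e e' : K) (P R : {poly S}) (q c : S) m n :
  injective h -> q != 0 -> z != 0 -> y * z = h q ->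
  e * y ^+ m = pev h y P -> e' * z ^+ n = pev h z R ->
  revp P q = (c * q ^+ m) *: R -> (n + m = (size P).-1)%N -> e = h c * e'.
Proof.
move=> hI q0 z0 yz ey ez er nm.
have hq : h q != 0 by rewrite -(rmorph0 h) (inj_eq hI).
have := congr1 (pev h z) er; rewrite pev_revp // pevZ -ez -nm -yz mulfK // -ey.
rewrite rmorphM rmorphXn -yz exprD => e1.
have nz : (y * z) ^+ m * z ^+ n != 0 by rewrite yz mulf_neq0 ?expf_neq0.
apply: (mulfI nz); transitivity (e * y ^+ m * (z ^+ n * z ^+ m)).
  by rewrite exprMn; ring.
by rewrite e1; ring.
Qed.

Section ConstantExchange.
Variables (S : idomainType) (A : lp_algebra S 2).
Hypothesis ufd : is_ufd S.
Local Notation K := (ambient S 2).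
Local Notation h := (@S_to_K S 2).
Variable t1 : lseed S 2.
Hypothesis At1 : lp_seeds A t1.
Local Notation s := (sseq A t1).
Local Notation x := (xseq A t1).
Local Notation p := (pseq A t1).
Local Notation E k := (x k * x k.+2).

Lemma pseq_const k : (size (p k) <= 1)%N ->
  p k = ((p k)`_0)%:P /\ irreducible_elt (p k)`_0.
Proof. by apply: seed_const; apply: sseq_is_seed. Qed.

Lemma pseq_const_associated k : (size (p k) <= 1)%N ->
  associated (p k.+2)`_0 (p k)`_0.
Proof.
move=> sk; have [m [_ _]] := pseq_exchange At1 k; rewrite sk => -[u uu ->].
by exists u; rewrite // coefZ.
Qed.

Lemma pseq_const_mod2 k : (size (p k) <= 1)%N ->
  associated (p k)`_0 (p (odd k))`_0.
Proof.
suff [] : ((size (p k) <= 1)%N -> associated (p k)`_0 (p (odd k))`_0) /\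
  ((size (p k.+1) <= 1)%N -> associated (p k.+1)`_0 (p (odd k.+1))`_0) by [].
elim: k => [|k [IH1 IH2]]; first by split=> _; apply: associated_refl.
split=> // sk; have sk' : (size (p k) <= 1)%N.
  by rewrite (size_pseq At1); move: sk; rewrite (size_pseq At1) /= negbK.
rewrite /= negbK; apply: associated_trans (IH1 sk').
exact: pseq_const_associated.
Qed.

(** From x_k x_(k+2) = E_k and x_(k+2) x_(k+4) = E_(k+2), up to units. *)
Lemma xseq_period4 : (forall k, propto (E k.+2) (E k)) ->
  forall k, propto (x (4 + k)) (x k).
Proof.
move=> pE k; have [u uu eu] := pE k; exists u => //.
by apply: (mulfI (xseq_neq0 At1 k.+2)); rewrite [RHS]mulrCA [x k.+2 * x k]mulrC -eu.
Qed.

(** The exponent m vanishes, so that the exchange Laurent polynomial is the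
constant itself. *)
Lemma exchange_const k : (size (p k.+1) <= 1)%N ->
  (1 < size (p k))%N \/ ~ associated (p k.+1)`_0 (p k)`_0 ->
  E k = h (p k.+1)`_0.
Proof.
move=> sk hk; have [m [le e _]] := pseq_exchange At1 k.
have [ek ik] := pseq_const sk.
suff m0 : m = 0%N by rewrite m0 expr0 mulr1 ek pevC in e.
case: (leqP (size (p k)) 1) hk => [sk' [//|na]|sk' _].
  have [ek' ik'] := pseq_const sk'; rewrite ek ek' in le.
  by have [_] := laurent_exp_const_const ik ik' le; apply.
by move: le; rewrite /laurent_exp leqNgt sk'.
Qed.

Hypothesis sp0 : size (p 0) = 1.

Lemma pseq_even_const k : ~~ odd k -> (size (p k) <= 1)%N.
Proof. by move=> /negbTE ok; rewrite (size_pseq At1) ok sp0. Qed.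

Hypothesis generic : (1 < size (p 1))%N \/ ~ associated (p 1)`_0 (p 0)`_0.

Lemma generic_mod2 k : (size (p k) <= 1)%N -> (size (p k.+1) <= 1)%N ->
  ~ associated (p k.+1)`_0 (p k)`_0.
Proof.
move=> sk sk1 ass.
have := associated_trans (associated_sym (pseq_const_mod2 sk1))
          (associated_trans ass (pseq_const_mod2 sk)).
have sp1 : (size (p 1) <= 1)%N.
  by move: sk sk1; rewrite (size_pseq At1 k) (size_pseq At1 k.+1) /=; case: (odd k).
case: generic => [|na]; first by rewrite ltnNge sp1.
rewrite /=; case: (odd k) => //= /associated_sym //.
Qed.

Lemma exchange_odd k : odd k -> E k = h (p k.+1)`_0.
Proof.
move=> ok; have sk : (size (p k.+1) <= 1)%N by apply: pseq_even_const; rewrite /= ok.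
apply: exchange_const => //; case: (leqP (size (p k)) 1) => sk'; last by left.
by right; apply: generic_mod2.
Qed.

(** At odd positions E_k is the constant q up to units; at even positions E_k is
the exchange Laurent polynomial that mutation at the other position preserves. *)
Lemma exchange_period2 k : propto (E k.+2) (E k).
Proof.
have [ok|ok] := boolP (odd k).
  rewrite !exchange_odd //=; last by rewrite negbK.
  have [u uu ->] : associated (p k.+3)`_0 (p k.+1)`_0.
    by apply: pseq_const_associated; apply: pseq_even_const; rewrite /= ok.
  by exists u => //; exact: (rmorphM h).
have sk := pseq_even_const ok.
have [sk1|sk1] := leqP (size (p k.+1)) 1.
  have sk2 : (size (p k.+2) <= 1)%N by apply: pseq_even_const; rewrite /= negbK.
  have sk3 : (size (p k.+3) <= 1)%N.
    by rewrite (size_pseq At1) /= negbK -/(odd k.+1) -(size_pseq At1).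
  rewrite !exchange_const //; try by right; apply: generic_mod2.
  have [u uu ->] := pseq_const_associated sk1.
  by exists u => //; exact: (rmorphM h).
have sk2 : (size (p k.+2) <= 1)%N by apply: pseq_even_const; rewrite /= negbK.
have sk3 : (1 < size (p k.+3))%N.
  by rewrite (size_pseq At1) /= negbK -/(odd k.+1) -(size_pseq At1).
have [m [lm em _]] := pseq_exchange At1 k.
have [n [ln en _]] := pseq_exchange At1 k.+2.
have [_ [_ _]] := pseq_exchange At1 k.+1.
rewrite leqNgt sk1 /= => -[r [u [hr uu er]]].
have [ek ik] := pseq_const sk; have [ek2 ik2] := pseq_const sk2.
have [w wu ew] := pseq_const_associated sk.
rewrite ek in lm; have lm' := laurent_exp_unit wu lm; rewrite -ew in lm'.
rewrite ek2 in ln.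
have pP : primitive (p k.+1) by apply: seed_primitive sk1; apply: sseq_is_seed.
have pR : primitive (p k.+3) by apply: seed_primitive sk3; apply: sseq_is_seed.
have [[c cu ec] nm] :=
  dual_laurent_exp ik2 pP pR (pseq_coef0 At1 k.+1) hr uu er lm' ln.
have yz : x k.+1 * x k.+3 = h (p k.+2)`_0 by apply: exchange_odd; rewrite /= ok.
have [q0 _ _] := ik2.
apply: propto_sym; exists c => //.
exact: (dual_exchange (@S_to_K_inj S 2) q0 (xseq_neq0 At1 k.+3) yz em en ec nm).
Qed.

Lemma finite_generic_constant : finite_type A.
Proof.
apply: (finite_type_of_period ufd At1 (n := 4)) => // k _.
exact: xseq_period4 exchange_period2 k.
Qed.

End ConstantExchange.

Section AssociatedConstants.
Variables (S : idomainType) (A : lp_algebra S 2).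
Hypothesis ufd : is_ufd S.
Local Notation K := (ambient S 2).
Local Notation h := (@S_to_K S 2).
Variable t1 : lseed S 2.
Hypothesis At1 : lp_seeds A t1.
Local Notation x := (xseq A t1).
Local Notation p := (pseq A t1).
Hypotheses (sp0 : size (p 0) = 1) (sp1 : (size (p 1) <= 1)%N).
Hypothesis ass : associated (p 1)`_0 (p 0)`_0.

Lemma all_const k : (size (p k) <= 1)%N.
Proof. by rewrite (size_pseq At1) //; case: (odd k); rewrite ?sp0. Qed.

Lemma all_associated k : associated (p k)`_0 (p 0)`_0.
Proof.
apply: associated_trans (pseq_const_mod2 At1 (all_const k)) _.
by case: (odd k) => //; apply: associated_refl.
Qed.

(** Here the exchange Laurent polynomials are p / x_{k+1}, so that the product of
three consecutive variables is constant up to units. *)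
Lemma exchange_triple k : x k * x k.+2 * x k.+1 = h (p k.+1)`_0.
Proof.
have [m [le e _]] := pseq_exchange At1 k.
have [ek ik] := pseq_const At1 (all_const k.+1).
have [ek' ik'] := pseq_const At1 (all_const k).
rewrite ek ek' in le; have [m1 _] := laurent_exp_const_const ik ik' le.
rewrite m1 in e; last exact: associated_trans (all_associated _) (associated_sym (all_associated _)).
by rewrite expr1 ek pevC in e.
Qed.

Lemma xseq_period3 k : propto (x k.+3) (x k).
Proof.
have [u uu eu] : associated (p k.+2)`_0 (p k.+1)`_0.
  exact: associated_trans (all_associated _) (associated_sym (all_associated _)).
exists u => //.
apply: (mulfI (mulf_neq0 (xseq_neq0 At1 k.+1) (xseq_neq0 At1 k.+2))).
have e1 := exchange_triple k; have e2 := exchange_triple k.+1.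
have eh : h (p k.+2)`_0 = h u * h (p k.+1)`_0 by rewrite eu; exact: (rmorphM h).
rewrite eh -e1 in e2; rewrite mulrAC e2.
move: (h u) (x k) (x k.+1) (x k.+2) => a b c d.
by rewrite [RHS]mulrCA; congr (_ * _); rewrite [RHS]mulrC -mulrA [d * c]mulrC.
Qed.

Lemma finite_associated_constants : finite_type A.
Proof.
apply: (finite_type_of_period ufd At1 (n := 6)) => // k _.
rewrite -[(6 + k)%N]/(k.+3.+3).
exact: propto_trans (xseq_period3 _) (xseq_period3 _).
Qed.

End AssociatedConstants.

Lemma finite_constant (S : idomainType) (A : lp_algebra S 2) (t1 : lseed S 2) :
  is_ufd S -> lp_seeds A t1 -> size (pseq A t1 0) = 1 -> finite_type A.
Proof.
move=> ufd At1 sp0; have [sp1|sp1] := leqP (size (pseq A t1 1)) 1.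
  have [a|na] := classic (associated (pseq A t1 1)`_0 (pseq A t1 0)`_0).
    exact: (finite_associated_constants ufd At1 sp0 sp1 a).
  by apply: (finite_generic_constant ufd At1 sp0); right.
by apply: (finite_generic_constant ufd At1 sp0); left.
Qed.

(** * Finite type in rank two *)

Theorem theorem6p4 (S : idomainType) (hS : is_ufd S)
    (A : lp_algebra S 2) (t1 : lseed S 2) (ht1 : lp_seeds A t1)
    (P Q : {poly S}) (b c : nat)
    (hF1 : exch t1 ord0 = (map_poly (@mpolyC 2 S) P).['X_ord_max])
    (hF2 : exch t1 ord_max = (map_poly (@mpolyC 2 S) Q).['X_ord0])
    (hP : size P = c.+1) (hQ : size Q = b.+1) (hbc : (b <= c)%N) :
  finite_type A <->
  (b = 0%N \/ (b, c) = (1, 1)%N \/ (b, c) = (1, 2)%N \/ (b, c) = (1, 3)%N).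
Proof.
have o0 : other ord0 = ord_max by apply: val_inj.
have o1 : other ord_max = ord0 by apply: val_inj.
have e0 : pseq A t1 0 = Q by rewrite /pseq /upoly o1 /= hF2 -uniXE uniXK.
have e1 : pseq A t1 1 = P by rewrite -pseqS // /upoly o0 /= hF1 -uniXE uniXK.
split=> [fin|].
  have [b0|b_gt0] := posnP b; first by left.
  right; have [bc4|bc4] := leqP 4 (b * c).
    case: b c hP hQ hbc bc4 b_gt0 => [|b] [|c] //= sP sQ bc bc4 _.
    rewrite -e0 in sQ; rewrite -e1 in sP.
    by case: (infinite_nonconstant ht1 sQ sP bc bc4 fin).
  have [b1|b2] := leqP b 1; last by nia.
  have -> : b = 1%N by lia.
  have c4 : (c < 4)%N by nia.
  case: c hbc c4 {hP bc4} => [|[|[|[|c]]]] //; first by lia.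
  - by left.
  - by right; left.
  - by right; right.
case=> [b0|]; first by apply: (finite_constant hS ht1); rewrite e0 hQ b0.
case=> [[eb ec]|[[eb ec]|[eb ec]]].
- by apply: (finite_linear hS ht1); rewrite ?e0 ?e1 ?hP ?hQ ?eb ?ec.
- by apply: (finite_quadratic hS ht1); rewrite ?e0 ?e1 ?hP ?hQ ?eb ?ec.
- by apply: (finite_cubic hS ht1); rewrite ?e0 ?e1 ?hP ?hQ ?eb ?ec.
Qed.
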